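(* Assume that the weight sequence $\{M_p\}_{p\in\mathbb{N}}$ satisfies $(M.1)$, $(M.2)'$, and $(M.3)'$, and let $\ast$ stand for $(M_p)$ (Beurling case) or $\{M_p\}$ (Roumieu case). Let $f\in\mathcal{D}'^{\ast}(\mathbb{R})$, $q\in\mathbb{R}$, and let $L\in L^{\infty}_{loc}[0,\infty)$ be $O$-slowly varying at infinity. Let $k$ be the smallest positive integer such that $-k\le q$. Then $$f(\lambda x)=O(\lambda^{q}L(\lambda))\qquad\text{as }\lambda\to\infty\text{ in }\mathcal{D}'^{\ast}(\mathbb{R})$$ holds if and only if there are continuous functions $f_m$ on $\mathbb{R}$ $(m\ge k-1)$ such that $$f=\sum_{m=k-1}^{\infty}f_m^{(m)},$$ for some $\ell>0$ in the Beurling case (for any $\ell>0$ in the Roumieu case) there exists $C_\ell>0$ such that $$|f_m(x)|\le C_\ell\frac{\ell^{m}}{M_m}(1+|x|)^{q+m}L(|x|),\qquad x\in\mathbb{R},\ m\ge k-1,$$ and additionally (only) when $q=-k$ $$\int_{-x}^{x}f_{k-1}(t)\,dt=O(L(x)),\qquad x\to\infty.$$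
   Context: $\{M_p\}_{p\in\mathbb{N}}$ is a sequence of positive real numbers ($0\in\mathbb{N}$). Conditions: - $(M.1)$: $M_p^2\le M_{p-1}M_{p+1}$ for $p\ge1$. - $(M.2)'$: $M_{p+1}\le AH^pM_p$, $p\in\mathbb{N}$, for certain constants $A,H$. - $(M.3)'$: $\sum_{p=1}^\infty M_{p-1}/M_p<\infty$. Ultradistribution spaces. Let $\Omega\subseteq\mathbb{R}$ be open. For $K$ a (regular) compact set and $\ell>0$, $\mathcal{D}^{M_p,\ell}_K$ is the space of smooth $\varphi$ supported in $K$ with $\sup_{m\in\mathbb{N}}\sup_{x\in K}\frac{|\varphi^{(m)}(x)|}{\ell^{m}M_m}<\infty$. Then $\mathcal{D}^{(M_p)}(\Omega)=\varinjlim_{K\Subset\Omega}\varprojlim_{\ell\to0^+}\mathcal{D}^{M_p,\ell}_K$ and $\mathcal{D}^{\{M_p\}}(\Omega)=\varinjlim_{K\Subset\Omega}\varinjlim_{\ell\to\infty}\mathcal{D}^{M_p,\ell}_K$. The strong dual of $\mathcal{D}^{\ast}(\Omega)$ is $\mathcal{D}'^{\ast}(\Omega)$. The relation $f(\lambda x)=O(\rho(\lambda))$ as $\lambda\to\infty$ in $\mathcal{D}'^{\ast}(\mathbb{R})$ means that for each $\varphi\in\mathcal{D}^{\ast}(\mathbb{R})$, $\langle f(\lambda x),\varphi(x)\rangle=\lambda^{-1}\langle f(x),\varphi(x/\lambda)\rangle=O(\rho(\lambda))$ as $\lambda\to\infty$. A positive measurable function $L$ is called $O$-slowly varying at infinity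 if for each $\varepsilon>0$ there are $C_\varepsilon,c_\varepsilon,R_\varepsilon>0$ such that $\frac{c_\varepsilon}{\lambda^{\varepsilon}}\le\frac{L(\lambda x)}{L(x)}\le C_\varepsilon\lambda^{\varepsilon}$ for all $\lambda\ge1$ and $x>R_\varepsilon$.
   Formalization: L is additionally assumed to have a positive lower bound on each compact subset of [0,∞); otherwise the claim fails, e.g. f=δ, q=-1, L(p/n)=1/n at reduced rationals in [0,1] and L=1 elsewhere, where the bound forces every f_m to vanish on [-1,1]. *)

(* Defs.v *)
From HB Require Import structures.
From mathcomp Require Import all_boot all_order all_algebra.
From mathcomp Require Import complex.
From mathcomp Require Import all_classical all_reals all_analysis.
From mathcomp Require Import measurable_realfun.

Set Implicit Arguments.
Unset Strict Implicit.
Unset Printing Implicit Defensive.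
Import Order.TTheory GRing.Theory Num.Theory.
Import numFieldNormedType.Exports.
Import Normc.
Local Open Scope classical_set_scope.
Local Open Scope ring_scope.

(* The tag ^o makes the pointwise C-module structure on
   functions, and the norm topology on C, available. *)
Notation cfun R := (R -> (R[i])^o).

Section WeightSequences.
Context {R : realType}.
Implicit Type M : nat -> R.

Definition cond_M1 M := forall p, (1 <= p)%N -> M p ^+ 2 <= M p.-1 * M p.+1.

Definition cond_M2' M := exists A H : R, forall p, M p.+1 <= A * H ^+ p * M p.

Definition cond_M3' M := (\sum_(1 <= p <oo) (M p.-1 / M p)%:E < +oo)%E.

End WeightSequences.

Definition bigO_pinfty {R : realType} (f g : R -> R) :=
  let F : filter_on R := FilterType (pinfty_nbhs R) _ in
  f =O_ F g.

(* The library has no locally convex inductive limits.  A locally convex space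
   is recorded as a linear subset of an ambient C-vector space together with
   its 0-neighbourhoods; a neighbourhood may contain points outside the
   subset, only its trace on the subset matters. *)
Section LocallyConvex.
Context {R : realType} {V : lmodType R[i]}.

Record lcs := Lcs { lc_dom : set V ; lc_nbhs0 : set_system V }.

Implicit Types (X : lcs) (u : V -> R[i]).

Definition absconvex (W : set V) :=
  forall (a b : R[i]) v w, normc a + normc b <= 1 -> W v -> W w ->
    W (a *: v + b *: w).

Definition lc_normed (E : set V) (N : V -> \bar R) : lcs :=
  Lcs E [set U | exists2 e : R, 0 < e &
                 forall v, E v -> (N v < e%:E)%E -> U v].

Definition lc_proj_lim {I : Type} (D : set I) (X : I -> lcs) : lcs :=
  let E := \bigcap_(i in D) lc_dom (X i) in
  Lcs E [set U | exists (J : set I) (W : I -> set V),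
    [/\ finite_set J, J `<=` D, forall i, J i -> lc_nbhs0 (X i) (W i) &
        E `&` \bigcap_(i in J) W i `<=` U]].

(* The finest locally convex topology making all inclusions continuous. *)
Definition lc_ind_lim {I : Type} (D : set I) (X : I -> lcs) : lcs :=
  Lcs (\bigcup_(i in D) lc_dom (X i))
      [set U | exists W : set V,
        [/\ absconvex W, forall i, D i -> lc_nbhs0 (X i) W &
            (\bigcup_(i in D) lc_dom (X i)) `&` W `<=` U]].

Definition lc_bounded X (B : set V) :=
  B `<=` lc_dom X /\
  forall U, lc_nbhs0 X U ->
    exists2 r : R, 0 < r & forall v, B v -> U (r%:C%C *: v).

(* For a linear form, continuity is continuity at 0.  Values outside
   [lc_dom X] are irrelevant junk. *)
Definition lc_dual X u :=
  (forall (a : R[i]) v w, lc_dom X v -> lc_dom X w ->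
     u (a *: v + w) = a * u v + u w) /\
  forall e : R, 0 < e -> lc_nbhs0 X [set v | normc (u v) < e].

Definition strong_cvg X (u_ : nat -> V -> R[i]) u :=
  forall B, lc_bounded X B -> forall e : R, 0 < e ->
    \forall n \near \oo, forall v, B v -> normc (u_ n v - u v) <= e.

End LocallyConvex.
Arguments lcs {R} V.

Section ComplexValued.
Context {R : realType}.
Implicit Types (phi f : cfun R).

(* Derivatives and integrals of functions of a real variable with values in C
   are taken componentwise: the library does not make C a normed R-module. *)
Definition cderiv (n : nat) phi : cfun R :=
  fun x => Complex (derive1n n (@complex.Re R \o phi) x)
                   (derive1n n (@complex.Im R \o phi) x).

Definition csmooth phi := forall n x,
  derivable (derive1n n (@complex.Re R \o phi)) x 1 /\
  derivable (derive1n n (@complex.Im R \o phi)) x 1.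

Definition csupport phi : set R := closure [set x | phi x != 0].

Definition cint (D : set R) f : R[i] :=
  Complex (\int[lebesgue_measure]_(x in D) complex.Re (f x))
          (\int[lebesgue_measure]_(x in D) complex.Im (f x)).

End ComplexValued.

Inductive ultra_case := Beurling | Roumieu.

Section Ultradistributions.
Context {R : realType} (M : nat -> R).

(* ereal_sup of the empty set is -oo, which is harmless: it occurs only for
   K empty, where the space is {0}. *)
Definition ultra_norm (l : R) (K : set R) (phi : cfun R) : \bar R :=
  ereal_sup [set y : \bar R | exists m x, K x /\
    y = (normc (cderiv m phi x) / (l ^+ m * M m))%:E].

Definition ultra_step (l : R) (K : set R) : lcs (cfun R) :=
  lc_normed [set phi : cfun R | [/\ csmooth phi, csupport phi `<=` K &
                                    (ultra_norm l K phi < +oo)%E]]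
            (ultra_norm l K).

Definition ultra_space_on (star : ultra_case) (K : set R) : lcs (cfun R) :=
  match star with
  | Beurling => lc_proj_lim [set l : R | 0 < l] (fun l => ultra_step l K)
  | Roumieu => lc_ind_lim [set l : R | 0 < l] (fun l => ultra_step l K)
  end.

Definition ultra_space (star : ultra_case) : lcs (cfun R) :=
  lc_ind_lim [set K : set R | compact K] (ultra_space_on star).

Definition ultradistribution (star : ultra_case) (f : cfun R -> R[i]) :=
  lc_dual (ultra_space star) f.

Definition regular_ud (g : cfun R) : cfun R -> R[i] :=
  fun phi => cint setT (fun x => g x * phi x).

Definition ud_deriv (m : nat) (f : cfun R -> R[i]) : cfun R -> R[i] :=
  fun phi => (-1) ^+ m * f (cderiv m phi).

Definition ud_dilate (lam : R) (f : cfun R -> R[i]) : cfun R -> R[i] :=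
  fun phi => lam^-1%:C%C * f (fun x => phi (x / lam)).

Definition ud_bigO (star : ultra_case) (f : cfun R -> R[i]) (rho : R -> R) :=
  forall phi, lc_dom (ultra_space star) phi ->
    bigO_pinfty (fun lam => normc (ud_dilate lam f phi)) rho.

(* Convergence in the strong dual. *)
Definition ud_sum (star : ultra_case) (m0 : nat)
    (u_ : nat -> cfun R -> R[i]) (f : cfun R -> R[i]) :=
  strong_cvg (ultra_space star)
    (fun n phi => \sum_(m0 <= m < n) u_ m phi) f.

End Ultradistributions.

Section SlowVariation.
Context {R : realType}.
Implicit Type L : R -> R.

(* Functions on [0, +oo[ are represented by functions on R whose values at
   negative arguments are never used. *)
Definition lebesgue_measurable_fun (D : set R) L :=
  @measurable_fun _ _
    (g_sigma_algebraType (completed_algebra_gen (@lebesgue_measure R))) R D L.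

Definition O_slowly_varying L :=
  [/\ forall x, 0 <= x -> 0 < L x,
      lebesgue_measurable_fun `[0, +oo[ L &
      forall e : R, 0 < e -> exists C c r : R,
        [/\ 0 < C, 0 < c, 0 < r &
            forall lam x, 1 <= lam -> r < x ->
              c / lam `^ e <= L (lam * x) / L x <= C * lam `^ e]].

Definition Linfty_loc L := forall K : set R, compact K -> K `<=` `[0, +oo[ ->
  finite_norm lebesgue_measure +oo%E (L \_ K).

(* Positivity of a weight on [0, +oo[ is understood locally uniformly.
   Mere pointwise positivity would let L be arbitrarily small near some
   x0 >= 0, and a continuous function dominated by a multiple of L(|x|) would
   have to vanish, or be arbitrarily flat, at x0; growth at infinity says
   nothing of the sort. *)
Definition locally_bounded_below L :=
  forall K : set R, compact K -> K `<=` `[0, +oo[ ->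
    exists2 c : R, 0 < c & forall x, K x -> c <= L x.

End SlowVariation.

Definition structure_bound {R : realType} (star : ultra_case) (M : nat -> R)
    (q : R) (L : R -> R) (m0 : nat) (F : nat -> cfun R) :=
  let bound (l : R) := exists2 C : R, 0 < C & forall m x, (m0 <= m)%N ->
    normc (F m x) <= C * (l ^+ m / M m) * (1 + `|x|) `^ (q + m%:R) * L `|x| in
  match star with
  | Beurling => exists2 l : R, 0 < l & bound l
  | Roumieu => forall l : R, 0 < l -> bound l
  end.

(* Main.v *)
Require Import Defs.
From HB Require Import structures.
From mathcomp Require Import all_boot all_order all_algebra.
From mathcomp Require Import complex.
From mathcomp Require Import all_classical all_reals all_analysis.
From mathcomp Require Import ring lra zify.

Set Implicit Arguments.
Unset Strict Implicit.
Unset Printing Implicit Defensive.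
Import Order.TTheory GRing.Theory Num.Theory.
Import numFieldNormedType.Exports.
Import Normc.
Local Open Scope classical_set_scope.
Local Open Scope ring_scope.

(** The real and imaginary parts of [f] are treated as functionals [v] on real
    test functions.  If the dilates of [v] are [O(lambda^(q+1) L(lambda))], then
    the functionals [phi |-> v (phi (x / 2^n)) / (2^n rho_n)], with
    [rho_n = 2^(nq) L(2^n)], are pointwise bounded, hence uniformly bounded by a
    gliding hump argument.  On test functions supported in [[-1/2, 1/2]] they
    are expanded in Fourier series; the term of frequency [j] is integrated by
    parts about as many times as the index [m] maximizing [(t j)^m / M_m], and
    collecting the terms by order gives continuous densities bounded by
    [l^m / M_m] uniformly in [n].  Multiplied by dyadic shells, rescaled and
    added up, they represent [v] with densities of all orders [m >= 0] obeying
    the weight [(1 + |x|)^(q+m) L(|x|)].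

    Testing [v] against dilates of a cut-off of [x^j / j!] estimates the
    integral over [[-x, x]] of the density of lowest order [j].  If [q + j < -1]
    this integral tends to [0], so the density has a primitive decaying at both
    ends, which can be moved into the density of order [j + 1]; this is repeated
    up to order [k - 1].  If [q + j = -1] the estimate is the integral condition.

    Conversely, the orders with [q + m > -1] can be estimated term by term, and
    the order with [q + m = -1], which occurs only if [q = -k], is where the
    integral condition is needed. *)

(** * Calculus of smooth functions *)

Section RealDerivatives.
Context {R : realType}.
Implicit Types (f g : R -> R) (x a b c : R).

(** What has to be gained is uniformity in the scale. A sequence of scales is enough for it: the
    weight changes by a bounded factor between consecutive powers of two, and a sequence of
    functionals is what a gliding hump can handle. By [(M.2)'] a bounded number of extra derivatives
    costs a geometric factor; so each frequency is integrated by parts three or four times beyond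
    the optimal order, just enough for summability over the frequencies. The resulting densities are
    trigonometric and do not vanish outside the shell; cutting them off replaces each by a Leibniz
    series, which converges because the growth parameters of the densities and of the cut-off can be
    given a small product. A pair of dual quantifiers over these parameters treats the two cases at
    once. The exponent [-1] is critical because the integral of [L(t) / (1 + t)] over [[0, x]] need
    not be [O(L(x))]: above it the integral of a density is governed by the far end of the interval,
    below it the tails are governed by the near end. Since [L] is only essentially bounded near the
    origin, it is first replaced by a weight [W] with Potter bounds on the whole half-line. *)

Lemma is_deriveDr f g x a b : is_derive x (1 : R) f a -> is_derive x (1 : R) g b ->
  is_derive x (1 : R) (fun y => f y + g y) (a + b).
Proof. exact: is_deriveD. Qed.

Lemma is_deriveNr f x a : is_derive x (1 : R) f a ->
  is_derive x (1 : R) (fun y => - f y) (- a).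
Proof. exact: is_deriveN. Qed.

Lemma is_deriveZr f x a c : is_derive x (1 : R) f a ->
  is_derive x (1 : R) (fun y => c * f y) (c * a).
Proof. by move=> df; apply: is_deriveZ. Qed.

Lemma is_deriveMr f g x a b : is_derive x (1 : R) f a -> is_derive x (1 : R) g b ->
  is_derive x (1 : R) (fun y => f y * g y) (a * g x + f x * b).
Proof.
move=> df dg; apply: is_derive_eq (is_deriveM _ _) _.
by rewrite /GRing.scale /= addrC mulrC.
Qed.

Lemma is_derive_compr f g x a b : is_derive (g x) (1 : R) f a ->
  is_derive x (1 : R) g b -> is_derive x (1 : R) (fun y => f (g y)) (a * b).
Proof. by move=> df dg; apply: is_derive1_comp. Qed.

Lemma is_derive_idr x : is_derive x (1 : R) (fun y => y) 1.
Proof. exact: is_derive_id. Qed.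

Lemma is_derive_cstr x c : is_derive x (1 : R) (fun=> c) 0.
Proof. exact: is_derive_cst. Qed.

End RealDerivatives.

Section Towers.
Context {R : realType}.
Implicit Types (f g : R -> R) (F G : nat -> R -> R).

(* A record rather than a definition: proof search must not unfold it to limits. *)
Record smooth f : Prop := Smooth {
  smooth_derivable : forall n x, derivable (derive1n n f) x (1 : R) }.

(** An explicit sequence of successive derivatives. Rules for [derive1n] are proved by exhibiting
    such a sequence and reading it off with [tower_derive1n]. *)
Definition tower F := forall n (x : R), is_derive x (1 : R) (F n) (F n.+1 x).

Lemma smooth_tower f : smooth f -> tower (fun n => derive1n n f).
Proof.
move=> sf n x; rewrite derive1nS derive1E.
by apply: DeriveDef; [exact: smooth_derivable|].
Qed.

Lemma tower_derive1n F n : tower F -> derive1n n (F 0%N) = F n.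
Proof.
move=> tF; elim: n => [//|n IH]; rewrite derive1nS IH.
by apply/funext => x; rewrite derive1E; have [_ ->] := tF n x.
Qed.

Lemma tower_smooth F : tower F -> smooth (F 0%N).
Proof. by move=> tF; split=> n x; rewrite tower_derive1n //; have [] := tF n x. Qed.

Lemma derive1nSr n f : derive1n n.+1 f = derive1n n (derive1n 1 f).
Proof. by rewrite /derive1n iterSr. Qed.

Lemma derive1nD n m f : derive1n (n + m) f = derive1n n (derive1n m f).
Proof. by rewrite /derive1n iterD. Qed.

Lemma smooth_derive1n f m : smooth f -> smooth (derive1n m f).
Proof. by move=> sf; split=> n x; rewrite -derive1nD; apply: smooth_derivable. Qed.

Lemma towerD F G : tower F -> tower G -> tower (fun n x => F n x + G n x).
Proof. by move=> tF tG n x; apply: is_deriveDr. Qed.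

Lemma tower0 : tower (fun _ _ => 0).
Proof. by move=> n x; apply: is_derive_cstr. Qed.

Lemma towerZ c F : tower F -> tower (fun n x => c * F n x).
Proof. by move=> tF n x; apply: is_deriveZr. Qed.

Lemma tower_scale c F : tower F -> tower (fun n x => c ^+ n * F n (c * x)).
Proof.
move=> tF n x; have d1 := is_deriveZr c (is_derive_idr x).
apply: is_derive_eq (is_deriveZr (c ^+ n) (is_derive_compr (tF n (c * x)) d1)) _.
by rewrite exprS; ring.
Qed.

Lemma tower_sum (I : Type) (s : seq I) (F : I -> nat -> R -> R) :
  (forall i, tower (F i)) -> tower (fun n x => \sum_(i <- s) F i n x).
Proof.
move=> tF; elim: s => [|i s IH] n x.
  under eq_fun do rewrite big_nil.
  by rewrite big_nil; apply: is_derive_cst.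
under eq_fun do rewrite big_cons.
by rewrite big_cons; apply: is_deriveD; [apply: tF|apply: IH].
Qed.

(** Leibniz' rule: differentiating the two factors gives two sums shifted against each other, and
    Pascal's rule recombines the binomial coefficients. *)
Lemma towerM F G : tower F -> tower G ->
  tower (fun n x => \sum_(i < n.+1) 'C(n, i)%:R * F i x * G (n - i)%N x).
Proof.
move=> tF tG n x.
have dt (i : 'I_n.+1) : is_derive x 1 (fun x => 'C(n, i)%:R * F i x * G (n - i)%N x)
    ('C(n, i)%:R * (F i.+1 x * G (n - i)%N x + F i x * G (n - i).+1 x)).
  apply: is_derive_eq (is_deriveMr (is_deriveZr _ (tF i x)) (tG (n - i)%N x)) _.
  ring.
have -> : (fun x => \sum_(i < n.+1) 'C(n, i)%:R * F i x * G (n - i)%N x) =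
   \sum_(i < n.+1) (fun x => 'C(n, i)%:R * F i x * G (n - i)%N x).
  by apply/funext => y; rewrite fct_sumE.
apply: is_derive_eq (@is_derive_sum _ _ _ _ _ _ _ _ dt) _.
under eq_bigr => i _ do rewrite mulrDr !mulrA.
rewrite big_split /= [X in X + _ = _]big_ord_recr [X in _ + X = _]big_ord_recl /=.
rewrite [RHS]big_ord_recl [in RHS]big_ord_recr /= !bin0 !binn !subnn !subn0 !mul1r.
rewrite [LHS]addrCA; congr (_ + _); rewrite addrAC; congr (_ + _).
rewrite -big_split /=; apply: eq_bigr => i _.
rewrite /bump /= !add1n binS natrD !mulrDl -subSn //.
by rewrite subSS addrC.
Qed.

Lemma smoothD f g : smooth f -> smooth g -> smooth (fun x => f x + g x).
Proof. by move=> /smooth_tower + /smooth_tower => /towerD/[apply]/tower_smooth. Qed.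

Lemma smoothZ c f : smooth f -> smooth (fun x => c * f x).
Proof. by move=> /smooth_tower/(towerZ c)/tower_smooth. Qed.

Lemma derive1n_add n f g : smooth f -> smooth g ->
  derive1n n (fun x => f x + g x) = fun x => derive1n n f x + derive1n n g x.
Proof.
by move=> /smooth_tower + /smooth_tower => /towerD/[apply]/(tower_derive1n n).
Qed.

Lemma derive1n_scale n c f : smooth f ->
  derive1n n (fun x => c * f x) = fun x => c * derive1n n f x.
Proof. by move=> /smooth_tower/(towerZ c)/(tower_derive1n n). Qed.

Lemma smooth_dilate c f : smooth f -> smooth (fun x => f (c * x)).
Proof.
move=> /smooth_tower/(tower_scale c)/tower_smooth/=.
by under eq_fun do rewrite mul1r.
Qed.

Lemma derive1n_dilate n c f : smooth f ->
  derive1n n (fun x => f (c * x)) = fun x => c ^+ n * derive1n n f (c * x).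
Proof.
move=> /smooth_tower/(tower_scale c)/(tower_derive1n n)/=.
by under eq_fun do rewrite mul1r.
Qed.

Lemma smoothM f g : smooth f -> smooth g -> smooth (fun x => f x * g x).
Proof.
move=> /smooth_tower + /smooth_tower => /towerM/[apply]/tower_smooth/=.
by under eq_fun do rewrite big_ord1 bin0 mul1r.
Qed.

Lemma derive1n_mul n f g : smooth f -> smooth g ->
  derive1n n (fun x => f x * g x) =
  fun x => \sum_(i < n.+1) 'C(n, i)%:R * derive1n i f x * derive1n (n - i) g x.
Proof.
move=> /smooth_tower + /smooth_tower => /towerM/[apply]/(tower_derive1n n)/=.
by under eq_fun do rewrite big_ord1 bin0 mul1r.
Qed.

Lemma is_derive_continuous f g : (forall x : R, is_derive x (1 : R) f (g x)) -> continuous f.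
Proof.
move=> df x; apply/differentiable_continuous/derivable1_diffP.
by have [] := df x.
Qed.

Lemma smooth_continuous f n : smooth f -> continuous (derive1n n f).
Proof. by move=> sf; apply: is_derive_continuous (smooth_tower sf n). Qed.

End Towers.

(** * Primitives and oriented integrals of continuous functions *)

Section Integral.
Context {R : realType}.
Implicit Types (F G f g : R -> R) (a b c r x : R).
Local Notation mu := (@lebesgue_measure R).

Lemma contD f g : continuous f -> continuous g -> continuous (fun x => f x + g x).
Proof. by move=> cf cg x; apply: continuousD; [apply: cf|apply: cg]. Qed.

Lemma contM f g : continuous f -> continuous g -> continuous (fun x => f x * g x).
Proof. by move=> cf cg x; apply: continuousM; [apply: cf|apply: cg]. Qed.

Lemma contN f : continuous f -> continuous (fun x => - f x).
Proof. by move=> cf x; apply: continuousN; apply: cf. Qed.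

Lemma contB f g : continuous f -> continuous g -> continuous (fun x => f x - g x).
Proof. by move=> cf /contN; apply: contD. Qed.

Lemma cont_cst c : continuous (fun _ : R => c).
Proof. exact: cst_continuous. Qed.

Lemma contZ c f : continuous f -> continuous (fun x => c * f x).
Proof. exact/contM/cont_cst. Qed.

Lemma cont_comp f g : continuous f -> continuous g -> continuous (fun x => f (g x)).
Proof. by move=> cf cg x; apply: continuous_comp; [apply: cg|apply: cf]. Qed.

Lemma cont_id : continuous (fun x : R => x).
Proof. by move=> x; exact: cvg_id. Qed.

Lemma continuous_norm f : continuous f -> continuous (fun x => `|f x|).
Proof. by apply: cont_comp; apply: norm_continuous. Qed.

Lemma continuous_scale c f : continuous f -> continuous (fun x => f (c * x)).
Proof. by move=> cf; apply: cont_comp => //; apply/contZ/cont_id. Qed.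

Lemma continuous_sum (I : Type) (s : seq I) (f : I -> R -> R) :
  (forall i, continuous (f i)) -> continuous (fun x => \sum_(i <- s) f i x).
Proof.
move=> cf; elim: s => [|i s IH].
  by under eq_fun do rewrite big_nil; exact: cont_cst.
by under eq_fun do rewrite big_cons; apply: contD.
Qed.

Lemma continuous_integrable_itv g a b : continuous g ->
  mu.-integrable `[a, b] (EFin \o g).
Proof.
move=> cg; apply: continuous_compact_integrable; first exact: segment_compact.
exact: continuous_subspaceT.
Qed.

(** The fundamental theorem is applied from the base points [-n]. Normalized at [0], the primitives
    for different [n] agree where both are defined, so that [n] may depend on the point. *)
Lemma continuous_primitive g : continuous g ->
  exists G : R -> R, forall x, is_derive x (1 : R) G (g x).
Proof.
move=> cg.
pose Int a x := \int[mu]_(t in `[a, x]) g t.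
pose H (n : nat) x := Int (- n%:R) x - Int (- n%:R) 0.
have HE (n m : nat) x : (n <= m)%N -> - n%:R <= x -> H m x = H n x.
  move=> nm nx.
  have sub y : - n%:R <= y -> Int (- m%:R) y - Int (- m%:R) (- n%:R) = Int (- n%:R) y.
    move=> ny; rewrite /Int Rintegral_itvB.
    - rewrite Rintegral_itv_obnd_cbnd //.
      apply: (integrableS _ _ _ (continuous_integrable_itv (- n%:R) y cg)) => //.
      by apply: subset_itvr; rewrite bnd_simp.
    - exact: continuous_integrable_itv.
    - by rewrite bnd_simp lerN2 ler_nat.
    - by rewrite bnd_simp.
  by rewrite /H -(sub x nx) -(sub 0) ?oppr_le0 //; ring.
pose N x := (Num.truncn `|x|).+1.
have NP x : - (N x)%:R < x.
  by rewrite ltrNl; apply: le_lt_trans (truncnS_gt _); rewrite -normrN ler_norm.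
exists (fun x => H (N x) x) => x.
(* The base point [-(N x + 1)] serves all [y] near [x], because [N y <= N x + 1] there. *)
have dH : is_derive x 1 (H (N x).+1) (g x).
  have lx : - (N x).+1%:R < x.
    by apply: lt_trans (NP x); rewrite ltrN2 ltr_nat.
  have ix : mu.-integrable `[- (N x).+1%:R, x + 1] (EFin \o g).
    exact: continuous_integrable_itv.
  have xx1 : x < x + 1 by rewrite ltrDl.
  have [d1 d2] := continuous_FTC1_closed xx1 ix lx (cg x).
  have dI : is_derive x 1 (Int (- (N x).+1%:R)) (g x).
    exact: DeriveDef d1 (etrans (esym (derive1E _ _)) d2).
  apply: is_derive_eq (is_deriveDr dI (is_derive_cstr _ _)) _.
  by rewrite addr0.
apply: near_eq_is_derive dH.
  near=> y.
  have y1 : - (N x).+1%:R <= y.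
    apply: ltW; near: y; apply: lt_nbhsr.
    by apply: lt_trans (NP x); rewrite ltrN2 ltr_nat.
  have y2 : (N y <= (N x).+1)%N.
    rewrite ltnS /N; have xy1 : `|y| < `|x| + 1.
      rewrite -ltrBlDl; apply: (le_lt_trans (lerB_dist _ _)).
      by rewrite distrC; near: y; exists 1 => //=.
    rewrite -ltnS -(ltr_nat R); apply: le_lt_trans (_ : `|y| < _); last first.
      by apply: lt_le_trans xy1 _; rewrite -natr1 lerD2r; exact/ltW/truncnS_gt.
    by have /andP[] := truncn_itv (normr_ge0 y).
  by apply: HE => //; apply: ltW.
Unshelve. all: by end_near. Qed.

Definition prim g : R -> R :=
  if pselect (continuous g) is left cg then sval (cid (continuous_primitive cg))
  else cst 0.

Lemma is_derive_prim g x : continuous g -> is_derive x (1 : R) (prim g) (g x).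
Proof. by rewrite /prim => cg; case: pselect => // ?; case: cid. Qed.

(** Oriented integral: additivity over intervals and integration by parts hold without a condition
    on the order of the endpoints. *)
Definition itg a b g := prim g b - prim g a.

(* Wrapped in a definition so that rewriting with [itg_prim] does not trigger
   type class resolution. *)
Definition primitive_of G g := forall x, is_derive x (1 : R) G (g x).

Lemma itg_prim G g a b : continuous g -> primitive_of G g ->
  itg a b g = G b - G a.
Proof.
move=> cg dG; apply/eqP; rewrite /itg -subr_eq0; apply/eqP.
have d x : is_derive x (1 : R) (fun x => prim g x - G x) 0.
  apply: is_derive_eq (is_deriveDr (is_derive_prim x cg) (is_deriveNr (dG x))) _.
  by rewrite subrr.
by have := is_derive_0_is_cst b a d; rewrite /= => /eqP; rewrite -subr_eq0 => /eqP <-; ring.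
Qed.

Lemma itgE g a b : continuous g -> a <= b -> \int[mu]_(x in `[a, b]) g x = itg a b g.
Proof.
move=> cg; rewrite le_eqVlt => /predU1P[->|ab].
  by rewrite set_itv1 Rintegral_set1 /itg subrr.
have cG := is_derive_continuous (fun x => is_derive_prim x cg).
rewrite /Rintegral (@continuous_FTC2 _ _ (prim g)) //.
- exact: continuous_subspaceT.
- split=> [x _||]; first by have [] := is_derive_prim x cg.
  + exact/cvg_at_right_filter/cG.
  + exact/cvg_at_left_filter/cG.
- by move=> x _; rewrite derive1E; have [_ ->] := is_derive_prim x cg.
Qed.

Lemma itgD f g a b : continuous f -> continuous g ->
  itg a b (fun x => f x + g x) = itg a b f + itg a b g.
Proof.
move=> cf cg; rewrite (@itg_prim (fun x => prim f x + prim g x)).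
- by rewrite /itg; ring.
- exact: contD.
- by move=> x; apply: is_deriveDr; apply: is_derive_prim.
Qed.

Lemma itgZ c f a b : continuous f -> itg a b (fun x => c * f x) = c * itg a b f.
Proof.
move=> cf; rewrite (@itg_prim (fun x => c * prim f x)).
- by rewrite /itg; ring.
- exact: contZ.
- by move=> x; apply: is_deriveZr; apply: is_derive_prim.
Qed.

Lemma itgN f a b : continuous f -> itg a b (fun x => - f x) = - itg a b f.
Proof.
by move=> cf; rewrite -mulN1r -itgZ //; congr itg; apply/funext => x; rewrite mulN1r.
Qed.

Lemma itgB f g a b : continuous f -> continuous g ->
  itg a b (fun x => f x - g x) = itg a b f - itg a b g.
Proof.
by move=> cf cg; rewrite itgD ?itgN //; apply: contN.
Qed.

Lemma itg_sum (I : Type) (s : seq I) (f : I -> R -> R) a b :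
  (forall i, continuous (f i)) ->
  itg a b (fun x => \sum_(i <- s) f i x) = \sum_(i <- s) itg a b (f i).
Proof.
move=> cf; rewrite (@itg_prim (fun x => \sum_(i <- s) prim (f i) x)).
- by rewrite -sumrB.
- exact: continuous_sum.
- elim: s => [|i s IH] x.
    by under eq_fun do rewrite big_nil; rewrite big_nil; apply: is_derive_cst.
  under eq_fun do rewrite big_cons.
  by rewrite big_cons; apply: is_deriveDr; [apply: is_derive_prim|apply: IH].
Qed.

Lemma itg_cst c a b : itg a b (fun=> c) = c * (b - a).
Proof.
rewrite (@itg_prim (fun x => c * x)); first by rewrite mulrBr.
  exact: cst_continuous.
by move=> x; apply: is_derive_eq (is_deriveZr c (is_derive_idr x)) _; rewrite mulr1.
Qed.

Lemma itg_le f g a b : continuous f -> continuous g -> a <= b ->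
  (forall x, a <= x <= b -> f x <= g x) -> itg a b f <= itg a b g.
Proof.
move=> cf cg ab fg; rewrite -subr_ge0 -itgB //.
have cgf : continuous (fun x => g x - f x).
  exact: contB.
have d x := is_derive_prim x cgf.
have [|c cab e] := MVT_segment ab (fun x _ => d x).
  exact/continuous_subspaceT/is_derive_continuous.
rewrite /itg e mulr_ge0 ?subr_ge0 //; apply: fg; move: cab.
by rewrite in_itv.
Qed.

Lemma eq_itg f g a b : continuous f -> continuous g -> a <= b ->
  (forall x, a <= x <= b -> f x = g x) -> itg a b f = itg a b g.
Proof.
by move=> cf cg ab fg; apply/eqP; rewrite eq_le !itg_le // => x xab; rewrite fg.
Qed.

Lemma itg_norm f g a b : continuous f -> continuous g -> a <= b ->
  (forall x, a <= x <= b -> `|f x| <= g x) -> `|itg a b f| <= itg a b g.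
Proof.
move=> cf cg ab fg; rewrite ler_norml -itgN // !itg_le //.
- by move=> x /fg; rewrite ler_norml => /andP[].
- exact: contN.
- by move=> x /fg; rewrite ler_norml => /andP[].
Qed.

Lemma itg_bound f a b B : continuous f -> a <= b ->
  (forall x, a <= x <= b -> `|f x| <= B) -> `|itg a b f| <= B * (b - a).
Proof.
by move=> cf ab fB; rewrite -itg_cst; apply: itg_norm => //; apply: cst_continuous.
Qed.

Lemma itg_chasles b a c f : itg a c f = itg a b f + itg b c f.
Proof. by rewrite /itg; ring. Qed.

Lemma itg_eq0 f a b : continuous f -> a <= b ->
  (forall x, a <= x <= b -> f x = 0) -> itg a b f = 0.
Proof.
move=> cf ab f0; apply/normr0_eq0/le_anti; rewrite normr_ge0 andbT.
rewrite -[leRHS](mul0r (b - a)); apply: itg_bound => // x /f0 ->.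
by rewrite normr0.
Qed.

Lemma itg_scale c f a b : continuous f ->
  c * itg a b (fun x => f (c * x)) = itg (c * a) (c * b) f.
Proof.
move=> cf; rewrite -itgZ; last exact: continuous_scale.
rewrite (@itg_prim (fun x => prim f (c * x))) //.
  exact/contZ/continuous_scale.
move=> x; rewrite mulrC; apply: is_derive_eq.
  exact: is_derive_compr (is_derive_prim _ cf) (is_deriveZr c (is_derive_idr x)).
by rewrite mulr1.
Qed.

Lemma itg_parts F G f g a b : continuous f -> continuous g ->
  (forall x, is_derive x (1 : R) F (f x)) -> (forall x, is_derive x (1 : R) G (g x)) ->
  itg a b (fun x => F x * g x) =
  F b * G b - F a * G a - itg a b (fun x => f x * G x).
Proof.
move=> cf cg dF dG; apply/eqP; rewrite eq_sym subr_eq eq_sym; apply/eqP.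
have cF := is_derive_continuous dF; have cG := is_derive_continuous dG.
have c1 : continuous (fun x => F x * g x).
  exact: contM.
have c2 : continuous (fun x => f x * G x).
  exact: contM.
rewrite addrC -itgD // (@itg_prim (fun x => F x * G x)) //.
  exact: contD.
by move=> x; apply: is_deriveMr.
Qed.

Lemma RintegralT_itg f r : continuous f -> 0 <= r ->
  (forall x, r < `|x| -> f x = 0) -> \int[mu]_x f x = itg (- r) r f.
Proof.
move=> cf r0 f0; rewrite -itgE ?ge0_cp // [RHS]Rintegral_mkcond.
apply: eq_Rintegral => x _; rewrite patchE; case: ifPn => //.
rewrite notin_setE /= in_itv /= => /negP; rewrite -ler_norml -ltNge => /f0.
by [].
Qed.

End Integral.

(** * Limits of real sequences with explicit thresholds *)

Section Sequences.
Context {R : realType}.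
Implicit Types (u v : nat -> R) (l c : R).

Definition tends u l := forall e : R, 0 < e ->
  exists N, forall n, (N <= n)%N -> `|u n - l| <= e.

Lemma tendsP u l : tends u l <-> u @ \oo --> l.
Proof.
split=> [ul|/cvgrPdist_le ul].
  apply/cvgrPdist_le => e /ul[N uN]; exists N => // n /= /uN.
  by rewrite distrC.
move=> e /ul[N _ uN]; exists N => n Nn; rewrite distrC; exact: uN.
Qed.

Lemma tends_dist u l a c j : tends u l ->
  (forall n, (j <= n)%N -> `|u n - a| <= c) -> `|l - a| <= c.
Proof.
move=> ul ua; apply/ler_addgt0Pr => e /ul[N uN].
have := uN (maxn N j) (leq_maxl _ _); have := ua (maxn N j) (leq_maxr _ _).
set t := u _; move=> h1 h2; rewrite [l - a](_ : _ = (t - a) - (t - l)); last by ring.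
by apply: le_trans (ler_normB _ _) _; apply: lerD.
Qed.

Lemma tends_ge u l c j : tends u l -> (forall n, (j <= n)%N -> c <= u n) -> c <= l.
Proof.
move=> ul uc; apply/ler_addgt0Pr => e /ul[N uN].
have := uN (maxn N j) (leq_maxl _ _); have := uc (maxn N j) (leq_maxr _ _).
set t := u _; move=> h1; rewrite ler_norml => /andP[_ h2]; lra.
Qed.

Lemma tends_cauchy u : (forall e : R, 0 < e -> exists N, forall n m, (N <= n)%N ->
  (n <= m)%N -> `|u m - u n| <= e) -> exists l, tends u l.
Proof.
move=> cu; have : cvg (u @ \oo).
  apply/cauchy_cvgP/cauchy_exP => e e0.
  have [N uN] := cu (e / 2) (divr_gt0 e0 (ltr0n _ 2)).
  exists (u N); exists N => // n /= Nn; rewrite /ball /= distrC.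
  by apply: le_lt_trans (uN _ _ (leqnn N) Nn) _; lra.
by move=> /tendsP ul; exists (lim (u @ \oo)).
Qed.

Lemma tends_squeeze u l v : tends v 0 -> (forall n, `|u n - l| <= v n) -> tends u l.
Proof.
move=> v0 uv e /v0[N vN]; exists N => n /vN; rewrite subr0 => ve.
by apply: le_trans (uv n) _; apply: le_trans (ler_norm _) ve.
Qed.

Lemma tends_shift u l k : tends u l -> tends (fun j => u (k + j)%N) l.
Proof.
move=> ul d /ul[N uN]; exists N => n Nn; apply: uN.
exact: leq_trans (leq_addl _ _).
Qed.

Lemma tendsD u v l k : tends u l -> tends v k -> tends (fun n => u n + v n) (l + k).
Proof. by move=> /tendsP ul /tendsP vk; apply/tendsP; apply: cvgD. Qed.

Lemma tendsZ a u l : tends u l -> tends (fun n => a * u n) (a * l).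
Proof. by move=> /tendsP ul; apply/tendsP; apply: cvgMl_tmp. Qed.

Lemma tends_cst l : tends (fun=> l) l.
Proof. by apply/tendsP; apply: cvg_cst. Qed.

Lemma tends_unique u l k : tends u l -> tends u k -> l = k.
Proof. by move=> /tendsP/(cvg_lim (@Rhausdorff R)) <- /tendsP/(cvg_lim (@Rhausdorff R)) <-. Qed.

Lemma tends_sum (I : Type) (s : seq I) (u : I -> nat -> R) (l : I -> R) :
  (forall i, tends (u i) (l i)) -> tends (fun n => \sum_(i <- s) u i n) (\sum_(i <- s) l i).
Proof.
move=> ul; elim: s => [|i s IH].
  by under eq_fun do rewrite big_nil; rewrite big_nil; apply: tends_cst.
by under eq_fun do rewrite big_cons; rewrite big_cons; apply: tendsD.
Qed.

Lemma tends_half : tends (fun n => 2^-1 ^+ n) 0.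
Proof. by apply/tendsP; apply: cvg_expr; rewrite ger0_norm; lra. Qed.

End Sequences.

(** * Limits of smooth functions *)

Section SmoothLimits.
Context {R : realType}.
Implicit Types (f g : R -> R) (x d : R).

Lemma is_deriveP_dist f x d :
  (forall e : R, 0 < e -> exists2 r : R, 0 < r & forall h, `|h| < r ->
     `|f (x + h) - f x - h * d| <= e * `|h|) -> is_derive x (1 : R) f d.
Proof.
move=> fd.
have c : (fun h : R => h^-1 *: ((f \o shift x) (h *: (1 : R)) - f x)) @ 0^' --> d.
  apply/cvgrPdist_le => e /fd[r r0 fr]; exists r => // h /=; rewrite sub0r normrN => hr h0.
  rewrite /GRing.scale /= mulr1 (addrC h) distrC.
  have hn0 : `|h| != 0 by rewrite normr_eq0.
  rewrite [X in `|X|](_ : _ = h^-1 * (f (x + h) - f x - h * d)); last by field.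
  by rewrite normrM normfV mulrC ler_pdivrMr ?normr_gt0 //; apply: fr.
by apply: DeriveDef; [apply/cvgP/c|apply: cvg_lim c => //; apply: Rhausdorff].
Qed.

Lemma is_derive_dist f x d : is_derive x (1 : R) f d ->
  forall e : R, 0 < e -> exists2 r : R, 0 < r & forall h, `|h| < r ->
     `|f (x + h) - f x - h * d| <= e * `|h|.
Proof.
move=> [fd <-] e e0.
have fd' : (fun h : R => h^-1 *: ((f \o shift x) (h *: (1 : R)) - f x)) @ 0^' --> 'D_1 f x.
  exact: fd.
have /cvgrPdist_le/(_ _ e0)[r /= r0 fr] := fd'.
exists r => // h hr; have [->|h0] := eqVneq h 0.
  by rewrite addr0 mul0r !subrr normr0 mulr0.
have := fr h; rewrite /= sub0r normrN => /(_ hr h0).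
rewrite /GRing.scale /= mulr1 (addrC h) distrC.
rewrite -(ler_pM2r (_ : 0 < `|h|)) ?normr_gt0 //; apply: le_trans.
rewrite -normrM le_eqVlt; apply/orP; left; apply/eqP; congr `|_|.
by field.
Qed.

Lemma lipschitz_derive f g c a b : (forall x, is_derive x (1 : R) f (g x)) ->
  (forall x, `|g x| <= c) -> `|f b - f a| <= c * `|b - a|.
Proof.
move=> df gc; wlog ab : a b / a <= b.
  by move=> H; case: (leP a b) => [/H//|/ltW/H]; rewrite distrC (distrC b a).
have [|z _ ->] := MVT_segment ab (fun x _ => df x).
  exact/continuous_subspaceT/is_derive_continuous.
by rewrite normrM ler_wpM2r.
Qed.

(** Only the derivatives have to converge uniformly: by the mean value theorem the increments of
    [h l - h N] over a step [t] are at most [e N |t|], a bound that survives [l -> oo]. *)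
Lemma is_derive_lim (h k : nat -> R -> R) (H K : R -> R) (e : nat -> R) :
  tends e 0 -> (forall j x, is_derive x (1 : R) (h j) (k j x)) ->
  (forall j l x, (j <= l)%N -> `|k l x - k j x| <= e j) ->
  (forall x, tends (h ^~ x) (H x)) -> (forall j x, `|K x - k j x| <= e j) ->
  forall x, is_derive x (1 : R) H (K x).
Proof.
move=> e0 dh ke hH Kk x; apply: is_deriveP_dist => d d0.
have [N /(_ N (leqnn N))] := e0 (d / 4) (divr_gt0 d0 (ltr0n _ 4)).
rewrite subr0 => /(le_trans (ler_norm _)) eN.
have [r r0 hr] := is_derive_dist (dh N x) (divr_gt0 d0 (ltr0n _ 4)).
exists r => // t tr; have A1 := hr t tr.
have A2 : `|(H (x + t) - H x) - (h N (x + t) - h N x)| <= d / 4 * `|t|.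
  have tHt : tends (fun l => h l (x + t) + -1 * h l x) (H (x + t) + -1 * H x).
    exact/tendsD/tendsZ/hH.
  have := @tends_dist _ _ _ (h N (x + t) - h N x) (d / 4 * `|t|) N tHt.
  rewrite mulN1r; apply => l Nl; rewrite mulN1r.
  have dl y : is_derive y (1 : R) (fun y => h l y - h N y) (k l y - k N y).
    by apply: is_deriveDr => //; apply: is_deriveNr.
  have lip y : `|k l y - k N y| <= d / 4 by apply: le_trans eN; apply: ke.
  have := lipschitz_derive x (x + t) dl lip.
  rewrite [x + t - x]addrC addKr; apply: le_trans.
  by rewrite [leLHS](_ : _ = `|h l (x + t) - h N (x + t) - (h l x - h N x)|) //; congr `|_|; ring.
have A3 : `|t * (K x - k N x)| <= d / 4 * `|t|.
  by rewrite normrM mulrC ler_wpM2r //; apply: le_trans eN.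
rewrite [X in `|X|](_ : _ = ((H (x + t) - H x) - (h N (x + t) - h N x)) +
  (h N (x + t) - h N x - t * k N x) - t * (K x - k N x)); last by ring.
apply: le_trans (ler_normB _ _) _; apply: le_trans (lerD (ler_normD _ _) A3) _.
have : 0 <= d * `|t| by rewrite mulr_ge0 // ltW.
by move: A1 A2; lra.
Qed.

(** The restriction [m < j] admits approximants that have only finitely many derivatives, such as
    the [j]-fold averages used for the bump functions. In the limit the first [m + 1] of them are
    skipped. *)
Lemma tower_lim (Y : nat -> nat -> R -> R) (e : nat -> nat -> R) :
  (forall m, tends (e m) 0) ->
  (forall m j x, (m < j)%N -> is_derive x (1 : R) (Y m j) (Y m.+1 j x)) ->
  (forall m j l x, (m <= j)%N -> (j <= l)%N -> `|Y m l x - Y m j x| <= e m j) ->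
  exists2 F, tower F & forall m j x, (m <= j)%N -> `|F m x - Y m j x| <= e m j.
Proof.
move=> e0 dY Ye.
have cY m x : exists l, tends (fun j => Y m j x) l.
  apply: tends_cauchy => d d0; have [N eN] := e0 m d d0.
  exists (maxn m N) => j l; rewrite geq_max => /andP[mj Nj] jl.
  by apply: le_trans (Ye _ _ _ _ mj jl) _; have := eN j Nj; rewrite subr0; exact/le_trans/ler_norm.
pose F m x := sval (cid (cY m x)).
have tF m x : tends (fun j => Y m j x) (F m x) by exact: svalP.
have FY m j x : (m <= j)%N -> `|F m x - Y m j x| <= e m j.
  by move=> mj; apply: (tends_dist (j := j) (tF m x)) => l jl; apply: Ye.
exists F => // m.
apply: (@is_derive_lim (fun j => Y m (m.+1 + j)%N) (fun j => Y m.+1 (m.+1 + j)%N)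
  _ _ (fun j => e m.+1 (m.+1 + j)%N)).
- exact: tends_shift.
- by move=> j x; apply: dY; rewrite leq_addr.
- by move=> j l x jl; apply: Ye; rewrite ?leq_addr // leq_add2l.
- by move=> x; apply: (@tends_shift _ (fun j => Y m j x)).
- by move=> j x; apply: FY; rewrite leq_addr.
Qed.

Lemma smooth_lim (y : nat -> R -> R) (e : nat -> nat -> R) :
  (forall m, tends (e m) 0) -> (forall j, smooth (y j)) ->
  (forall m j l x, (j <= l)%N ->
     `|derive1n m (y l) x - derive1n m (y j) x| <= e m j) ->
  exists2 f, smooth f & forall m j x, (m <= j)%N ->
    `|derive1n m f x - derive1n m (y j) x| <= e m j.
Proof.
move=> e0 sy ye.
have [F tF FY] : exists2 F, tower F & forall m j x, (m <= j)%N ->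
    `|F m x - derive1n m (y j) x| <= e m j.
  apply: (@tower_lim (fun m j => derive1n m (y j))); first exact: e0.
    by move=> m j x _; apply: smooth_tower.
  by move=> m j l x _; apply: ye.
exists (F 0%N) => [|m j x mj]; first exact: tower_smooth.
by rewrite tower_derive1n //; apply: FY.
Qed.

End SmoothLimits.

(** * Mollified bump functions *)

Section Averages.
Context {R : realType}.
Implicit Types (f g u v : R -> R) (x a b c d w : R).

(** Convolution with the normalized indicator of [[-a, a]]. *)
Definition avg a u x := (2 * a)^-1 * itg (x - a) (x + a) u.

Lemma is_derive_shift f c x d : is_derive (x + c) (1 : R) f d ->
  is_derive x (1 : R) (fun y => f (y + c)) d.
Proof.
move=> df; rewrite -[d]mulr1.
apply: (is_derive_compr (g := fun y => y + c) df).
by apply: is_derive_eq (is_deriveDr (is_derive_idr x) (is_derive_cstr x c)) _; rewrite addr0.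
Qed.

Lemma is_derive_central f g a x : (forall x, is_derive x (1 : R) f (g x)) ->
  is_derive x (1 : R) (fun y => (2 * a)^-1 * (f (y + a) - f (y - a)))
    ((2 * a)^-1 * (g (x + a) - g (x - a))).
Proof.
move=> df; apply/is_deriveZr/is_deriveDr; first exact: is_derive_shift.
exact/is_deriveNr/is_derive_shift.
Qed.

Lemma is_derive_avg a u x : continuous u ->
  is_derive x (1 : R) (avg a u) ((2 * a)^-1 * (u (x + a) - u (x - a))).
Proof. by move=> cu; apply: is_derive_central => y; apply: is_derive_prim. Qed.

Lemma continuous_avg a u : continuous u -> continuous (avg a u).
Proof. by move=> cu; apply: is_derive_continuous => x; apply: is_derive_avg. Qed.

Lemma avg_dist a u x w c : 0 < a -> continuous u ->
  (forall y, `|y - x| <= a -> `|u y - w| <= c) -> `|avg a u x - w| <= c.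
Proof.
move=> a0 cu uw; have xa : x - a <= x + a by lra.
rewrite /avg [X in `|X|](_ : _ = (2 * a)^-1 * (itg (x - a) (x + a) (fun y => u y - w))).
  rewrite normrM gtr0_norm ?invr_gt0 ?mulr_gt0 // mulrC ler_pdivrMr ?mulr_gt0 //.
  apply: le_trans (itg_bound (B := c) _ xa _) _.
  - exact/contB/cont_cst.
  - by move=> y xy; apply: uw; rewrite ler_norml; lra.
  - by rewrite le_eqVlt; apply/orP; left; apply/eqP; ring.
rewrite itgB ?itg_cst //; last exact: cont_cst.
by field; rewrite gt_eqF.
Qed.

Lemma avgB_dist a u v x c : 0 < a -> continuous u -> continuous v ->
  (forall y, `|u y - v y| <= c) -> `|avg a u x - avg a v x| <= c.
Proof.
move=> a0 cu cv uv; rewrite -mulrBr -itgB // -[X in `|X|]subr0.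
apply: (@avg_dist a (fun y => u y - v y)) => //; first exact: contB.
by move=> y _; rewrite subr0.
Qed.

Lemma avg_ge0 a u x : 0 < a -> continuous u -> (forall y, 0 <= u y) -> 0 <= avg a u x.
Proof.
move=> a0 cu u0; apply: mulr_ge0; first by rewrite invr_ge0 mulr_ge0 // ltW.
rewrite -[leLHS](_ : itg (x - a) (x + a) (fun=> 0) = 0); last by rewrite itg_cst mul0r.
by apply: itg_le => //; [apply: cont_cst|lra].
Qed.

End Averages.

Section Bump.
Context {R : realType}.
Variable a : nat -> R.
Hypothesis a_gt0 : forall j, 0 < a j.

Let psum n := \sum_(j < n) a j.

(** Equal to [1] up to [|x| = 5/8] and to [0] from [7/8] on, with slope [4] in between; this leaves
    a margin of [1/8] on either side for the averaging. *)
Definition trapezoid (x : R) : R := Num.max 0 (Num.min 1 (7 / 2 - 4 * `|x|)).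

Lemma trapezoid_itv x : 0 <= trapezoid x <= 1.
Proof. by rewrite /trapezoid le_max lexx ge_max ge_min lexx ler01. Qed.

Lemma trapezoid_lip x y : `|trapezoid x - trapezoid y| <= 4 * `|x - y|.
Proof.
have h1 := lerB_dist x y; have := lerB_dist y x; rewrite (distrC y) => h2.
rewrite /trapezoid ler_norml; have := normr_ge0 (x - y).
by do 2![case: (ltP 1) => ?; case: (ltP 0) => ?]; lra.
Qed.

Lemma continuous_lip (f : R -> R) c : 0 < c ->
  (forall x y, `|f x - f y| <= c * `|x - y|) -> continuous f.
Proof.
move=> c0 fl x; apply/cvgrPdist_le => e e0; exists (e / c) => /=; first exact: divr_gt0.
move=> y; rewrite /ball_ /= => xy; apply: le_trans (fl _ _) _.
by rewrite mulrC -ler_pdivlMr //; apply: ltW.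
Qed.

(** Convolution of the trapezoid with the boxes of radii [a i], ..., [a (i + n - 1)], the first of
    them outermost. *)
Fixpoint mollify (n i : nat) : R -> R :=
  if n is n'.+1 then avg (a i) (mollify n' i.+1) else trapezoid.

(** The [m]-th derivative of [mollify n i]: the [m] outermost averages are replaced by central
    difference quotients, each of which costs an inverse radius. The value [0] for [n < m] is a
    default. *)
Fixpoint dmollify (m n i : nat) : R -> R :=
  match m, n with
  | 0, _ => mollify n i
  | m'.+1, n'.+1 => fun x => (2 * a i)^-1 *
      (dmollify m' n' i.+1 (x + a i) - dmollify m' n' i.+1 (x - a i))
  | _, _ => cst 0
  end.

Lemma continuous_mollify n i : continuous (mollify n i).
Proof.
elim: n i => [|n IH] i /=; last exact: continuous_avg.
by apply: (@continuous_lip _ 4) => //; exact: trapezoid_lip.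
Qed.

Lemma is_derive_dmollify m n i x : (m < n)%N ->
  is_derive x (1 : R) (dmollify m n i) (dmollify m.+1 n i x).
Proof.
elim: m n i x => [|m IH] [//|n] i x /= mn.
  by case: n mn => [|n] _; apply: is_derive_avg; apply: continuous_mollify.
by apply: is_derive_central => y; apply: IH.
Qed.

Lemma psumS i n : psum (i + n.+1) = a i + (psum (i.+1 + n) - psum i.+1) + psum i.
Proof. by rewrite addnS -addSn /psum [in X in _ - X]big_ord_recr /=; ring. Qed.

Lemma mollify_dist k i x : `|mollify k i x - trapezoid x| <= 4 * (psum (i + k) - psum i).
Proof.
elim: k i x => [|k IH] i x; first by rewrite addn0 !subrr normr0 mulr0.
apply: avg_dist => // [|y yx]; first exact: continuous_mollify.
rewrite psumS; apply: le_trans (ler_distD (trapezoid y) _ _) _.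
apply: le_trans (lerD (IH _ _) (trapezoid_lip _ _)) _; lra.
Qed.

(** Raising [n] inserts averages on the inside only, next to the trapezoid. Those outside do not
    increase the sup norm, so only the added radii count. *)
Lemma mollify_tail_dist n i k x : `|mollify (n + k) i x - mollify n i x| <=
  4 * (psum (i + (n + k)) - psum (i + n)).
Proof.
elim: n i x => [|n IH] i x; first by rewrite add0n addn0; apply: mollify_dist.
rewrite addSn /=; apply: avgB_dist => //; try exact: continuous_mollify.
by move=> y; rewrite !addnS -!addSn; apply: IH.
Qed.

Lemma mollify_locally_constant n i x w :
  (forall y, `|y - x| <= psum (i + n) - psum i -> trapezoid y = w) -> mollify n i x = w.
Proof.
elim: n i x => [|n IH] i x tw; first by rewrite /= tw // addn0 !subrr normr0.
apply/eqP; rewrite -subr_eq0 -normr_le0; apply: (@avg_dist _ _ (mollify n i.+1)) => //.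
  exact: continuous_mollify.
move=> y yx; rewrite IH ?subrr ?normr0 // => z zy; apply: tw.
by rewrite psumS; apply: le_trans (ler_distD y _ _) _; lra.
Qed.

Lemma mollify_ge0 n i x : 0 <= mollify n i x.
Proof.
elim: n i x => [|n IH] i x; first by case/andP: (trapezoid_itv x).
by apply: avg_ge0 => //; apply: continuous_mollify.
Qed.

Lemma mollify_le1 n i x : `|mollify n i x| <= 1.
Proof.
elim: n i x => [|n IH] i x; first by rewrite ger0_norm; case/andP: (trapezoid_itv x).
rewrite -[X in `|X|]subr0; apply: avg_dist => //; first exact: continuous_mollify.
by move=> y _; rewrite subr0.
Qed.

Let wprod m i := \prod_(j < m) (a (i + j))^-1.

Lemma wprodS m i : wprod m.+1 i = (a i)^-1 * wprod m i.+1.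
Proof.
rewrite /wprod big_ord_recl addn0; congr (_ * _).
by apply: eq_bigr => j _; rewrite /= /bump /= add1n addnS addSn.
Qed.

Lemma wprod_ge0 m i : 0 <= wprod m i.
Proof. by apply: prodr_ge0 => j _; rewrite invr_ge0 ltW. Qed.

Lemma central_le i (x y c : R) : `|x| <= c -> `|y| <= c ->
  `|(2 * a i)^-1 * (x - y)| <= (a i)^-1 * c.
Proof.
move=> xc yc; have a0 := a_gt0 i.
rewrite normrM gtr0_norm ?invr_gt0 ?mulr_gt0 //.
rewrite -[leRHS](_ : (2 * a i)^-1 * (c + c) = _); last by field; rewrite gt_eqF.
apply: ler_wpM2l; first by rewrite invr_ge0 mulr_ge0 // ltW.
by apply: le_trans (ler_normB _ _) _; apply: lerD.
Qed.

Lemma dmollify_le m n i x : (m <= n)%N -> `|dmollify m n i x| <= wprod m i.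
Proof.
elim: m n i x => [|m IH] [|n] i x //= mn; try by rewrite /wprod big_ord0 mollify_le1.
- by rewrite /wprod big_ord0; case/andP: (trapezoid_itv x) => ? ?; rewrite ger0_norm.
- by rewrite /wprod big_ord0; apply: (mollify_le1 n.+1).
- by rewrite wprodS; apply: central_le; apply: IH.
Qed.

Lemma dmollify_dist m n i k x : (m <= n)%N ->
  `|dmollify m (n + k) i x - dmollify m n i x| <=
  wprod m i * (4 * (psum (i + (n + k)) - psum (i + n))).
Proof.
elim: m n i x => [|m IH] n i x mn.
  rewrite /wprod big_ord0 mul1r.
  by have := mollify_tail_dist n i k x; case: (n) => [|n'] //; case: (k).
case: n mn => // n mn; rewrite addSn /= -mulrBr wprodS -mulrA.
rewrite [X in (2 * a i)^-1 * X](_ : _ =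
  (dmollify m (n + k) i.+1 (x + a i) - dmollify m n i.+1 (x + a i)) -
  (dmollify m (n + k) i.+1 (x - a i) - dmollify m n i.+1 (x - a i))); last by ring.
by apply: central_le; rewrite !addnS -!addSn; apply: IH.
Qed.

Lemma exists_bump (t : nat -> R) : tends t 0 -> (forall n, psum n + t n = 8^-1) ->
  exists th : R -> R, [/\ smooth th,
    (forall x, `|x| <= 2^-1 -> th x = 1) /\ (forall x, 1 <= `|x| -> th x = 0),
    forall x, 0 <= th x &
    forall m x, `|derive1n m th x| <= \prod_(j < m) (a j)^-1].
Proof.
move=> t0 at8.
have tp n : psum n <= 8^-1.
  have ps : tends (fun k => psum (n + k)) 8^-1.
    move=> e /t0[N tN]; exists N => k Nk; rewrite -(at8 (n + k)%N) opprD addrA subrr sub0r.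
    by rewrite normrN -[t _]subr0; apply: tN; apply: leq_trans (leq_addl _ _).
  apply: (tends_ge (j := 0%N) ps) => k _; rewrite /psum big_split_ord /= lerDl.
  by apply: sumr_ge0 => j _; apply: ltW.
have psum0 : psum 0 = 0 by rewrite /psum big_ord0.
have [|||F tF FY] := @tower_lim R (fun m j => dmollify m j 0)
   (fun m j => wprod m 0 * (4 * t j)).
- by move=> m; rewrite -[X in tends _ X](mulr0 (wprod m 0 * 4));
    under eq_fun do rewrite mulrA; apply: tendsZ.
- by move=> m j x; apply: is_derive_dmollify.
- move=> m j l x mj jl; rewrite -(subnKC jl); apply: le_trans (dmollify_dist _ _ _ mj) _.
  rewrite ler_wpM2l ?wprod_ge0 // !add0n ler_wpM2l //.
  by rewrite lerBlDr (addrC (t j)) at8.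
have F0 x : tends (fun j => mollify j 0 x) (F 0%N x).
  apply: (@tends_squeeze _ _ _ (fun j => 4 * t j)).
    by rewrite -[X in tends _ X](mulr0 (4 : R)); apply: tendsZ.
  move=> j; have := FY 0%N j x isT; rewrite /wprod big_ord0 mul1r distrC.
  by case: j.
have F0c x w : (forall y, `|y - x| <= 8^-1 -> trapezoid y = w) -> F 0%N x = w.
  move=> tw; apply: (tends_unique (F0 x)).
  rewrite (_ : (fun j => _) = fun=> w); first exact: tends_cst.
  apply/funext => j; apply: mollify_locally_constant => y; rewrite psum0 subr0 add0n => yx.
  by apply: tw; apply: le_trans yx (tp _).
exists (F 0%N); split.
- exact: tower_smooth.
- split=> x hx; apply: F0c => y yx; have := lerB_dist x y; have := lerB_dist y x;
    rewrite (distrC x) /trapezoid => h1 h2; case: (ltP 1) => ?; case: ltP => ?; lra.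
- by move=> x; apply: (tends_ge (j := 0%N) (F0 x)) => n _; apply: mollify_ge0.
- move=> m x; rewrite tower_derive1n // -[X in `|X|]subr0.
  have Fm : tends (fun j => dmollify m (m + j) 0 x) (F m x).
    apply: (@tends_squeeze _ _ _ (fun j => wprod m 0 * (4 * t (m + j)%N))).
      rewrite -[X in tends _ X](mulr0 (wprod m 0 * 4)).
      under eq_fun do rewrite mulrA; apply: tendsZ; exact: tends_shift.
    by move=> j; rewrite distrC; apply: FY; apply: leq_addr.
  by apply: (tends_dist (j := 0%N) Fm) => n _; rewrite subr0; apply/dmollify_le/leq_addr.
Qed.

End Bump.

(** * Real test functions *)

Section StarQuantifiers.
Context {R : realType}.
Variable star : ultra_case.
Implicit Types (P Q S T U : R -> Prop) (h c : R).

(* [coqu] is the quantifier over the parameter in the definition of the test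
   space, [qu] the dual one, which governs continuity of functionals and the
   growth of the densities. *)
Definition coqu P := match star with
  | Beurling => forall h, 0 < h -> P h
  | Roumieu => exists2 h, 0 < h & P h
  end.

Definition qu P := match star with
  | Beurling => exists2 h, 0 < h & P h
  | Roumieu => forall h, 0 < h -> P h
  end.

Lemma coqu_scale c P Q : 0 < c -> (forall h, 0 < h -> P h -> Q (c * h)) ->
  coqu P -> coqu Q.
Proof.
rewrite /coqu => c0 PQ; case: star => [Pa h h0|[h h0 Ph]].
  rewrite -[h](mulVKf (lt0r_neq0 c0)).
  by apply: PQ; [|apply: Pa]; rewrite mulr_gt0 // invr_gt0.
by exists (c * h); [apply: mulr_gt0|apply: PQ].
Qed.

Lemma qu_scale c P Q : 0 < c -> (forall h, 0 < h -> P h -> Q (c * h)) -> qu P -> qu Q.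
Proof.
rewrite /qu => c0 PQ; case: star => [[h h0 Ph]|Pa h h0].
  by exists (c * h); [apply: mulr_gt0|apply: PQ].
rewrite -[h](mulVKf (lt0r_neq0 c0)).
by apply: PQ; [|apply: Pa]; rewrite mulr_gt0 // invr_gt0.
Qed.

Lemma coqu_imp P Q : (forall h, 0 < h -> P h -> Q h) -> coqu P -> coqu Q.
Proof. by move=> PQ; apply: (@coqu_scale 1) => // h h0 /PQ; rewrite mul1r; apply. Qed.

Lemma qu_imp P Q : (forall h, 0 < h -> P h -> Q h) -> qu P -> qu Q.
Proof. by move=> PQ; apply: (@qu_scale 1) => // h h0 /PQ; rewrite mul1r; apply. Qed.

Lemma coqu_and P Q : (forall h h', 0 < h -> h <= h' -> P h -> P h') ->
  (forall h h', 0 < h -> h <= h' -> Q h -> Q h') ->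
  coqu P -> coqu Q -> coqu (fun h => P h /\ Q h).
Proof.
rewrite /coqu => Pm Qm; case: star => [Pa Qa h h0|[h h0 Ph] [k k0 Qk]].
  by split; [apply: Pa|apply: Qa].
exists (Num.max h k); first by rewrite lt_max h0.
by split; [apply: Pm Ph|apply: Qm Qk] => //; rewrite le_max lexx ?orbT.
Qed.

Lemma qu_inv c P Q : 0 < c -> (forall h, 0 < h -> P h -> Q (c / h)) -> qu P -> qu Q.
Proof.
rewrite /qu => c0 PQ; case: star => [[h h0 Ph]|Pa h h0].
  by exists (c / h); [apply: divr_gt0|apply: PQ].
rewrite -[h]invrK -[h^-1](mulKf (lt0r_neq0 c0)) invfM invrK.
by apply: PQ; last apply: Pa; apply: divr_gt0.
Qed.

Lemma qu_coqu P Q : qu P -> coqu Q -> exists2 h, 0 < h & P h /\ Q h.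
Proof.
rewrite /qu /coqu; case: star => [[h h0 Ph] Qa|Pa [h h0 Qh]]; exists h => //; split=> //.
  exact: Qa.
exact: Pa.
Qed.

(** How the bound of the densities, with parameter [l], meets that of a test function, with
    parameter [h]: in the Beurling case [l] is given and [h] is free, in the Roumieu case
    conversely, so that the product can be prescribed in both. *)
Lemma qu_coqu_inv c P Q : 0 < c -> qu P -> coqu Q ->
  exists l h, [/\ 0 < l, 0 < h, l * h = c, P l & Q h].
Proof.
rewrite /qu /coqu => c0; case: star => [[l l0 Pl] Qa|Pa [h h0 Qh]].
  by exists l, (c / l); split; rewrite ?divr_gt0 //; [field; rewrite gt_eqF|apply/Qa/divr_gt0].
by exists (c / h), h; split; rewrite ?divr_gt0 //; [field; rewrite gt_eqF|apply/Pa/divr_gt0].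
Qed.

(** Leibniz' rule adds the parameters of two factors. In the Beurling case the available parameter
    is halved between them; in the Roumieu case one factor imposes its [e] and the other keeps an
    arbitrary [k]. *)
Lemma qu_split U P Q : (forall e k, 0 < e -> 0 < k -> P e -> U (e + k) -> Q k) ->
  qu U -> coqu P -> qu Q.
Proof.
rewrite /qu /coqu => H; case: star => [[h h0 Uh] Pa|Ua [e e0 Pe] k k0].
  have h20 : 0 < h / 2 by rewrite divr_gt0.
  by exists (h / 2) => //; apply: (H (h / 2)) => //; [apply: Pa|rewrite -splitr].
by apply: (H e) => //; apply: Ua; rewrite addr_gt0.
Qed.

End StarQuantifiers.

Section SupportedFunctions.
Context {R : realType}.
Implicit Types (f g : R -> R) (r x : R).

Definition supp r f := forall x, r < `|x| -> f x = 0.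

Lemma supp_le r r' f : r <= r' -> supp r f -> supp r' f.
Proof. by move=> rr sf x r'x; apply: sf; apply: le_lt_trans r'x. Qed.

Lemma is_derive_unique f x a b : is_derive x (1 : R) f a -> is_derive x (1 : R) f b -> a = b.
Proof. by move=> [_ <-] [_ <-]. Qed.

Lemma supp_derive1n m r f : smooth f -> supp r f -> supp r (derive1n m f).
Proof.
move=> /smooth_tower tf sf; elim: m => [//|m IH] x rx.
apply: (is_derive_unique (tf m x)); apply: near_eq_is_derive (is_derive_cstr x 0).
have [d d0 dP] : exists2 d : R, 0 < d & r + d = `|x|.
  by exists (`|x| - r); [rewrite subr_gt0|rewrite addrC subrK].
exists d => //= y; rewrite /ball_ /= => xy; rewrite IH //.
by have := lerB_dist x y; lra.
Qed.

End SupportedFunctions.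

(** * Ultradifferentiable functions and the existence of cut-offs *)

Section UltraClass.
Context {R : realType}.
Variables (M : nat -> R) (star : ultra_case).
Hypotheses (M_gt0 : forall p, 0 < M p) (M1 : cond_M1 M) (M2' : cond_M2' M)
  (M3' : cond_M3' M).
Implicit Types (f g phi : R -> R) (c e h k r x A B C : R).

Lemma M_ge0 p : 0 <= M p.
Proof. exact/ltW/M_gt0. Qed.

Definition mratio p := M p.+1 / M p.

Lemma mratio_gt0 p : 0 < mratio p.
Proof. exact: divr_gt0. Qed.

Lemma mratio_le p q : (p <= q)%N -> mratio p <= mratio q.
Proof.
move=> /subnKC <-; elim: (q - p)%N => [|k IH]; first by rewrite addn0.
apply: le_trans IH _; rewrite addnS /mratio ler_pdivrMr // mulrAC ler_pdivlMr //.
by have := @M1 (p + k).+1 isT; rewrite expr2 [leRHS]mulrC.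
Qed.

(** [M (i + j) / M i] is a product of [j] ratios, each at least the corresponding one in
    [M j / M 0], since the ratios increase by [(M.1)]. *)
Lemma M_supermul i j : M i * M j <= M 0%N * M (i + j)%N.
Proof.
elim: j => [|j IH]; first by rewrite addn0 mulrC.
have E p : M p.+1 = mratio p * M p by rewrite /mratio divfK ?gt_eqF.
rewrite addnS !E mulrCA [leRHS]mulrCA; apply: le_trans (_ : mratio j * (M 0 * M (i + j)%N) <= _).
  by rewrite ler_wpM2l // ltW // mratio_gt0.
by rewrite ler_wpM2r ?mulr_ge0 ?M_ge0 // mratio_le // leq_addl.
Qed.

Lemma M2_ge1 : exists A H : R, [/\ 1 <= A, 1 <= H & forall p, M p.+1 <= A * H ^+ p * M p].
Proof.
have [A [H AH]] := M2'; exists (Num.max 1 `|A|), (Num.max 1 `|H|).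
split; rewrite ?le_max ?lexx // => p; apply: le_trans (AH p) _.
rewrite ler_wpM2r ?M_ge0 //; apply: le_trans (ler_norm _) _; rewrite normrM normrX.
apply: ler_pM => //; rewrite ?exprn_ge0 //; first by rewrite le_max lexx orbT.
by apply: lerXn2r; rewrite ?nnegrE // ?le_max ?lexx ?orbT ?ler01.
Qed.

(** The strict inequality says that all tails of the series are positive, as is needed for the radii
    of the cut-off. *)
Lemma inv_mratio_sum : exists2 S : R, tends (fun n => \sum_(j < n) (mratio j)^-1) S &
  forall n, \sum_(j < n) (mratio j)^-1 < S.
Proof.
pose u n := \sum_(j < n) (mratio j)^-1.
have uS n : u n < u n.+1 by rewrite /u big_ord_recr /= ltrDl invr_gt0 mratio_gt0.
have um : {homo u : n m / (n <= m)%N >-> n <= m}.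
  by apply/nondecreasing_seqP => n; apply/ltW/uS.
have uB n : u n <= fine (\sum_(1 <= p <oo) (M p.-1 / M p)%:E)%E.
  have nn p : (0 <= (M p.-1 / M p)%:E)%E by rewrite lee_fin ltW ?divr_gt0.
  rewrite -lee_fin fineK; last first.
    by rewrite ge0_fin_numE //; apply: nneseries_ge0.
  apply: le_trans (nneseries_lim_ge n.+1 _) => //.
  rewrite sumEFin lee_fin big_add1 /= big_mkord le_eqVlt.
  by apply/orP; left; apply/eqP; apply: eq_bigr => j _; rewrite invf_div.
have cu : cvgn u by apply: nondecreasing_is_cvgn => //; exists (fine (\sum_(1 <= p <oo) (M p.-1 / M p)%:E)%E) => _ [n _ <-].
have tu : tends u (limn u) by apply/tendsP.
exists (limn u) => // n; apply: lt_le_trans (uS n) _.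
by apply: (tends_ge (j := n.+1) tu) => m /um.
Qed.

Lemma mratio_oo (T : R) : exists p0, forall p, (p0 <= p)%N -> T <= mratio p.
Proof.
have [S tS uS] := inv_mratio_sum.
have T1 : 0 < `|T| + 1 by rewrite ltr_wpDl.
have [N SN] := tS _ (divr_gt0 (ltr01 : 0 < (1 : R)) T1).
exists N => p Np; have := SN p Np; have := uS p.+1.
rewrite big_ord_recr /=; set u := \sum_(_ < _) _; move=> h1.
rewrite ler_norml => /andP[h2 _].
have : (mratio p)^-1 <= 1 / (`|T| + 1) by lra.
rewrite div1r lef_pV2 ?posrE ?mratio_gt0 //; apply: le_trans.
by have := ler_norm T; lra.
Qed.

Definition dbnd f h C := forall m x, `|derive1n m f x| <= C * h ^+ m * M m.

Lemma dbnd_ge0 f h C : dbnd f h C -> 0 <= C.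
Proof.
move=> /(_ 0%N 0)/(le_trans (normr_ge0 _)).
by rewrite expr0 mulr1 pmulr_lge0.
Qed.

Lemma dbnd_le f h h' C C' : 0 < h -> h <= h' -> C <= C' -> dbnd f h C -> dbnd f h' C'.
Proof.
move=> h0 hh CC fb m x; have C0 := dbnd_ge0 fb; apply: le_trans (fb m x) _.
rewrite ler_wpM2r ?M_ge0 //; apply: ler_pM => //; first exact/exprn_ge0/ltW.
by apply: lerXn2r; rewrite // nnegrE; [apply: ltW|apply: le_trans hh; apply: ltW].
Qed.

Lemma dbndD f g h C C' : smooth f -> smooth g -> dbnd f h C -> dbnd g h C' ->
  dbnd (fun x => f x + g x) h (C + C').
Proof.
move=> sf sg fb gb m x; rewrite derive1n_add //; apply: le_trans (ler_normD _ _) _.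
by rewrite !mulrDl; apply: lerD.
Qed.

Lemma dbndZ c f h C : smooth f -> dbnd f h C -> dbnd (fun x => c * f x) h (`|c| * C).
Proof.
by move=> sf fb m x; rewrite derive1n_scale // normrM -!mulrA ler_wpM2l // mulrA.
Qed.

Lemma dbnd_dilate c f h C : smooth f -> dbnd f h C ->
  dbnd (fun x => f (c * x)) (`|c| * h) C.
Proof.
move=> sf fb m x; rewrite derive1n_dilate // normrM normrX exprMn.
by rewrite mulrCA -!mulrA ler_wpM2l ?exprn_ge0 // mulrA.
Qed.

(** Leibniz' rule together with [M_supermul]. The factor [g] is controlled only where [f] lives; it
    will be a monomial, or the remainder of a Fourier series, which is small on one interval
    only. *)
Lemma dbnd_mul_on (S : R -> Prop) f g e k A B : 0 < e -> 0 < k ->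
  smooth f -> smooth g -> dbnd f e A ->
  (forall m x, ~ S x -> derive1n m f x = 0) ->
  (forall m x, S x -> `|derive1n m g x| <= B * k ^+ m * M m) -> 0 <= B ->
  dbnd (fun x => f x * g x) (e + k) (A * B * M 0%N).
Proof.
move=> e0 k0 sf sg fb fS gb B0 m x; have A0 := dbnd_ge0 fb.
have rhs0 n : 0 <= A * B * M 0%N * (e + k) ^+ n * M n.
  by rewrite !mulr_ge0 ?M_ge0 // exprn_ge0 // ltW // addr_gt0.
rewrite derive1n_mul //; have [Sx|nSx] := pselect (S x); last first.
  by rewrite big1 ?normr0 // => i _; rewrite fS // mulr0 mul0r.
apply: le_trans (ler_norm_sum _ _ _) _.
rewrite addrC exprDn mulr_sumr mulr_suml; apply: ler_sum => -[i im] _ /=.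
rewrite !normrM normr_nat -mulr_natl.
have h1 := fb i x; have h2 := gb (m - i)%N x Sx.
have M' := M_supermul i (m - i); rewrite subnKC // in M'.
have h3 : `|derive1n i f x| * `|derive1n (m - i) g x| <=
   A * B * (k ^+ (m - i) * e ^+ i) * (M 0%N * M m).
  apply: le_trans (_ : (A * e ^+ i * M i) * (B * k ^+ (m - i) * M (m - i)%N) <= _).
    by apply: ler_pM.
  rewrite [leLHS](_ : _ = A * B * (k ^+ (m - i) * e ^+ i) * (M i * M (m - i)%N)); last by ring.
  by rewrite ler_wpM2l // !mulr_ge0 // ?exprn_ge0 // ltW.
rewrite -mulrA [leRHS](_ : _ = 'C(m, i)%:R *
  (A * B * (k ^+ (m - i) * e ^+ i) * (M 0%N * M m))); last by ring.
by rewrite mulr1 ler_wpM2l.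
Qed.

Lemma dbndM f g e k A B : 0 < e -> 0 < k -> smooth f -> smooth g ->
  dbnd f e A -> dbnd g k B -> dbnd (fun x => f x * g x) (e + k) (A * B * M 0%N).
Proof.
move=> e0 k0 sf sg fb gb; have B0 := dbnd_ge0 gb.
by apply: (@dbnd_mul_on (fun=> True)).
Qed.

Lemma dbnd_derive1 A H f h C : 1 <= A -> 1 <= H ->
  (forall p, M p.+1 <= A * H ^+ p * M p) -> 0 < h ->
  dbnd f h C -> dbnd (derive1n 1 f) (H * h) (A * h * C).
Proof.
move=> A1 H1 AH h0 fb m x; rewrite -derive1nSr; apply: le_trans (fb _ _) _.
have C0 := dbnd_ge0 fb.
rewrite exprMn exprS [leRHS](_ : _ = C * (h * h ^+ m) * (A * H ^+ m * M m)); last by ring.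
by rewrite ler_wpM2l // !mulr_ge0 // ?exprn_ge0 // ltW.
Qed.

Definition udiff f := smooth f /\ coqu star (fun h => exists C, dbnd f h C).

Lemma dbnd_up f h h' : 0 < h -> h <= h' ->
  (exists C, dbnd f h C) -> exists C, dbnd f h' C.
Proof. by move=> h0 hh [C fC]; exists C; apply: dbnd_le fC. Qed.

Lemma udiffD f g : udiff f -> udiff g -> udiff (fun x => f x + g x).
Proof.
move=> [sf uf] [sg ug]; split; first exact: smoothD.
have := coqu_and (@dbnd_up f) (@dbnd_up g) uf ug.
by apply: coqu_imp => h h0 [[C fC] [C' gC]]; exists (C + C'); apply: dbndD.
Qed.

Lemma udiffZ c f : udiff f -> udiff (fun x => c * f x).
Proof.
move=> [sf uf]; split; first exact: smoothZ.
by apply: coqu_imp uf => h h0 [C fC]; exists (`|c| * C); apply: dbndZ.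
Qed.

Lemma udiffM f g : udiff f -> udiff g -> udiff (fun x => f x * g x).
Proof.
move=> [sf uf] [sg ug]; split; first exact: smoothM.
have := coqu_and (@dbnd_up f) (@dbnd_up g) uf ug.
apply: (@coqu_scale _ _ 2) => // h h0 [[C fC] [C' gC]].
by exists (C * C' * M 0%N); rewrite mulr_natl mulr2n; apply: dbndM.
Qed.

Lemma udiff_dilate c f : c != 0 -> udiff f -> udiff (fun x => f (c * x)).
Proof.
move=> c0 [sf uf]; split; first exact: smooth_dilate.
have {}c0 : 0 < `|c| by rewrite normr_gt0.
by apply: coqu_scale c0 _ uf => h h0 [C fC]; exists C; apply: dbnd_dilate.
Qed.

Lemma udiff_derive1 f : udiff f -> udiff (derive1n 1 f).
Proof.
move=> [sf uf]; split; first exact: smooth_derive1n.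
have [A [H [A1 H1 AH]]] := M2_ge1.
apply: coqu_scale uf; first by apply: lt_le_trans H1.
by move=> h h0 [C fC]; exists (A * h * C); apply: dbnd_derive1.
Qed.

Definition test_function r f := udiff f /\ supp r f.
Local Notation test := test_function.

Lemma test_le r r' f : r <= r' -> test r f -> test r' f.
Proof. by move=> rr [uf sf]; split=> //; apply: supp_le sf. Qed.

Lemma testD r f g : test r f -> test r g -> test r (fun x => f x + g x).
Proof.
move=> [uf sf] [ug sg]; split; first exact: udiffD.
by move=> x rx; rewrite sf // sg // addr0.
Qed.

Lemma testZ r c f : test r f -> test r (fun x => c * f x).
Proof.
move=> [uf sf]; split; first exact: udiffZ.
by move=> x rx; rewrite sf // mulr0.
Qed.

Lemma testM r f g : test r f -> udiff g -> test r (fun x => f x * g x).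
Proof.
move=> [uf sf] ug; split; first exact: udiffM.
by move=> x rx; rewrite sf // mul0r.
Qed.

Lemma test_dilate r c f : 0 < c -> test r f -> test (r / c) (fun x => f (c * x)).
Proof.
move=> c0 [uf sf]; split; first by apply: udiff_dilate => //; rewrite gt_eqF.
by move=> x; rewrite ltr_pdivrMr // => rx; apply: sf; rewrite normrM gtr0_norm // mulrC.
Qed.

Lemma test_sum (I : Type) (s : seq I) r (f : I -> R -> R) :
  (forall i, test r (f i)) -> test r (fun x => \sum_(i <- s) f i x).
Proof.
move=> tf; elim: s => [|i s IH].
  under eq_fun do rewrite big_nil.
  split=> //; split; first exact: (tower_smooth (@tower0 R)).
  have cb h : exists C, dbnd (fun=> 0) h C.
    exists 0 => m x; rewrite (tower_derive1n m (@tower0 R)).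
    by rewrite normr0 !mul0r.
  by rewrite /coqu; case: star => [//|]; exists 1.
by under eq_fun do rewrite big_cons; apply: testD.
Qed.

(** From some index on the factors are at most [h], after which the quotients by [h^m] decrease; the
    finitely many earlier quotients make up the constant. *)
Lemma prod_le_geometric (k : nat -> R) : (forall j, 0 <= k j) -> tends k 0 ->
  forall h, 0 < h -> exists C, forall m, \prod_(j < m) k j <= C * h ^+ m.
Proof.
move=> k0 kt h h0; have [N kN] := kt h h0.
pose p m := \prod_(j < m) k j / h ^+ m.
have p0 m : 0 <= p m by rewrite divr_ge0 ?exprn_ge0 ?prodr_ge0 // ltW.
exists (\sum_(j < N.+1) p j) => m; rewrite -ler_pdivrMr ?exprn_gt0 // -/(p m).
have pN n : (n <= N)%N -> p n <= \sum_(j < N.+1) p j.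
  rewrite -ltnS => nN; rewrite (bigD1 (Ordinal nN)) //= lerDl.
  by apply: sumr_ge0.
case: (leqP m N) => [/pN//|/ltnW/subnKC <-].
elim: (m - N)%N => [|n IH]; first by rewrite addn0 pN.
apply: le_trans IH; rewrite addnS /p big_ord_recr /= exprSr invfM mulrACA ler_piMr //; first exact: p0.
rewrite ler_pdivrMr // mul1r; have := kN (N + n)%N (leq_addr _ _).
by rewrite subr0 ger0_norm.
Qed.

Lemma exists_cutoff : exists th : R -> R, [/\ test 1 th,
  forall x, `|x| <= 2^-1 -> th x = 1 & forall x, 0 <= th x].
Proof.
(* Radii [a n] proportional to differences of square roots of the tails of the
   series of [1 / mratio n] are summable, and [(a n)^-1 = o(mratio n)]; the
   latter gives bounds [h^m M m] for every [h]. *)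
have [S tS uS] := inv_mratio_sum.
pose u n := \sum_(j < n) (mratio j)^-1.
pose T n := S - u n.
have T0 n : 0 < T n by rewrite subr_gt0 uS.
have TS n : T n = T n.+1 + (mratio n)^-1 by rewrite /T /u big_ord_recr /=; ring.
pose s n := Num.sqrt (T n).
have s0 n : 0 < s n by rewrite sqrtr_gt0.
have s2 n : s n ^+ 2 = T n by rewrite sqr_sqrtr // ltW.
(* The radii telescope to [c * s 0], which has to be [1/8]. *)
pose c := (8 * s 0%N)^-1.
have c0 : 0 < c by rewrite invr_gt0 mulr_gt0.
pose a n := c * (s n - s n.+1).
have sS n : s n.+1 < s n by rewrite ltr_sqrt // [ltRHS]TS ltrDl invr_gt0 mratio_gt0.
have a0 n : 0 < a n by rewrite mulr_gt0 // subr_gt0.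
have ts : tends (fun n => c * s n) 0.
  rewrite -[X in tends _ X](mulr0 c); apply: tendsZ => e e0.
  have [N SN] := tS (e ^+ 2) (exprn_gt0 2 e0).
  exists N => n /SN; rewrite distrC => Sn'; have Sn := le_trans (ler_norm _) Sn'.
  rewrite subr0 (gtr0_norm (s0 n)).
  by rewrite -ler_sqr ?nnegrE ?(ltW e0) ?(ltW (s0 n)) // s2.
have as8 n : \sum_(j < n) a j + c * s n = 8^-1.
  elim: n => [|n IH]; last by rewrite big_ord_recr /= -IH /a; ring.
  by rewrite big_ord0 add0r /c; field; rewrite gt_eqF.
have [th [sth [th1 th0] thge thb]] := exists_bump a0 ts as8.
exists th; split => //; split; last by move=> x /ltW/th0.
split=> //.
(* The inverse ratio is the difference of squares [(s n - s n.+1) (s n + s n.+1)]; its first factor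
   is [a n / c], and its second tends to [0]. *)
have ainv n : (a n)^-1 <= 2 * s n / c * mratio n.
  rewrite -[leLHS]mul1r ler_pdivrMr //.
  have e : (mratio n)^-1 = (s n - s n.+1) * (s n + s n.+1).
    by rewrite -subr_sqr !s2 TS; ring.
  rewrite [leRHS](_ : _ = mratio n * ((s n - s n.+1) * (2 * s n))); last first.
    by rewrite /a; field; rewrite gt_eqF.
  rewrite -[leLHS](_ : mratio n * (mratio n)^-1 = 1); last by rewrite divff ?gt_eqF ?mratio_gt0.
  rewrite e ler_wpM2l ?(ltW (mratio_gt0 n)) // ler_wpM2l ?subr_ge0 ?(ltW (sS n)) //.
  by have := sS n; lra.
have tk : tends (fun n => 2 * s n / c) 0.
  rewrite -[X in tends _ X](mulr0 (2 / c ^+ 2)).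
  rewrite (_ : (fun n => 2 * s n / c) = fun n => 2 / c ^+ 2 * (c * s n)); first exact: tendsZ.
  by apply/funext => n; field; rewrite gt_eqF.
have k0 n : 0 <= 2 * s n / c by rewrite divr_ge0 ?mulr_ge0 ?ltW.
have H h : 0 < h -> exists C, dbnd th h C.
  move=> h0; have [C hC] := prod_le_geometric k0 tk h0.
  exists (C / M 0%N) => m x; apply: le_trans (thb m x) _.
  have pm : \prod_(j < m) mratio j = M m / M 0%N.
    elim: m {x} => [|m IH]; first by rewrite big_ord0 divff // gt_eqF.
    by rewrite big_ord_recr /= IH /mratio; field; rewrite !gt_eqF.
  apply: le_trans (_ : \prod_(j < m) (2 * s j / c * mratio j) <= _).
    by apply: ler_prod => j _; rewrite invr_ge0 ltW //= ainv.
  rewrite big_split /= pm [leRHS](_ : _ = C * h ^+ m * (M m / M 0%N)); last by ring.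
  by rewrite ler_wpM2r ?hC // divr_ge0 ?M_ge0.
by rewrite /coqu; case: star => //; exists 1 => //; apply: H.
Qed.

End UltraClass.

(** * Uniform boundedness *)

Section UniformBoundedness.
Context {R : realType}.
Variables (M : nat -> R).
Hypothesis M_gt0 : forall p, 0 < M p.
Variables (r : R) (hs : nat -> R).
Hypotheses (hs_gt0 : forall i, 0 < hs i)
  (hs_le : forall i j, (i <= j)%N -> hs j <= hs i).
Implicit Types (f g : R -> R) (c d C K B : R).

(** With [hs] decreasing to [0] this is the whole projective limit over the parameters, with
    constant [hs] a single Banach step of the inductive limit. *)
Definition step_dom f :=
  [/\ smooth f, supp r f & forall i, exists C, dbnd M f (hs i) C].

Variable T : nat -> (R -> R) -> R.
Hypotheses (T_add : forall n f g, step_dom f -> step_dom g ->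
    T n (fun x => f x + g x) = T n f + T n g)
  (T_scale : forall n c f, step_dom f -> T n (fun x => c * f x) = c * T n f)
  (T_cont : forall n, exists i C, forall f B, step_dom f -> dbnd M f (hs i) B ->
    `|T n f| <= C * B)
  (T_bounded : forall f, step_dom f -> exists C, forall n, `|T n f| <= C).

Lemma step_domD f g : step_dom f -> step_dom g -> step_dom (fun x => f x + g x).
Proof.
move=> [sf rf bf] [sg rg bg]; split; first exact: smoothD.
  by move=> x rx; rewrite rf // rg // addr0.
move=> i; have [C fC] := bf i; have [C' gC] := bg i.
by exists (C + C'); apply: dbndD.
Qed.

Lemma step_domZ c f : step_dom f -> step_dom (fun x => c * f x).
Proof.
move=> [sf rf bf]; split; first exact: smoothZ.
  by move=> x rx; rewrite rf // mulr0.
by move=> i; have [C fC] := bf i; exists (`|c| * C); apply: dbndZ.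
Qed.

Let unbounded := forall i C, exists n f B,
  [/\ step_dom f, dbnd M f (hs i) B & C * B < `|T n f|].

(** A counterexample to boundedness is rescaled to seminorm [d]. If its bound [B] is [0], continuity
    of [T n] gives [T n f = 0], so that it was none. *)
Lemma unbounded_hump : unbounded -> forall i d K, 0 < d ->
  exists n f, [/\ step_dom f, dbnd M f (hs i) d & K < `|T n f|].
Proof.
move=> un i d K d0; have [n [f [B [df fB Tf]]]] := un i (`|K| / d).
have := dbnd_ge0 M_gt0 fB; rewrite le_eqVlt => /predU1P[B0|B0].
  have [i' [C TC]] := T_cont n.
  have : `|T n f| <= C * 0.
    by apply: TC => // m x; have := fB m x; rewrite -B0 !mul0r.
  by rewrite mulr0 => /(lt_le_trans Tf); rewrite -B0 mulr0 ltxx.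
exists n, (fun x => d / B * f x); split; first exact: step_domZ.
  have dB : `|d / B| * B = d by rewrite gtr0_norm ?divr_gt0 // divfK // gt_eqF.
  by rewrite -[X in dbnd _ _ _ X]dB; apply: dbndZ => //; case: df.
rewrite T_scale // normrM gtr0_norm ?divr_gt0 //; apply: le_lt_trans (ler_norm K) _.
rewrite [ltLHS](_ : _ = d / B * (`|K| / d * B)); last by field; rewrite !gt_eqF.
by rewrite ltr_pM2l // divr_gt0.
Qed.

(* One step of the gliding hump; the last clause protects the functional made
   large at this step from all later corrections. *)
Let next (s s' : (R -> R) * R * nat) := let: (y, d, i) := s in let: (y', d', i') := s' in
  step_dom y -> 0 < d -> [/\ step_dom y', 0 < d' /\ 2 * d' <= d, (i < i')%N,
    (forall m x, `|derive1n m y' x - derive1n m y x| <= d * hs i ^+ m * M m) &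
    exists n, i%:R + 1 < `|T n y'| /\
      forall z, step_dom z -> dbnd M z (hs i') (2 * d') -> `|T n z| <= 1].

Lemma unbounded_next : unbounded -> forall s, exists s', next s s'.
Proof.
move=> un [[y d] i].
have [[dy d0]|ndy] := pselect (step_dom y /\ 0 < d); last first.
  by exists (y, d, i) => dy d0; case: ndy.
have [Cy yC] := T_bounded dy.
(* The index [n] comes only with the hump. Pointwise boundedness at [y] provides a constant [Cy]
   that is valid for every [n]. *)
have [n [x [dx xd Tx]]] := unbounded_hump un i (i%:R + 1 + Cy) d0.
have [k [C TC]] := T_cont n.
(* All later corrections together have size at most [2 d'] in the seminorm that controls [T n],
   hence change [T n] by at most [1]. *)
pose d' := Num.min (d / 2) ((2 * (`|C| + 1))^-1).
have d'0 : 0 < d'.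
  by rewrite lt_min divr_gt0 //= invr_gt0 mulr_gt0 // ltr_wpDl.
exists ((fun t => y t + x t), d', maxn i.+1 k) => _ _; split.
- exact: step_domD.
- split=> //; have : d' <= d / 2 by rewrite ge_min lexx.
  lra.
- by rewrite leq_maxl.
- move=> m t; case: dx dy => sx _ _ [sy _ _].
  by rewrite derive1n_add // addrC addKr; apply: xd.
- exists n; split.
    rewrite T_add //; rewrite [T n y + _]addrC; have := lerB_normD (T n x) (T n y).
    by have := yC n; lra.
  move=> z dz zd; have zk : dbnd M z (hs k) (2 * d').
    by apply: dbnd_le zd => //; apply: hs_le; rewrite leq_maxr.
  apply: le_trans (TC z _ dz zk) _.
  have dC : d' <= (2 * (`|C| + 1))^-1 by rewrite ge_min lexx orbT.
  apply: le_trans (_ : (`|C| + 1) * (2 * (2 * (`|C| + 1))^-1) <= _).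
    apply: le_trans (_ : `|C| * (2 * d') <= _).
      by rewrite ler_wpM2r ?ler_norm // mulr_ge0 // ltW.
    by apply: ler_pM; rewrite ?mulr_ge0 ?(ltW d'0) ?lerDl ?ler_wpM2l.
  have C1 : `|C| + 1 != 0 by rewrite gt_eqF // ltr_wpDl.
  by rewrite le_eqVlt; apply/orP; left; apply/eqP; field.
Qed.

(** Otherwise the sums of humps converge to some [phi] in the space, by its completeness, and the
    functional picked at step [j] exceeds [I j >= j] at [phi], against pointwise boundedness. *)
Lemma uniform_boundedness : exists i C, forall n f B,
  step_dom f -> dbnd M f (hs i) B -> `|T n f| <= C * B.
Proof.
apply: contrapT => nb.
have un : unbounded.
  move=> i C; apply: contrapT => nT; apply: nb; exists i, C => n f B df fB.
  by rewrite leNgt; apply/negP => CT; apply: nT; exists n, f, B.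
pose nx s := sval (cid (unbounded_next un s)).
have nxP s : next s (nx s) by exact: svalP.
have smooth0 : smooth (fun _ : R => (0 : R)) by apply: (tower_smooth (@tower0 R)).
pose s0 : (R -> R) * R * nat := (fun=> 0, 1, 0%N).
pose st j := iter j nx s0.
pose y j := (st j).1.1; pose d j := (st j).1.2; pose I j := (st j).2.
have stE j : st j = (y j, d j, I j) by rewrite /y /d /I; case: (st j) => -[].
have inv j : step_dom (y j) /\ 0 < d j.
  elim: j => [|j [dy dj]].
    split; rewrite /d ?ltr01 //; split=> // i; exists 0 => m x.
    by rewrite (tower_derive1n m (@tower0 R)) normr0 !mul0r.
  by have := nxP (st j); rewrite -[nx _]/(st j.+1) !stE => /(_ dy dj) [? [? _] _ _ _].
have stp j : [/\ 2 * d j.+1 <= d j, (I j < I j.+1)%N,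
   (forall m x, `|derive1n m (y j.+1) x - derive1n m (y j) x| <= d j * hs (I j) ^+ m * M m) &
    exists n, (I j)%:R + 1 < `|T n (y j.+1)| /\
      forall z, step_dom z -> dbnd M z (hs (I j.+1)) (2 * d j.+1) -> `|T n z| <= 1].
  have [dy dj] := inv j.
  by have := nxP (st j); rewrite -[nx _]/(st j.+1) !stE => /(_ dy dj) [? [_ ?] ? ? ?].
have I_le j l : (j <= l)%N -> (I j <= I l)%N.
  move=> /subnKC <-; elim: (l - j)%N => [|k IH]; first by rewrite addn0.
  by apply: leq_trans IH _; rewrite addnS; have [_ /ltnW] := stp (j + k)%N.
have jI j : (j <= I j)%N.
  by elim: j => // j IH; apply: leq_ltn_trans IH _; have [] := stp j.
(* As [2 d k.+1 <= d k], every increment [d k] is at most [2 (d k - d k.+1)], and the estimates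
   telescope. *)
have tele m j l x : (j <= l)%N -> `|derive1n m (y l) x - derive1n m (y j) x| <=
    2 * (d j - d l) * hs (I j) ^+ m * M m.
  move=> /subnKC <-; elim: (l - j)%N => [|k IH].
    by rewrite addn0 !subrr normr0 mulr0 !mul0r.
  have [h1 _ h2 _] := stp (j + k)%N.
  have h3 : `|derive1n m (y (j + k).+1) x - derive1n m (y (j + k)%N) x| <=
     d (j + k)%N * hs (I j) ^+ m * M m.
    apply: le_trans (h2 m x) _; rewrite ler_wpM2r ?M_ge0 // ler_wpM2l //.
      by have [_ /ltW] := inv (j + k)%N.
    apply: lerXn2r; rewrite ?nnegrE ?(ltW (hs_gt0 _)) //.
    by apply/hs_le/I_le/leq_addr.
  rewrite addnS; apply: le_trans (ler_distD (derive1n m (y (j + k)%N) x) _ _) _.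
  apply: le_trans (lerD h3 IH) _; rewrite -!mulrDl.
  rewrite ler_wpM2r ?M_ge0 // ler_wpM2r ?exprn_ge0 ?(ltW (hs_gt0 _)) //.
  lra.
have d_tends : tends d 0.
  apply: (@tends_squeeze _ _ _ (fun j => 2^-1 ^+ j)); first exact: tends_half.
  move=> j; rewrite subr0 gtr0_norm; last by have [] := inv j.
  elim: j => [|j IH]; first by rewrite expr0.
  by rewrite exprS; have [h _ _ _] := stp j; lra.
pose e m j := 2 * d j * hs 0%N ^+ m * M m.
have e0 m : tends (e m) 0.
  rewrite -[X in tends _ X](mulr0 (2 * hs 0%N ^+ m * M m)).
  rewrite (_ : e m = fun j => 2 * hs 0%N ^+ m * M m * d j); first exact: tendsZ.
  by apply/funext => j; rewrite /e; ring.
have dle j l : 2 * (d j - d l) <= 2 * d j.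
  by have [_ /ltW ?] := inv l; lra.
have [phi sphi phiE] : exists2 f, smooth f & forall m j x, (m <= j)%N ->
    `|derive1n m f x - derive1n m (y j) x| <= e m j.
  apply: smooth_lim => //; first by move=> j; have [[]] := inv j.
  move=> m j l x jl; apply: le_trans (tele m j l x jl) _; rewrite /e.
  rewrite ler_wpM2r ?M_ge0 //; apply: ler_pM; rewrite ?exprn_ge0 ?(ltW (hs_gt0 _)) //.
    rewrite mulr_ge0 // subr_ge0; move: jl => /subnKC <-.
    elim: (l - j)%N => [|k IH]; first by rewrite addn0.
    apply: le_trans IH; rewrite addnS; have [h _ _ _] := stp (j + k)%N.
    by have [_ /ltW] := inv (j + k).+1; lra.
  by apply: lerXn2r; rewrite ?nnegrE ?(ltW (hs_gt0 _)) // hs_le.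
have tphi m x : tends (fun j => derive1n m (y j) x) (derive1n m phi x).
  move=> eps eps0; have [N eN] := e0 m eps eps0; exists (maxn m N) => j.
  rewrite geq_max => /andP[mj /eN]; rewrite subr0 distrC => ej.
  by apply: le_trans (phiE _ _ _ mj) _; apply: le_trans (ler_norm _) ej.
have tail m j x : `|derive1n m phi x - derive1n m (y j) x| <=
    2 * d j * hs (I j) ^+ m * M m.
  apply: (tends_dist (j := j) (tphi m x)) => l jl; apply: le_trans (tele m j l x jl) _.
  rewrite ler_wpM2r ?M_ge0 // ler_wpM2r ?dle //.
  by rewrite exprn_ge0 // ltW.
have tail_dbnd j : dbnd M (fun x => phi x + -1 * y j x) (hs (I j)) (2 * d j).
  have [[sy _ _] _] := inv j; move=> m x.
  by rewrite derive1n_add ?derive1n_scale //; [rewrite mulN1r; apply: tail|apply: smoothZ].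
have dphi : step_dom phi.
  split=> //.
    move=> x rx; apply: (tends_unique (tphi 0%N x)).
    rewrite (_ : (fun j => _) = fun=> 0); first exact: tends_cst.
    by apply/funext => j /=; have [[_ sy _] _] := inv j; apply: sy.
  move=> i; have [[sy _ by_] dj] := inv i; have [C yC] := by_ i.
  exists (2 * d i + C).
  have -> : phi = (fun x => (phi x + -1 * y i x) + y i x) by apply/funext => x; ring.
  apply: dbndD => //; first exact/smoothD/smoothZ.
  by apply: dbnd_le (tail_dbnd i) => //; apply: hs_le.
have tail_dom j : step_dom (fun x => phi x + -1 * y j x).
  by have [dy _] := inv j; apply/step_domD/step_domZ.
have [C Cphi] := T_bounded dphi.
have [j Cj] : exists j : nat, C <= j%:R.
  by exists (Num.truncn C).+1; apply/ltW/truncnS_gt.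
have [_ _ _ [n [Tn]]] := stp j.
move=> /(_ _ (tail_dom j.+1) (tail_dbnd j.+1)).
have [dy _] := inv j.+1; rewrite T_add //; last exact: step_domZ.
rewrite T_scale // mulN1r => h1; have := Cphi n; apply/negP; rewrite -ltNge.
apply: le_lt_trans Cj _; have : (j%:R : R) <= (I j)%:R by rewrite ler_nat.
have := lerB_dist (T n (y j.+1)) (T n phi); rewrite distrC; lra.
Qed.

End UniformBoundedness.

(** * Fourier series *)

Section RiemannLebesgue.
Context {R : realType}.
Implicit Types (f g k : R -> R) (a b c w x z : R) (j n N L : nat).

Lemma is_derive_sinZ w x : is_derive x (1 : R) (fun y => sin (w * y)) (w * cos (w * x)).
Proof.
rewrite mulrC; have d := is_derive_eq (is_deriveZr w (is_derive_idr x)) (mulr1 w).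
exact: is_derive_compr (is_derive_sin _) d.
Qed.

Lemma is_derive_cosZ w x : is_derive x (1 : R) (fun y => cos (w * y)) (- w * sin (w * x)).
Proof.
rewrite mulNr -mulrN mulrC; have d := is_derive_eq (is_deriveZr w (is_derive_idr x)) (mulr1 w).
exact: is_derive_compr (is_derive_cos _) d.
Qed.

Lemma continuous_sinZ w : continuous (fun y : R => sin (w * y)).
Proof. by apply: is_derive_continuous => x; apply: is_derive_sinZ. Qed.

Lemma continuous_cosZ w : continuous (fun y : R => cos (w * y)).
Proof. by apply: is_derive_continuous => x; apply: is_derive_cosZ. Qed.

Lemma sin_natpi n : sin (n%:R * pi) = 0 :> R.
Proof.
elim: n => [|n IH]; first by rewrite mul0r sin0.
by rewrite -natr1 mulrDl mul1r sinDpi IH oppr0.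
Qed.

Lemma itg_cos_period n : (0 < n)%N -> itg (- pi) pi (fun z : R => cos (n%:R * z)) = 0.
Proof.
move=> n0; have nn0 : n%:R != 0 :> R by rewrite pnatr_eq0 -lt0n.
rewrite (@itg_prim _ (fun z => n%:R^-1 * sin (n%:R * z))); last 2 first.
- exact: continuous_cosZ.
- by move=> x; apply: is_derive_eq (is_deriveZr _ (is_derive_sinZ _ _)) _; rewrite mulKf.
by rewrite mulrN sinN sin_natpi oppr0 !mulr0 subrr.
Qed.

(** Numerator of the Dirichlet kernel, whose denominator is [2 sin (z / 2)]. *)
Definition halfsin n (z : R) : R := sin ((n%:R + 2^-1) * z).

Lemma continuous_halfsin n : continuous (halfsin n).
Proof. exact: continuous_sinZ. Qed.

Lemma itg_halfsin n m : itg (- pi) pi (fun z => halfsin n z * halfsin m z) =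
  if n == m then pi else 0.
Proof.
wlog nm : n m / (m <= n)%N.
  move=> H; case: (leqP m n) => [/H//|/ltnW/H]; rewrite eq_sym => <-.
  by congr itg; apply/funext => z; rewrite mulrC.
have -> : (fun z => halfsin n z * halfsin m z) =
  (fun z => 2^-1 * (cos ((n - m)%:R * z) - cos ((n + m).+1%:R * z))).
  apply/funext => z; rewrite /halfsin.
  have -> : (n - m)%:R * z = (n%:R + 2^-1) * z - (m%:R + 2^-1) * z.
    by rewrite natrB //; ring.
  have -> : (n + m).+1%:R * z = (n%:R + 2^-1) * z + (m%:R + 2^-1) * z.
    by rewrite -natr1 natrD; field.
  by rewrite cosB cosD; field.
rewrite itgZ; last by apply: contB; apply: continuous_cosZ.
rewrite itgB; try exact: continuous_cosZ.
rewrite [X in _ - X]itg_cos_period // subr0; case: eqP => [->|/eqP nem].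
  rewrite subnn; under [X in itg _ _ X]eq_fun do rewrite mul0r cos0.
  by rewrite itg_cst; field.
by rewrite itg_cos_period ?mulr0 // subn_gt0 ltn_neqAle eq_sym nem.
Qed.

(* Bessel's inequality: the squares of the coefficients of [k] along the
   orthogonal system [halfsin] are summable. *)
Lemma riemann_lebesgue k : continuous k ->
  tends (fun n => itg (- pi) pi (fun z => k z * halfsin n z)) 0.
Proof.
move=> ck; pose I n := itg (- pi) pi (fun z => k z * halfsin n z).
pose res n z := k z - \sum_(i < n) pi^-1 * I i * halfsin i z.
have pi0 := pi_gt0 R.
have cres n : continuous (res n).
  by apply: contB => //; apply: continuous_sum => i; apply/contZ/continuous_halfsin.
have resS n : res n.+1 = fun z => res n z + (- (pi^-1 * I n)) * halfsin n z.
  by apply/funext => z; rewrite /res big_ord_recr /=; ring.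
have res_I n m : (n <= m)%N -> itg (- pi) pi (fun z => res n z * halfsin m z) = I m.
  elim: n => [|n IH] nm.
    by congr itg; apply/funext => z; rewrite /res big_ord0 subr0.
  rewrite resS; under [X in itg _ _ X]eq_fun do rewrite mulrDl -mulrA.
  have c2 : continuous (fun z => halfsin n z * halfsin m z).
    by apply: contM; apply: continuous_halfsin.
  rewrite itgD; last 2 first.
  - exact/contM/continuous_halfsin.
  - exact: contZ.
  by rewrite itgZ // itg_halfsin ltn_eqF // mulr0 addr0 IH // ltnW.
have res2 n : itg (- pi) pi (fun z => res n z * res n z) =
    itg (- pi) pi (fun z => k z * k z) - pi^-1 * \sum_(i < n) I i ^+ 2.
  elim: n => [|n IH].
    rewrite big_ord0 mulr0 subr0; congr itg; apply/funext => z.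
    by rewrite /res big_ord0 subr0.
  rewrite big_ord_recr /= resS.
  have -> : (fun z => (res n z + - (pi^-1 * I n) * halfsin n z) *
      (res n z + - (pi^-1 * I n) * halfsin n z)) =
     fun z => res n z * res n z + ((- 2 * (pi^-1 * I n)) * (res n z * halfsin n z) +
       (pi^-1 * I n) ^+ 2 * (halfsin n z * halfsin n z)).
    by apply/funext => z; ring.
  have c1 : continuous (fun z => res n z * res n z) by apply: contM.
  have c2 : continuous (fun z => res n z * halfsin n z).
    exact/contM/continuous_halfsin.
  have c3 : continuous (fun z => halfsin n z * halfsin n z).
    by apply: contM; apply: continuous_halfsin.
  rewrite itgD; [|exact: c1|by apply: contD; apply: contZ].
  rewrite itgD; [|exact: contZ|exact: contZ].
  rewrite !itgZ // itg_halfsin eqxx res_I // IH.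
  rewrite [(pi^-1 * I n) ^+ 2 * pi](_ : _ = (pi^-1 * pi) * (pi^-1 * I n ^+ 2)); last by ring.
  by rewrite mulVf ?gt_eqF //; ring.
pose s n := \sum_(i < n) I i ^+ 2.
have sB n : s n <= pi * itg (- pi) pi (fun z => k z * k z).
  rewrite -ler_pdivrMl // -subr_ge0 -res2.
  rewrite -[leLHS](_ : itg (- pi) pi (fun=> 0) = 0); last by rewrite itg_cst mul0r.
  apply: itg_le; [exact: cont_cst|exact: contM|lra|].
  by move=> z _; rewrite -expr2 sqr_ge0.
have sm : {homo s : n m / (n <= m)%N >-> n <= m}.
  by apply/nondecreasing_seqP => n; rewrite /s big_ord_recr /= lerDl sqr_ge0.
have cs : cvgn s.
  apply: nondecreasing_is_cvgn => //.
  by exists (pi * itg (- pi) pi (fun z => k z * k z)) => _ [n _ <-].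
have ts : tends s (limn s) by apply/tendsP.
move=> e e0; have e2 : 0 < e ^+ 2 / 2 by rewrite divr_gt0 // exprn_gt0.
have [N sN] := ts _ e2.
exists N => n Nn; rewrite subr0 -/(I n) -(ger0_norm (ltW e0)) -ler_sqr ?nnegrE //.
rewrite !real_normK ?num_real //.
have -> : I n ^+ 2 = (s n.+1 - limn s) - (s n - limn s).
  by rewrite /s big_ord_recr /=; ring.
have h1 := sN n Nn; have h2 := sN n.+1 (leqW Nn).
apply: le_trans (ler_norm _) _; apply: le_trans (ler_normB _ _) _; lra.
Qed.

End RiemannLebesgue.

(** * Pointwise convergence of Fourier series with a remainder estimate *)

Section Fourier.
Context {R : realType}.
Implicit Types (f g k psi : R -> R) (a b c w x z B : R) (j n N L : nat).

Definition slope f d z := if z == 0 then d else f z / z.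

Lemma continuous_slope f d : continuous f -> f 0 = 0 -> is_derive (0 : R) (1 : R) f d ->
  continuous (slope f d).
Proof.
move=> cf f0 df z; have [->|z0] := eqVneq z 0.
  apply/cvgrPdist_le => e e0; have [r r0 fr] := is_derive_dist df e0.
  exists r => // h; rewrite /ball_ /= sub0r normrN /slope eqxx => /fr.
  rewrite add0r f0 subr0; have [->|h0] := eqVneq h 0.
    by rewrite subrr normr0 => _; apply: ltW.
  rewrite distrC -[X in _ -> `|X| <= _](mulfK h0) normrM normfV.
  rewrite ler_pdivrMr ?normr_gt0 //.
  by congr (`|_| <= _); field.
have : {for z, continuous (fun z => f z / z)}.
  apply: continuousM; first exact: cf.
  by apply: continuousV => //; exact: cvg_id.
move=> c; rewrite /continuous_at {2}/slope (negbTE z0).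
apply: cvg_trans (c : (fun z => f z / z) @ z --> f z / z); apply: near_eq_cvg.
exists `|z| => /=; first by rewrite normr_gt0.
move=> y; rewrite /ball_ /= /slope; have [->|//] := eqVneq y 0.
by rewrite subr0 ltxx.
Qed.

Lemma sin_half_pos z : 0 < z <= pi -> 0 < sin (z / 2).
Proof. by move=> /andP[z0 zpi]; apply: sin_gt0_pi; have := pi_gt0 R; lra. Qed.

(** Numerator and denominator both vanish at [0]; each is divided by [z] and completed by its
    derivative there, which makes the quotient continuous. *)
Lemma exists_dirichlet_quotient psi x : smooth psi ->
  exists2 k : R -> R, continuous k & forall z, - pi <= z <= pi ->
    psi (x - z) - psi x = k z * (2 * sin (z / 2)).
Proof.
move=> spsi.
have dpsi t : is_derive t (1 : R) psi (derive1n 1 psi t) by apply: smooth_tower spsi 0%N t.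
pose g z := psi (x - z) - psi x.
have dg z : is_derive z (1 : R) g (- derive1n 1 psi (x - z)).
  have d1 : is_derive z (1 : R) (fun z => x - z) (- 1).
    by apply: is_derive_eq (is_deriveDr (is_derive_cstr z x) (is_deriveNr (is_derive_idr z))) _; rewrite add0r.
  have d2 := is_derive_compr (f := psi) (g := fun z => x - z) (dpsi (x - z)) d1.
  have := is_deriveDr d2 (is_derive_cstr z (- psi x)).
  by rewrite addr0 mulrN1.
have ds (z : R) : is_derive z (1 : R) (fun z => 2 * sin (2^-1 * z)) (cos (2^-1 * z)).
  by apply: is_derive_eq (is_deriveZr 2 (is_derive_sinZ _ _)) _; rewrite mulVKf.
pose q := slope g (- derive1n 1 psi (x - 0)).
have cq : continuous q.
  by apply: continuous_slope; [exact: is_derive_continuous dg|rewrite /g subr0 subrr].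
pose r := slope (fun z => 2 * sin (2^-1 * z)) 1.
have cr : continuous r.
  apply: continuous_slope; first exact: is_derive_continuous ds.
    by rewrite mulr0 sin0 mulr0.
  by have := ds 0; rewrite mulr0 cos0.
have pi0 := pi_gt0 R.
have r0 z : - pi <= z <= pi -> 0 < r z.
  move=> /andP[z1 z2]; rewrite /r /slope; case: (ltgtP z 0) => [zn|zp|//].
    rewrite -[_ / z](_ : 2 * sin (- z / 2) / - z = _); last first.
      by rewrite mulNr sinN mulrN mulNr invrN mulrN opprK (mulrC z).
    by rewrite divr_gt0 ?mulr_gt0 // ?sin_half_pos //; lra.
  by rewrite divr_gt0 ?mulr_gt0 // mulrC sin_half_pos //; lra.
have [|c0 c0pi c0min] := @EVT_min _ r (- pi) pi _ (continuous_subspaceT cr); first lra.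
have rc : 0 < r c0 by apply: r0; move: c0pi; rewrite in_itv.
(* Positivity of [r] is known on [[-pi, pi]] only. Truncation at its minimum [c0] over this interval
   changes nothing there and keeps [k] continuous on the whole line. *)
pose k z := q z / Num.max (r z) (r c0).
exists k.
  apply: contM => // z; suff : {for z, continuous (fun z => (Num.max (r z) (r c0))^-1)} by [].
  apply: (@continuousV _ _ (fun z => Num.max (r z) (r c0))).
    by rewrite gt_eqF // lt_max rc orbT.
  by apply: (@continuous_max _ _ r (fun=> r c0)); [exact: cr|exact: cvg_cst].
move=> z zpi; have rz := r0 z zpi.
have -> : k z = q z / r z.
  by rewrite /k; congr (_ / _); apply/max_idPl/c0min; rewrite in_itv.
have [z0|z0] := eqVneq z 0.
  by rewrite z0 mul0r sin0 !mulr0 subr0 subrr.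
move: rz; rewrite /q /r /slope (negbTE z0) /g (mulrC z) => /lt0r_neq0.
rewrite mulf_eq0 negb_or => /andP[h _].
by move: h; set s := 2 * sin _ => h; field; rewrite z0 h.
Qed.

Lemma itg_reflect f x a b : continuous f ->
  itg a b (fun z => f (x - z)) = itg (x - b) (x - a) f.
Proof.
move=> cf; rewrite (@itg_prim _ (fun z => - prim f (x - z))) /itg.
- by rewrite opprK addrC.
- by apply: cont_comp => //; apply: contB; [apply: cont_cst|apply: cont_id].
- move=> z; have d1 : is_derive z (1 : R) (fun z => x - z) (- 1).
    by apply: is_derive_eq (is_deriveDr (is_derive_cstr z x) (is_deriveNr (is_derive_idr z))) _; rewrite add0r.
  apply: is_derive_eq (is_deriveNr (is_derive_compr (is_derive_prim _ cf) d1)) _.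
  by rewrite mulrN1 opprK.
Qed.

Definition dirichlet N (z : R) : R := 2^-1 + \sum_(j < N) cos (j.+1%:R * z).

Lemma dirichletE N z : dirichlet N z * (2 * sin (z / 2)) = halfsin N z.
Proof.
rewrite /halfsin; elim: N => [|N IH].
  by rewrite /dirichlet big_ord0 addr0 add0r mulrA mulVf // mul1r; congr sin; rewrite mulrC.
rewrite /dirichlet big_ord_recr /= addrA mulrDl IH.
have -> : (N%:R + 2^-1) * z = N.+1%:R * z - z / 2 by rewrite -natr1; field.
have -> : (N.+1%:R + 2^-1) * z = N.+1%:R * z + z / 2 by field.
by rewrite sinB sinD; ring.
Qed.

Lemma continuous_dirichlet N : continuous (dirichlet N).
Proof.
apply: contD; first exact: cont_cst.
by apply: continuous_sum => j; apply: continuous_cosZ.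
Qed.

Lemma itg_dirichlet N : itg (- pi) pi (dirichlet N) = pi.
Proof.
rewrite itgD; last 2 first.
- exact: cont_cst.
- by apply: continuous_sum => j; apply: continuous_cosZ.
rewrite itg_cst itg_sum; last by move=> j; apply: continuous_cosZ.
by rewrite big1 => [|j _]; [field|rewrite itg_cos_period].
Qed.

(** Fourier coefficients over the period [[-pi, pi]]. The functions to be expanded vanish outside
    [[-1/2, 1/2]], which leaves [[-1, 1]]. *)
Definition fcos psi j : R := pi^-1 * itg (-1) 1 (fun t => psi t * cos (j%:R * t)).
Definition fsin psi j : R := pi^-1 * itg (-1) 1 (fun t => psi t * sin (j%:R * t)).
Definition fterm psi j x := fcos psi j * cos (j%:R * x) + fsin psi j * sin (j%:R * x).
Definition fsum psi N x := 2^-1 * fterm psi 0 x + \sum_(j < N) fterm psi j.+1 x.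

Lemma fterm_itg psi j x : continuous psi ->
  fterm psi j x = pi^-1 * itg (-1) 1 (fun t => psi t * cos (j%:R * (x - t))).
Proof.
move=> cp; have -> : (fun t => psi t * cos (j%:R * (x - t))) =
   fun t => cos (j%:R * x) * (psi t * cos (j%:R * t)) + sin (j%:R * x) * (psi t * sin (j%:R * t)).
  by apply/funext => t; rewrite mulrBr cosB; ring.
have c1 : continuous (fun t => psi t * cos (j%:R * t)) by apply/contM/continuous_cosZ.
have c2 : continuous (fun t => psi t * sin (j%:R * t)) by apply/contM/continuous_sinZ.
rewrite itgD; [|exact: contZ|exact: contZ].
by rewrite !itgZ // /fterm /fcos /fsin; ring.
Qed.

Lemma fsum_itg psi N x : continuous psi ->
  fsum psi N x = pi^-1 * itg (-1) 1 (fun t => psi t * dirichlet N (x - t)).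
Proof.
move=> cp; rewrite /fsum; under eq_bigr do rewrite fterm_itg //.
rewrite fterm_itg // -mulr_sumr mulrCA -mulrDr; congr (_ * _).
have c1 j : continuous (fun t => psi t * cos (j%:R * (x - t))).
  apply: contM => //; apply: (@cont_comp _ (fun y => cos (j%:R * y)) (fun t => x - t)).
    exact: continuous_cosZ.
  exact/contB/cont_id/cont_cst.
rewrite -itg_sum // -itgZ // -itgD; [|exact: contZ|exact: continuous_sum].
congr itg; apply/funext => t; rewrite /dirichlet [psi t * (_ + _)]mulrDr mulr_sumr; congr (_ + _).
by rewrite mul0r cos0; ring.
Qed.

(** The error is the integral of a continuous quotient against [halfsin N], and tends to [0] by the
    Riemann-Lebesgue lemma. *)
Lemma fourier_inversion psi x : smooth psi -> supp 2^-1 psi -> `|x| <= 1 ->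
  tends (fun N => fsum psi N x) (psi x).
Proof.
move=> sp supp1; rewrite ler_norml => /andP[x1 x2]; have pi2 := pi_ge2 R.
have cp : continuous psi by apply: (smooth_continuous (n := 0%N)).
have [k ck kE] := exists_dirichlet_quotient x sp.
have pi0 := pi_gt0 R.
have pi00 : pi != 0 :> R by rewrite gt_eqF.
have E N : fsum psi N x = psi x + pi^-1 * itg (- pi) pi (fun z => k z * halfsin N z).
  rewrite fsum_itg //; set F := fun t => psi t * dirichlet N (x - t).
  have cF : continuous F.
    apply: contM => //; apply: cont_comp; first exact: continuous_dirichlet.
    exact/contB/cont_id/cont_cst.
  have F0 a b : a <= b -> b <= -1 \/ 1 <= a -> itg a b F = 0.
    move=> ab h; apply: itg_eq0 => // t /andP[ta tb]; rewrite /F supp1 ?mul0r //.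
    case: h => h; first by rewrite ltr0_norm; lra.
    by rewrite gtr0_norm; lra.
  (* As [pi >= 2] and [|x| <= 1], the window [[x - pi, x + pi]] contains [[-1, 1]]. *)
  have -> : itg (-1) 1 F = itg (x - pi) (x - - pi) F.
    rewrite [RHS](itg_chasles (-1)) [X in _ = _ + X](itg_chasles 1).
    rewrite (F0 (x - pi) (-1)); [|lra|by left].
    by rewrite (F0 1 (x - - pi)); [rewrite add0r addr0|lra|by right].
  rewrite -itg_reflect //.
  have -> : (fun z => F (x - z)) =
     fun z => (psi (x - z) - psi x) * dirichlet N z + psi x * dirichlet N z.
    by apply/funext => z; rewrite /F subKr; ring.
  have c1 : continuous (fun z => psi (x - z) - psi x).
    apply: contB; last exact: cont_cst.
    apply: cont_comp => //.
    exact/contB/cont_id/cont_cst.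
  have cD := @continuous_dirichlet N.
  rewrite itgD; [|exact: contM|exact: contZ].
  rewrite itgZ // itg_dirichlet mulrDr addrC mulrCA mulVf // mulr1.
  congr (_ + _ * _); apply: eq_itg => //; [exact: contM| |lra|].
    exact/contM/continuous_halfsin.
  by move=> z /kE ->; rewrite -mulrA [_ * dirichlet N z]mulrC dirichletE.
have t := tendsZ pi^-1 (riemann_lebesgue ck).
have := tendsD (tends_cst (psi x)) t; rewrite mulr0 addr0.
by congr tends; apply/funext => N; rewrite E.
Qed.

Lemma fsinD psi j : smooth psi -> supp 2^-1 psi ->
  fsin (derive1n 1 psi) j = - (j%:R * fcos psi j) /\
  fcos (derive1n 1 psi) j = j%:R * fsin psi j.
Proof.
move=> sp supp1; have dp := smooth_tower sp 0%N.
have p1 (t : R) : `|t| = 1 -> psi t = 0 by move=> t1; apply: supp1; rewrite t1; lra.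
have cp m := smooth_continuous (n := m) sp.
have pm1 : psi (-1) = 0 by apply: p1; rewrite normrN normr1.
have pp1 : psi 1 = 0 by apply: p1; rewrite normr1.
have cs := @continuous_sinZ R j%:R; have cc := @continuous_cosZ R j%:R.
split.
  have := @itg_parts _ psi (fun t => sin (j%:R * t)) (derive1n 1 psi)
    (fun t => j%:R * cos (j%:R * t)) (-1) 1 (cp 1%N).
  move=> /(_ (@contZ _ _ _ cc) dp (is_derive_sinZ _)).
  rewrite pp1 pm1 !mul0r subrr sub0r => /eqP; rewrite eq_sym eqr_oppLR => /eqP.
  rewrite /fsin => ->; rewrite /fcos mulrN mulrCA; congr (- (_ * _)).
  rewrite -itgZ; last by apply: contM => //; apply: (cp 0%N).
  by congr itg; apply/funext => t; ring.
have := @itg_parts _ psi (fun t => cos (j%:R * t)) (derive1n 1 psi)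
  (fun t => - j%:R * sin (j%:R * t)) (-1) 1 (cp 1%N).
move=> /(_ (@contZ _ _ _ cs) dp (is_derive_cosZ _)).
rewrite pp1 pm1 !mul0r subrr sub0r => /eqP; rewrite eq_sym eqr_oppLR => /eqP.
rewrite /fcos => ->; rewrite /fsin [RHS]mulrCA; congr (_ * _).
rewrite -itgN; last by apply: contM; [apply: (cp 0%N)|apply: contZ].
rewrite -itgZ; last by apply: contM => //; apply: (cp 0%N).
by congr itg; apply/funext => t; ring.
Qed.

Lemma tower_fterm psi j : smooth psi -> supp 2^-1 psi ->
  tower (fun m => fterm (derive1n m psi) j).
Proof.
move=> sp supp1 m x; rewrite /fterm.
have sm := smooth_derive1n m sp; have um := supp_derive1n m sp supp1.
have [] := fsinD j sm um; rewrite -!derive1nD add1n => -> ->.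
apply: is_derive_eq (is_deriveDr (is_deriveZr _ (is_derive_cosZ _ _))
  (is_deriveZr _ (is_derive_sinZ _ _))) _.
by ring.
Qed.

(** The derivatives of the partial sums are the partial sums of the derivatives, so that a single
    remainder estimate serves all orders of differentiation. *)
Lemma tower_fsum psi N : smooth psi -> supp 2^-1 psi ->
  tower (fun m => fsum (derive1n m psi) N).
Proof.
move=> sp supp1; apply: towerD; first exact/towerZ/tower_fterm.
apply: (@tower_sum _ _ _ (fun (j : 'I_N) m => fterm (derive1n m psi) j.+1)) => j.
exact: tower_fterm.
Qed.

Lemma fterm_bound psi j x B : smooth psi -> supp 2^-1 psi ->
  (forall x, `|derive1n 2 psi x| <= B) -> `|fterm psi j.+1 x| <= B / j.+1%:R ^+ 2.
Proof.
move=> sp supp1 pB.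
have E : fterm (derive1n 2 psi) j.+1 x = - (j.+1%:R ^+ 2 * fterm psi j.+1 x).
  have [a1 b1] := fsinD j.+1 sp supp1.
  have [] := fsinD j.+1 (smooth_derive1n 1 sp) (supp_derive1n 1 sp supp1).
  rewrite -!derive1nD a1 b1 => a2 b2; rewrite /fterm a2 b2; ring.
have n0 : 0 < j.+1%:R ^+ 2 :> R by rewrite exprn_gt0.
rewrite ler_pdivlMr // mulrC -[X in X * _]gtr0_norm // -normrM -normrN -E.
have c2 : continuous (derive1n 2 psi) by apply: smooth_continuous.
rewrite fterm_itg // normrM gtr0_norm ?invr_gt0 ?pi_gt0 // mulrC ler_pdivrMr ?pi_gt0 //.
have B0 : 0 <= B := le_trans (normr_ge0 _) (pB 0).
apply: le_trans (itg_bound (B := B) _ _ _) _.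
- apply: contM => //; apply: (@cont_comp _ (fun y => cos (j.+1%:R * y)) (fun t => x - t)).
    exact: continuous_cosZ.
  exact/contB/cont_id/cont_cst.
- lra.
- move=> t _; rewrite normrM -[B]mulr1; apply: ler_pM => //.
  by rewrite ler_norml cos_geN1 cos_le1.
- by rewrite ler_wpM2l //; have := pi_ge2 R; lra.
Qed.

Lemma sum_inv_sqr_tail N L :
  \sum_(j < L) ((N + j).+2%:R ^+ 2)^-1 <= N.+1%:R^-1 - (N + L).+1%:R^-1 :> R.
Proof.
elim: L => [|L IH]; first by rewrite big_ord0 addn0 subrr.
rewrite big_ord_recr /=; apply: le_trans (lerD IH (lexx _)) _.
rewrite addnS -subr_ge0.
have a0 : 0 < (N + L).+1%:R :> R by [].
have e : (N + L).+2%:R = (N + L).+1%:R + 1 :> R by rewrite -natr1.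
rewrite e; move: a0; set q := (N + L).+1%:R; set p := N.+1%:R^-1 => a0.
have -> : p - (q + 1)^-1 - (p - q^-1 + ((q + 1) ^+ 2)^-1) = (q * (q + 1) ^+ 2)^-1.
  by field; rewrite !gt_eqF // ltr_wpDr.
by rewrite invr_ge0 mulr_ge0 ?(ltW a0) // sqr_ge0.
Qed.

(** Two derivatives of [psi] buy absolute convergence and the rate [1 / N]. The rate is linear in
    [B], hence inherited by the seminorms of the test space. *)
Lemma fourier_tail psi N x B : smooth psi -> supp 2^-1 psi -> `|x| <= 1 ->
  (forall x, `|derive1n 2 psi x| <= B) -> `|psi x - fsum psi N.+1 x| <= B / N.+1%:R.
Proof.
move=> sp supp1 x1 pB; have B0 : 0 <= B := le_trans (normr_ge0 _) (pB 0).
apply: (tends_dist (j := N.+1) (fourier_inversion sp supp1 x1)) => L /subnKC <-.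
rewrite (_ : fsum psi _ x - fsum psi _ x =
  \sum_(j < L - N.+1) fterm psi (N.+1 + j).+1 x); last first.
  by rewrite /fsum big_split_ord /=; ring.
apply: le_trans (ler_norm_sum _ _ _) _.
apply: le_trans (_ : B * \sum_(j < L - N.+1) ((N + j).+2%:R ^+ 2)^-1 <= _).
  by rewrite mulr_sumr; apply: ler_sum => j _; rewrite -addSn; apply: fterm_bound.
rewrite ler_wpM2l //; apply: le_trans (sum_inv_sqr_tail _ _) _.
by rewrite lerBlDr lerDl invr_ge0.
Qed.

End Fourier.

(** * Local structure *)

Section BlockSums.
Context {R : realType}.
Variable d : nat -> nat.
Hypotheses (d_le : forall l, (d l <= d l.+1)%N) (d_oo : forall N, exists l, (N <= d l)%N).

Definition block_end N := ex_minn (d_oo N).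

Lemma d_homo l l' : (l <= l')%N -> (d l <= d l')%N.
Proof.
move=> /subnKC <-; elim: (l' - l)%N => [|k IH]; first by rewrite addn0.
by rewrite addnS; apply: leq_trans IH (d_le _).
Qed.

Lemma block_endP N l : (l < block_end N)%N = (d l < N)%N.
Proof.
rewrite /block_end; case: ex_minnP => k Nk kmin; case: (ltnP (d l) N) => dl.
  by rewrite ltnNge; apply/negP => kl; have := leq_trans Nk (d_homo kl); rewrite leqNgt dl.
by apply/negbTE; rewrite -leqNgt; apply: kmin.
Qed.

Lemma block_end_oo L : exists N0, forall N, (N0 <= N)%N -> (L <= block_end N)%N.
Proof.
exists (d L).+1 => N LN; have : (L < block_end N)%N by rewrite block_endP.
exact: ltnW.
Qed.

(** Since [d] is monotone, a partial sum over the orders is itself a partial sum over the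
    frequencies; the terms are regrouped without any appeal to absolute convergence. *)
Lemma block_sum (a : nat -> R) N :
  \sum_(m < N) \sum_(l < block_end m.+1 | d l == m) a l = \sum_(l < block_end N) a l.
Proof.
have widen m : (m < N)%N -> \sum_(l < block_end m.+1 | d l == m) a l =
    \sum_(l < block_end N | d l == m) a l.
  move=> mN; have le : (block_end m.+1 <= block_end N)%N.
    by rewrite leqNgt block_endP -leqNgt; apply: leq_trans mN _;
       rewrite leqNgt -block_endP ltnn.
  rewrite -!(big_mkord (fun l => d l == m) a) [RHS](@big_cat_nat _ _ _ (block_end m.+1)) //=.
  rewrite [X in _ = _ + X]big_nat_cond [X in _ = _ + X]big1 ?addr0 // => l /andP[/andP[h _] /eqP e].
  by move: h; rewrite leqNgt block_endP e ltnS leqnn.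
under eq_bigr => m _ do rewrite widen //.
rewrite (exchange_big_dep xpredT) //=; apply: eq_bigr => l _.
have dl : (d l < N)%N by rewrite -block_endP.
by rewrite (big_pred1 (Ordinal dl)) // => m; rewrite /= eq_sym.
Qed.

End BlockSums.

Section Trigonometric.
Context {R : realType}.

Lemma tower_cosZ (w c : R) : tower (fun m x => w ^+ m * cos (w * x + c + m%:R * (pi / 2))).
Proof.
move=> m x.
have d1 : is_derive x (1 : R) (fun x => w * x + c + m%:R * (pi / 2)) w.
  have := is_deriveDr (is_deriveZr w (is_derive_idr x)) (is_derive_cstr x c).
  move=> /is_deriveDr/(_ (is_derive_cstr x (m%:R * (pi / 2)))).
  by rewrite mulr1 !addr0.
apply: is_derive_eq (is_deriveZr _ (is_derive_compr (is_derive_cos _) d1)) _.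
have -> : w * x + c + m.+1%:R * (pi / 2) = w * x + c + m%:R * (pi / 2) + pi / 2.
  by rewrite -natr1; ring.
by rewrite cosDpihalf exprS; ring.
Qed.

Lemma smooth_cosZ (w : R) : smooth (fun x => cos (w * x)) /\
  forall m x, `|derive1n m (fun x => cos (w * x)) x| <= `|w| ^+ m.
Proof.
have := tower_cosZ w 0; set F := (fun m => _) => tF.
have F0 : F 0%N = fun x => cos (w * x).
  by apply/funext => x; rewrite /F mul1r mul0r !addr0.
rewrite -F0; split; first exact: tower_smooth.
move=> m x; rewrite tower_derive1n // /F normrM normrX ler_piMr ?exprn_ge0 //.
by rewrite ler_norml cos_geN1 cos_le1.
Qed.

Lemma smooth_sinZ (w : R) : smooth (fun x => sin (w * x)) /\
  forall m x, `|derive1n m (fun x => sin (w * x)) x| <= `|w| ^+ m.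
Proof.
have := tower_cosZ w (- (pi / 2)); set F := (fun m => _) => tF.
have F0 : F 0%N = fun x => sin (w * x).
  apply/funext => x; rewrite /F mul1r mul0r !addr0 cosB cos_pihalf sin_pihalf.
  by rewrite mulr0 add0r mulr1.
rewrite -F0; split; first exact: tower_smooth.
move=> m x; rewrite tower_derive1n // /F normrM normrX ler_piMr ?exprn_ge0 //.
by rewrite ler_norml cos_geN1 cos_le1.
Qed.

End Trigonometric.

(** * The associated function of the weight sequence *)

Section AssociatedFunction.
Context {R : realType}.
Variables (M : nat -> R) (star : ultra_case).
Hypotheses (M_gt0 : forall p, 0 < M p) (M1 : cond_M1 M) (M2' : cond_M2' M)
  (M3' : cond_M3' M).
Implicit Types (t s h C : R).

Lemma exists_mratio_gt t : exists p, t < mratio M p.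
Proof.
have [p0 h] := mratio_oo M_gt0 M3' (t + 1); exists p0.
by apply: lt_le_trans (h p0 (leqnn _)); rewrite ltrDl.
Qed.

Let Mge p : 0 <= M p. Proof. exact: M_ge0. Qed.

(** The sequence [t^m / M m] increases as long as the ratio of the weights is at most [t], so this
    is an index where it is maximal. *)
Definition mstar t := ex_minn (exists_mratio_gt t).

Lemma mstarP t p : (p < mstar t)%N = (mratio M p <= t).
Proof.
rewrite /mstar; case: ex_minnP => k tk kmin; case: (ltnP p k) => pk.
  by apply/esym; rewrite leNgt; apply/negP => /kmin; rewrite leqNgt pk.
by apply/esym/negbTE; rewrite -ltNge; apply: lt_le_trans tk (mratio_le M_gt0 M1 pk).
Qed.

Lemma mstar_le t t' : t <= t' -> (mstar t <= mstar t')%N.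
Proof.
case E : (mstar t) => [//|p] tt; rewrite mstarP; apply: le_trans tt.
by rewrite -mstarP E.
Qed.

(** The supremum of [t^m / M m] over [m]: the exponential of the associated function, up to the
    factor [M 0]. *)
Definition assoc t := t ^+ mstar t / M (mstar t).

Lemma assoc_max t m : 0 <= t -> t ^+ m / M m <= assoc t.
Proof.
move=> t0.
have S p : t ^+ p.+1 / M p.+1 = t ^+ p / M p * (t / mratio M p).
  by rewrite /mratio exprSr; field; rewrite !gt_eqF.
have q0 p : 0 <= t ^+ p / M p by rewrite divr_ge0 ?exprn_ge0 // ltW.
have r0 p : 0 < mratio M p by apply: mratio_gt0.
have up k : (m + k <= mstar t)%N -> t ^+ m / M m <= t ^+ (m + k) / M (m + k)%N.
  elim: k => [|k IH]; first by rewrite addn0.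
  rewrite addnS => kt; apply: le_trans (IH (ltnW kt)) _.
  by rewrite S ler_peMr // ler_pdivlMr // mul1r -mstarP.
have [mt|/ltnW/subnKC] := leqP m (mstar t).
  by have := up (mstar t - m)%N; rewrite subnKC //; apply.
move=> <-; elim: (m - mstar t)%N => [|k IH]; first by rewrite addn0.
apply: le_trans IH; rewrite addnS S ler_piMr // ler_pdivrMr // mul1r ltW //.
by rewrite ltNge -mstarP -leqNgt leq_addr.
Qed.

Lemma assoc_le t t' : 0 <= t -> t <= t' -> assoc t <= assoc t'.
Proof.
move=> t0 tt; apply: le_trans (assoc_max (mstar t) (le_trans t0 tt)).
rewrite ler_wpM2r ?invr_ge0 ?Mge //; apply: lerXn2r => //.
by rewrite nnegrE; apply: le_trans tt.
Qed.

Lemma assoc_ge0 t : 0 <= t -> 0 <= assoc t.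
Proof. by move=> t0; rewrite divr_ge0 ?exprn_ge0 ?Mge. Qed.

(** Take for [i j] the largest [i <= j] with [C i <= j + 1], or [0] if there is none. These levels
    tend to infinity however fast [C] grows, and the default value [0] is paid for by the constant
    [K]. *)
Lemma select_levels (C : nat -> R) : exists i : nat -> nat,
  (forall I, exists J, forall j, (J <= j)%N -> (I <= i j)%N) /\
  exists K, forall j, C (i j) <= K * j.+1%:R.
Proof.
pose P j i := (i <= j)%N && ((i == 0)%N || (C i <= j.+1%:R)).
have exP j : exists i, P j i by exists 0%N; rewrite /P eqxx.
have ubP j i : P j i -> (i <= j)%N by case/andP.
pose i j := ex_maxn (exP j) (ubP j).
have iP j : P j (i j) by rewrite /i; case: ex_maxnP.
have imax j k : P j k -> (k <= i j)%N by rewrite /i; case: ex_maxnP => ? _; apply.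
exists i; split.
  move=> I; exists (maxn I (Num.truncn (C I))) => j; rewrite geq_max => /andP[Ij CIj].
  apply: imax; rewrite /P Ij /=; apply/orP; right.
  by apply: le_trans (ltW (truncnS_gt _)) _; rewrite ler_nat.
exists (`|C 0%N| + 1) => j; have j1 : 1 <= j.+1%:R :> R by rewrite ler1n.
have [_ /orP[/eqP ->|Cj]] := andP (iP j).
  apply: le_trans (ler_norm _) _; rewrite -[leLHS]mulr1.
  by apply: ler_pM => //; rewrite lerDl.
by apply: le_trans Cj _; rewrite ler_peMl ?lerDr // (le_trans _ j1).
Qed.

(* A single sequence [t] replaces the family of bounds [assoc (s j)], [s > 0]:
   in the Roumieu case the parameter is decreased along the frequencies, as
   slowly as needed to absorb the constants in one power of [j]. *)
Lemma select_scale (g : nat -> nat -> R) :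
  qu star (fun s => exists C, forall n j, `|g n j| <= C * assoc (s * j%:R)) ->
  exists t : nat -> R, [/\ forall j, 0 < t j, forall j, t j <= t j.+1,
    forall T, exists j, T <= t j,
    qu star (fun s => exists J, forall j, (J <= j)%N -> t j <= s * j.+1%:R) &
    exists C, forall n j, `|g n j.+1| <= C * j.+1%:R * assoc (t j)].
Proof.
have nat_oo (T : R) : exists j : nat, T <= j%:R.
  by exists (Num.truncn T).+1; apply/ltW/truncnS_gt.
rewrite /qu; case: star => [[s s0 [C gC]]|gC].
  exists (fun j => s * j.+1%:R); split.
  - by move=> j; rewrite mulr_gt0.
  - by move=> j; rewrite ler_wpM2l ?ler_nat // ltW.
  - move=> T; have [j Tj] := nat_oo (T / s); exists j.
    by rewrite -ler_pdivrMl // mulrC; apply: le_trans Tj _; rewrite ler_nat.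
  - by exists s => //; exists 0%N.
  - exists `|C| => n j; apply: le_trans (gC n j.+1) _.
    have a0 : 0 <= assoc (s * j.+1%:R) by apply: assoc_ge0; rewrite mulr_ge0 // ltW.
    rewrite ler_wpM2r // -[leLHS]mulr1; apply: le_trans (_ : `|C| * 1 <= _).
      by rewrite ler_wpM2r ?ler_norm.
    by rewrite ler_wpM2l // ler1n.
have Hc (i : nat) : exists C, forall n j, `|g n j| <= C * assoc ((i.+1%:R)^-1 * j%:R).
  by apply: gC; rewrite invr_gt0.
pose C i := sval (cid (Hc i)).
have CP i n j : `|g n j| <= C i * assoc ((i.+1%:R)^-1 * j%:R) by apply: (svalP (cid (Hc i))).
have [i [i_oo [K CK]]] := select_levels C.
(* The first entry carries the bound at level [i j]; the square root makes the sequence unbounded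
   and is itself [o(j)]. The running maximum [t] is monotone in addition. *)
pose v j : R := Num.max ((i j).+1%:R^-1 * j.+1%:R) (Num.sqrt j.+1%:R).
pose t := fix t j : R := if j is j'.+1 then Num.max (t j') (v j'.+1) else v 0%N.
have vt j : v j <= t j by case: j => [|j] //=; rewrite le_max lexx orbT.
have sq0 j : 0 < Num.sqrt (j.+1%:R : R) by rewrite sqrtr_gt0.
have tS j : t j <= t j.+1 by rewrite /= le_max lexx.
exists t; split => //.
- by move=> j; apply: lt_le_trans (vt j); rewrite lt_max sq0 orbT.
- move=> T; have [j Tj] := nat_oo (T ^+ 2); exists j; apply: le_trans (vt j).
  rewrite le_max; apply/orP; right; case: (leP T 0) => [T0|T0].
    exact: le_trans T0 (ltW (sq0 j)).
  rewrite -ler_sqr ?nnegrE ?(ltW T0) ?(ltW (sq0 j)) // sqr_sqrtr //.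
  by apply: le_trans Tj _; rewrite ler_nat.
- move=> s s0.
  have [I sI] := nat_oo (s^-1); have [J0 iJ0] := i_oo I.
  have [J1 sJ1] := nat_oo ((s ^+ 2)^-1).
  pose L := maxn J0 J1.
  have vs j : (L <= j)%N -> v j <= s * j.+1%:R.
    rewrite geq_max => /andP[/iJ0 Ii Jj]; rewrite ge_max; apply/andP; split.
      rewrite ler_wpM2r // -[s]invrK lef_pV2 ?posrE ?invr_gt0 //.
      by apply: le_trans sI _; rewrite ler_nat; apply: leqW.
    rewrite -ler_sqr ?nnegrE ?(ltW (sq0 j)) // ?mulr_ge0 ?(ltW s0) // sqr_sqrtr //.
    rewrite exprMn expr2 mulrA ler_peMl // -[leLHS](_ : s ^+ 2 * (s ^+ 2)^-1 = 1); last first.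
      by rewrite divff // gt_eqF // exprn_gt0.
    rewrite ler_wpM2l ?sqr_ge0 //; apply: le_trans sJ1 _.
    by rewrite ler_nat; apply: leqW.
  have [J2 tJ2] := nat_oo (t L / s).
  have st k : t (L + k)%N <= Num.max (t L) (s * (L + k).+1%:R).
    elim: k => [|k IH]; first by rewrite addn0 le_max lexx.
    rewrite addnS /= ge_max; apply/andP; split.
      apply: le_trans IH _; rewrite ge_max !le_max lexx /=; apply/orP; right.
      by rewrite ler_wpM2l ?(ltW s0) // ler_nat.
    rewrite le_max; apply/orP; right; apply: vs.
    by rewrite -addnS leq_addr.
  exists (maxn L J2) => j; rewrite geq_max => /andP[Lj Jj].
  have := st (j - L)%N; rewrite subnKC // => h; apply: le_trans h _.
  rewrite ge_max lexx andbT -ler_pdivrMl // mulrC; apply: le_trans tJ2 _.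
  by rewrite ler_nat; apply: leqW.
exists `|K| => n j; apply: le_trans (CP (i j) n j.+1) _.
have a0 : 0 <= (i j).+1%:R^-1 * j.+1%:R :> R by rewrite mulr_ge0 // invr_ge0.
apply: le_trans (_ : `|K| * j.+1%:R * assoc ((i j).+1%:R^-1 * j.+1%:R) <= _).
  rewrite ler_wpM2r ?assoc_ge0 //; apply: le_trans (CK j) _.
  by rewrite ler_wpM2r // ler_norm.
rewrite ler_wpM2l ?mulr_ge0 //; apply: assoc_le => //.
by apply: le_trans (vt j); rewrite le_max lexx.
Qed.

End AssociatedFunction.

(** * Expansion of a uniformly bounded sequence of functionals *)

Section LocalStructure.
Context {R : realType}.
Variables (M : nat -> R) (star : ultra_case).
Hypotheses (M_gt0 : forall p, 0 < M p) (M1 : cond_M1 M) (M2' : cond_M2' M)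
  (M3' : cond_M3' M).
Implicit Types (f g psi : R -> R) (h s C B w : R) (n j m : nat).
Local Notation test := (test_function M star).
Local Notation assoc := (assoc M_gt0 M3').
Local Notation mstar := (mstar M_gt0 M3').

Let Mge p : 0 <= M p. Proof. exact: M_ge0. Qed.

Let tD r f g : test r f -> test r g -> test r (fun x => f x + g x).
Proof. exact: testD. Qed.

Let tM r f g : test r f -> udiff M star g -> test r (fun x => f x * g x).
Proof. exact: testM. Qed.

Let tS (I : Type) (s : seq I) r (f : I -> R -> R) : (forall i, test r (f i)) ->
  test r (fun x => \sum_(i <- s) f i x).
Proof. exact: test_sum. Qed.

Variable u : nat -> (R -> R) -> R.
Hypotheses (uD : forall n f g, test 1 f -> test 1 g ->
    u n (fun x => f x + g x) = u n f + u n g)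
  (uZ : forall n c f, test 1 f -> u n (fun x => c * f x) = c * u n f)
  (u_bound : qu star (fun h => exists C, forall n f B, test 1 f -> dbnd M f h B ->
    `|u n f| <= C * B)).
Variable th : R -> R.
Hypotheses (th_test : test 1 th) (th1 : forall x, `|x| <= 2^-1 -> th x = 1).

(** The seminorm of an exponential of frequency [w] is the supremum of [(w / k)^m / M m], which is
    the associated function at [w / k]. *)
Lemma dbnd_pow f w k : 0 < k -> 0 <= w -> (forall m x, `|derive1n m f x| <= w ^+ m) ->
  dbnd M f k (assoc (k^-1 * w)).
Proof.
move=> k0 w0 fw m x; apply: le_trans (fw m x) _.
have w1 : 0 <= k^-1 * w by rewrite mulr_ge0 // invr_ge0 ltW.
have := assoc_max M_gt0 M1 M3' m w1; rewrite ler_pdivrMr // => am.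
have km : 0 < k ^+ m by rewrite exprn_gt0.
move: am; rewrite exprMn exprVn -ler_pdivlMl ?invr_gt0 // invrK => am.
by rewrite -mulrA mulrCA.
Qed.

Lemma udiff_pow f w : 0 <= w -> smooth f -> (forall m x, `|derive1n m f x| <= w ^+ m) ->
  udiff M star f.
Proof.
move=> w0 sf fw; split=> //.
have H k : 0 < k -> exists C, dbnd M f k C.
  by move=> k0; exists (assoc (k^-1 * w)); apply: dbnd_pow.
by rewrite /coqu; case: star => //; exists 1 => //; apply: H.
Qed.

Let tcos j x := th x * cos (j%:R * x).
Let tsin j x := th x * sin (j%:R * x).

Lemma test_tcos j : test 1 (tcos j).
Proof.
have [sc bc] := smooth_cosZ (j%:R : R).
apply: tM => //; apply: udiff_pow sc _; last exact: bc.
by [].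
Qed.

Lemma test_tsin j : test 1 (tsin j).
Proof.
have [sc bc] := smooth_sinZ (j%:R : R).
apply: tM => //; apply: udiff_pow sc _; last exact: bc.
by [].
Qed.

Lemma freq_bound_pow (f : nat -> R -> R) : (forall j, smooth (f j)) ->
  (forall j m x, `|derive1n m (f j) x| <= j%:R ^+ m) ->
  qu star (fun s => exists C, forall n j,
    `|u n (fun x => th x * f j x)| <= C * assoc (s * j%:R)).
Proof.
move=> sf fb; have [[sth uth] _] := th_test.
suff : qu star (fun k => exists C, forall n j,
    `|u n (fun x => th x * f j x)| <= C * assoc (k^-1 * j%:R)).
  by apply: (@qu_inv _ _ 1) => // k k0; rewrite div1r.
apply: (qu_split _ u_bound uth) => e k e0 k0 [A thA] [C uC].
exists (C * (A * M 0%N)) => n j.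
have fk : dbnd M (f j) k (assoc (k^-1 * j%:R)) by apply: dbnd_pow.
have tf : test 1 (fun x => th x * f j x).
  by apply: tM => //; apply: udiff_pow (sf j) (fb j).
apply: le_trans (uC n _ _ tf (dbndM M_gt0 M1 e0 k0 sth (sf j) thA fk)) _.
by rewrite le_eqVlt; apply/orP; left; apply/eqP; ring.
Qed.

Let Gc n j := u n (tcos j).
Let Gs n j := u n (tsin j).

Let gsum n j : R := `|Gc n j| + `|Gs n j|.

Lemma freq_bound : qu star (fun s => exists C, forall n j,
  `|gsum n j| <= C * assoc (s * j%:R)).
Proof.
have h1 : qu star (fun s => exists C, forall n j, `|Gc n j| <= C * assoc (s * j%:R)).
  apply: freq_bound_pow => j; first by case: (smooth_cosZ (j%:R : R)).
  by move=> m x; have [_ h] := smooth_cosZ (j%:R : R); apply: le_trans (h m x) _; rewrite normr_nat.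
have h2 : qu star (fun s => exists C, forall n j, `|Gs n j| <= C * assoc (s * j%:R)).
  apply: freq_bound_pow => j; first by case: (smooth_sinZ (j%:R : R)).
  by move=> m x; have [_ h] := smooth_sinZ (j%:R : R); apply: le_trans (h m x) _; rewrite normr_nat.
have mono (g : nat -> nat -> R) s s' : 0 < s -> s <= s' ->
    (exists C, forall n j, `|g n j| <= C * assoc (s * j%:R)) ->
    exists C, forall n j, `|g n j| <= C * assoc (s' * j%:R).
  move=> s0 ss [C gC]; exists `|C| => n j; apply: le_trans (gC n j) _.
  have a0 : 0 <= s * j%:R by rewrite mulr_ge0 // ltW.
  apply: le_trans (_ : `|C| * assoc (s * j%:R) <= _).
    by rewrite ler_wpM2r ?ler_norm //; apply: assoc_ge0.
  by rewrite ler_wpM2l //; apply: assoc_le => //; rewrite ler_wpM2r.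
have comb s : (exists C, forall n j, `|Gc n j| <= C * assoc (s * j%:R)) ->
  (exists C, forall n j, `|Gs n j| <= C * assoc (s * j%:R)) ->
  exists C, forall n j, `|gsum n j| <= C * assoc (s * j%:R).
  move=> [C GC] [C' GC']; exists (C + C') => n j.
  by rewrite /gsum ger0_norm ?addr_ge0 // mulrDl; apply: lerD.
move: h1 h2; rewrite /qu; case: star => [[s s0 h] [s' s0' h']|h h' s s0].
  exists (Num.max s s'); first by rewrite lt_max s0.
  by apply: comb; [apply: mono h|apply: mono h'] => //; rewrite le_max lexx ?orbT.
by apply: comb; [apply: h|apply: h'].
Qed.

Lemma test_fterm psi j : test 1 (fun x => th x * fterm psi j x).
Proof.
have -> : (fun x => th x * fterm psi j x) =
  fun x => fcos psi j * tcos j x + fsin psi j * tsin j x.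
  by apply/funext => x; rewrite /fterm /tcos /tsin; ring.
by apply: tD; apply: testZ; [apply: test_tcos|apply: test_tsin].
Qed.

Lemma u_fterm n psi j : u n (fun x => th x * fterm psi j x) =
  fcos psi j * Gc n j + fsin psi j * Gs n j.
Proof.
have -> : (fun x => th x * fterm psi j x) =
  fun x => fcos psi j * tcos j x + fsin psi j * tsin j x.
  by apply/funext => x; rewrite /fterm /tcos /tsin; ring.
have tc := test_tcos j; have ts := test_tsin j.
by rewrite uD ?uZ //; apply: testZ.
Qed.

Lemma u_sum n (I : Type) (s : seq I) (f : I -> R -> R) : (forall i, test 1 (f i)) ->
  u n (fun x => \sum_(i <- s) f i x) = \sum_(i <- s) u n (f i).
Proof.
move=> tf; elim: s => [|i s IH].
  under eq_fun do rewrite big_nil; rewrite big_nil.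
  have -> : (fun _ : R => 0) = (fun x => 0 * th x) :> (R -> R) by apply/funext => x; rewrite mul0r.
  by rewrite uZ // mul0r.
under eq_fun do rewrite big_cons.
by rewrite big_cons uD ?IH //; apply: tS.
Qed.

Lemma u_fsum n psi N : u n (fun x => th x * fsum psi N x) =
  2^-1 * (fcos psi 0 * Gc n 0%N + fsin psi 0 * Gs n 0%N) +
  \sum_(j < N) (fcos psi j.+1 * Gc n j.+1 + fsin psi j.+1 * Gs n j.+1).
Proof.
have -> : (fun x => th x * fsum psi N x) =
  fun x => 2^-1 * (th x * fterm psi 0 x) + \sum_(j < N) (th x * fterm psi j.+1 x).
  by apply/funext => x; rewrite /fsum mulrDr mulr_sumr; ring.
have tf := test_fterm psi.
rewrite uD; [|exact: testZ|by apply: tS => j; apply: tf].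
rewrite uZ // u_fterm u_sum //.
by congr (_ + _); apply: eq_bigr => j _; rewrite u_fterm.
Qed.

Lemma test_cutoff psi : test 2^-1 psi -> (fun x => th x * psi x) = psi.
Proof.
move=> [_ sp]; apply/funext => x; case: (leP `|x| 2^-1) => [/th1 ->|/sp ->].
  by rewrite mul1r.
by rewrite mulr0.
Qed.

(** The partial sums approximate [psi] on [[-1, 1]] only. The cut-off [th] vanishes outside this
    interval and is [1] on the support of [psi], so that [th psi = psi] and the cut remainder tends
    to [0] in a seminorm that controls [u n]. *)
Lemma u_fsum_tends n psi : test 2^-1 psi ->
  tends (fun N => u n (fun x => th x * fsum psi N.+1 x)) (u n psi).
Proof.
move=> tp; have [[sp up] supp_p] := tp; have [[sth uth] supp_th] := th_test.
have [A [H [A1 H1 AH]]] := M2_ge1 M_gt0 M2'.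
have tp1 : test 1 psi by apply: test_le tp; lra.
pose p2 := derive1n 2 psi.
have up2 : coqu star (fun h => exists C, dbnd M p2 h C).
  by rewrite /p2 (derive1nSr 1); case: (udiff_derive1 M_gt0 M2' (udiff_derive1 M_gt0 M2' (conj sp up))).
have upth := coqu_and (dbnd_up M_gt0 (f := th)) (dbnd_up M_gt0 (f := p2)) uth up2.
have upth2 : coqu star (fun k => exists h A B, [/\ 0 < h, k = 2 * h, dbnd M th h A & dbnd M p2 h B]).
  by apply: (@coqu_scale _ _ 2) upth => // h h0 [[A' ?] [B ?]]; exists h, A', B.
have [k k0 [[C uC] [h [A' [B [h0 kh thA p2B]]]]]] := qu_coqu u_bound upth2.
have B0 := dbnd_ge0 M_gt0 p2B.
have tl N : `|u n (fun x => th x * fsum psi N.+1 x) - u n psi| <=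
    C * (A' * B * M 0%N) * (N.+1%:R)^-1.
  pose g x := -1 * fsum psi N.+1 x + psi x.
  have tF := tower_fsum N.+1 sp supp_p.
  have sF : smooth (fsum psi N.+1) := tower_smooth tF.
  have sg : smooth g by apply: smoothD => //; apply: smoothZ.
  have tfs : test 1 (fun x => th x * fsum psi N.+1 x).
    have -> : (fun x => th x * fsum psi N.+1 x) =
      fun x => 2^-1 * (th x * fterm psi 0 x) + \sum_(j < N.+1) (th x * fterm psi j.+1 x).
      by apply/funext => x; rewrite /fsum mulrDr mulr_sumr; ring.
    apply: tD; first exact/testZ/test_fterm.
    by apply: tS => j; apply: test_fterm.
  have eg : (fun x => th x * g x) = fun x => -1 * (th x * fsum psi N.+1 x) + psi x.
    apply/funext => x; have /= e := congr1 (@^~ x) (test_cutoff tp).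
    by rewrite /g mulrDr e; ring.
  have tg : test 1 (fun x => th x * g x).
    by rewrite eg; apply: tD => //; apply: testZ.
  have gB m x : `|x| <= 1 -> `|derive1n m g x| <= B / N.+1%:R * h ^+ m * M m.
    move=> x1; rewrite derive1n_add //; last exact: smoothZ.
    rewrite derive1n_scale // mulN1r addrC (tower_derive1n m tF).
    have [smp supm] := (smooth_derive1n m sp, supp_derive1n m sp supp_p).
    have ft := @fourier_tail R (derive1n m psi) N x (B * h ^+ m * M m) smp supm x1.
    apply: le_trans (ft _) _.
      by move=> y; rewrite -derive1nD addnC derive1nD; apply: p2B.
    by rewrite le_eqVlt; apply/orP; left; apply/eqP; ring.
  have db : dbnd M (fun x => th x * g x) k (A' * (B / N.+1%:R) * M 0%N).
    rewrite kh mulr_natl mulr2n.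
    apply: (@dbnd_mul_on _ M M_gt0 M1 (fun x => `|x| <= 1)) => //.
    - by move=> m x /negP; rewrite -ltNge; apply: supp_derive1n.
    - by rewrite divr_ge0.
  have -> : u n (fun x => th x * fsum psi N.+1 x) - u n psi = - u n (fun x => th x * g x).
    by rewrite eg uD ?uZ //; [ring|apply: testZ].
  rewrite normrN; apply: le_trans (uC n _ _ tg db) _.
  by rewrite le_eqVlt; apply/orP; left; apply/eqP; ring.
apply: tends_squeeze tl; rewrite -[X in tends _ X](mulr0 (C * (A' * B * M 0%N))).
apply: tendsZ; apply/tendsP; exact: cvg_harmonic.
Qed.

(** Term of frequency [j] in the formal Fourier series of the functional [u n] multiplied by the
    cut-off [th]. *)
Let E n j x := pi^-1 * (Gc n j * cos (j%:R * x) + Gs n j * sin (j%:R * x)).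

Lemma continuous_E n j : continuous (E n j).
Proof.
by apply/contZ/contD; apply: contZ; [apply: continuous_cosZ|apply: continuous_sinZ].
Qed.

Lemma E_bound n j x : `|E n j x| <= gsum n j.
Proof.
have pi1 : 1 <= pi :> R by apply: le_trans (pi_ge2 R); lra.
have pi0 := pi_gt0 R.
rewrite normrM gtr0_norm ?invr_gt0 // mulrC ler_pdivrMr //.
apply: le_trans (ler_normD _ _) _; apply: le_trans (_ : gsum n j * 1 <= _); last first.
  by rewrite ler_wpM2l // addr_ge0.
rewrite mulr1 /gsum !normrM; apply: lerD; rewrite ler_piMr // ler_norml.
  by rewrite cos_geN1 cos_le1.
by rewrite sin_geN1 sin_le1.
Qed.

Lemma E_itg n j g : continuous g ->
  itg (-1) 1 (fun x => E n j x * g x) = fcos g j * Gc n j + fsin g j * Gs n j.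
Proof.
move=> cg; have -> : (fun x => E n j x * g x) = fun x =>
    pi^-1 * Gc n j * (g x * cos (j%:R * x)) + pi^-1 * Gs n j * (g x * sin (j%:R * x)).
  by apply/funext => x; rewrite /E; ring.
have c1 : continuous (fun t => g t * cos (j%:R * t)) by apply/contM/continuous_cosZ.
have c2 : continuous (fun t => g t * sin (j%:R * t)) by apply/contM/continuous_sinZ.
rewrite itgD; [|exact: contZ|exact: contZ].
by rewrite !itgZ // /fcos /fsin; ring.
Qed.

Lemma fcos_derive_even psi j r : smooth psi -> supp 2^-1 psi ->
  fcos (derive1n r.*2 psi) j = (-1) ^+ r * j%:R ^+ r.*2 * fcos psi j /\
  fsin (derive1n r.*2 psi) j = (-1) ^+ r * j%:R ^+ r.*2 * fsin psi j.
Proof.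
move=> sp supp1; elim: r => [|r [IHc IHs]]; first by rewrite !expr0 !mul1r.
have s1 := smooth_derive1n r.*2 sp; have u1 := supp_derive1n r.*2 sp supp1.
have [a1 b1] := fsinD j s1 u1.
have [] := fsinD j (smooth_derive1n 1 s1) (supp_derive1n 1 s1 u1).
rewrite -!derive1nD a1 b1 !add1n IHc IHs doubleS => -> ->.
by split; rewrite !exprS; ring.
Qed.

Lemma u_term n psi j r : smooth psi -> supp 2^-1 psi ->
  fcos psi j.+1 * Gc n j.+1 + fsin psi j.+1 * Gs n j.+1 =
  (-1) ^+ r / j.+1%:R ^+ r.*2 *
    itg (-1) 1 (fun x => E n j.+1 x * derive1n r.*2 psi x).
Proof.
move=> sp supp1; rewrite E_itg; last exact: smooth_continuous.
have [-> ->] := fcos_derive_even j.+1 r sp supp1.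
have n0 : j.+1%:R ^+ r.*2 != 0 :> R by rewrite expf_neq0 // pnatr_eq0.
have ss : (-1) ^+ r * (-1) ^+ r = 1 :> R by rewrite -expr2 -exprM mulnC exprM sqrrN !expr1n.
move: ((-1) ^+ r) (j.+1%:R ^+ r.*2) ss n0 => e y ss n0.
by rewrite -[LHS]mul1r -ss; field.
Qed.

(** Iteration of [(M.2)']. Four is the largest excess of the number of integrations by parts over
    the optimal index. *)
Lemma M_shift : exists A H : R, [/\ 1 <= A, 1 <= H &
  forall m e, (e <= 4)%N -> M (m + e)%N <= A * H ^+ (m + e) * M m].
Proof.
have [A [H [A1 H1 AH]]] := M2_ge1 M_gt0 M2'.
have A0 : 0 <= A by apply: le_trans A1. 
have H0 : 0 <= H by apply: le_trans H1.
have it m e : M (m + e)%N <= A ^+ e * (H ^+ e) ^+ (m + e) * M m.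
  elim: e => [|e IH]; first by rewrite addn0 !expr0 expr1n !mul1r.
  rewrite addnS; apply: le_trans (AH _) _.
  apply: le_trans (ler_wpM2l _ IH) _; first by rewrite mulr_ge0 ?exprn_ge0.
  rewrite [leLHS](_ : _ = A ^+ e.+1 * (H ^+ (m + e) * (H ^+ e) ^+ (m + e)) * M m); last first.
    by rewrite exprS; ring.
  rewrite ler_wpM2r // ler_wpM2l ?exprn_ge0 // -!exprM -exprD ler_weXn2l //.
  by rewrite mulSn mulnS; lia.
exists (A ^+ 4), (H ^+ 4); split; try exact: exprn_ege1.
move=> m e e4; apply: le_trans (it m e) _; rewrite ler_wpM2r //.
apply: ler_pM; rewrite ?exprn_ge0 //; first exact: ler_weXn2l.
apply: lerXn2r; rewrite ?nnegrE ?exprn_ge0 //; exact: ler_weXn2l.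
Qed.

Lemma qu_exists (Q : R -> Prop) : qu star Q -> exists2 h, 0 < h & Q h.
Proof. by rewrite /qu; case: star => // h; exists 1; [|apply: h]. Qed.

Lemma sum_inv_sqr L : \sum_(l < L) (l.+1%:R ^+ 2)^-1 <= 2 :> R.
Proof.
case: L => [|L]; first by rewrite big_ord0.
rewrite big_ord_recl /= expr1n invr1.
have h : \sum_(i < L) (i.+2%:R ^+ 2)^-1 <= 1%:R^-1 - L.+1%:R^-1 := @sum_inv_sqr_tail R 0 L.
rewrite -[X in 1 + X]/(\sum_(i < L) (i.+2%:R ^+ 2)^-1).
have z0 : 0 <= L.+1%:R^-1 :> R by rewrite invr_ge0.
apply: le_trans (lerD (lexx 1) h) _; rewrite invr1.
by move: (L.+1%:R^-1) z0 => z z0; lra.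
Qed.

Lemma local_structure : exists P : nat -> nat -> R -> R,
  [/\ forall n m, continuous (P n m),
      qu star (fun l => exists C, forall n m x, `|P n m x| <= C * l ^+ m / M m) &
      forall n psi, test 2^-1 psi -> tends (fun N =>
        \sum_(m < N) itg (-1) 1 (fun x => P n m x * derive1n m psi x)) (u n psi)].
Proof.
have [t [t0 t_mono t_oo t_small [C gC]]] := select_scale M1 freq_bound.
(* The term of frequency [l.+1] is integrated by parts [d l] times; [d l] is even,
   so that cosines give cosines, and slightly exceeds the maximizing index
   [mstar (t l)], so that the series over [l] converges. *)
pose d l := (((mstar (t l)).+4)./2).*2.
have d_bnd l : (mstar (t l) + 3 <= d l <= mstar (t l) + 4)%N.
  by rewrite /d; move: (mstar (t l)) => m; have := odd_double_half m.+4; clear; case: (odd _) => /=; lia.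
have d_le l : (d l <= d l.+1)%N.
  by rewrite /d leq_double half_leq // !ltnS; apply: mstar_le.
have d_oo N : exists l, (N <= d l)%N.
  have [l Tl] := t_oo (mratio M N); exists l.
  have h : (N < mstar (t l))%N by rewrite mstarP.
  by have /andP[+ _] := d_bnd l; move: (mstar _) (d l) h; clear => m e; lia.
(* This factor undoes the sign and the power of the frequency produced by [d l] integrations by
   parts. *)
pose c l : R := (-1) ^+ (d l)./2 / l.+1%:R ^+ d l.
pose P n m x := (if m == 0%N then 2^-1 * E n 0 x else 0) +
  \sum_(l < block_end d_oo m.+1 | d l == m) c l * E n l.+1 x.
have P_sum n m : P n m = fun x => (if m == 0%N then 2^-1 else 0) * E n 0 x +
  \sum_(l < block_end d_oo m.+1) (if d l == m then c l else 0) * E n l.+1 x.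
  apply/funext => x; rewrite /P; congr (_ + _); first by case: eqP => //; rewrite mul0r.
  by rewrite big_mkcond /=; apply: eq_bigr => l _; case: eqP => //; rewrite mul0r.
have cP n m : continuous (P n m).
  rewrite P_sum; apply: contD; first exact/contZ/continuous_E.
  by apply: continuous_sum => l; apply/contZ/continuous_E.
exists P; split => //.
  have [s0 s00 [C0 C0g]] := qu_exists freq_bound.
  have [A [H [A1 H1 AH]]] := M_shift.
  have H0 : 0 < H by apply: lt_le_trans H1.
  apply: (qu_scale H0 _ t_small) => s s_gt0 [J tJ].
  pose a l : R := (l.+1%:R ^+ d l)^-1 * (`|C| * l.+1%:R * assoc (t l)).
  have a_ge0 l : 0 <= a l.
    apply: mulr_ge0; first by rewrite invr_ge0 exprn_ge0.
    by apply: mulr_ge0; [rewrite mulr_ge0|apply: assoc_ge0 => //; apply: ltW].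
  have l_gt0 : 0 < H * s by rewrite mulr_gt0.
  pose K := `|C| * (s ^- 3 + s ^- 4) * A.
  have K0 : 0 <= K by rewrite !mulr_ge0 ?addr_ge0 ?invr_ge0 ?exprn_ge0 ?(ltW s_gt0) // (le_trans _ A1).
  (* Up to a factor [(l + 1)^2], this is the size of term [l] relative to the bound [(H s)^m / M m]
     claimed for its order [m = d l]. Boundedness of [b] leaves a sum of inverse squares in each
     order. *)
  pose b l := a l * (l.+1%:R ^+ 2) * (M (d l) / (H * s) ^+ d l).
  have b_ge0 l : 0 <= b l.
    by rewrite !mulr_ge0 ?invr_ge0 ?exprn_ge0 // ltW.
  have bE l : a l = b l * (l.+1%:R ^+ 2)^-1 * ((H * s) ^+ d l / M (d l)).
    rewrite /b; field; rewrite !expf_neq0 ?pnatr_eq0 //= ?gt_eqF //.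
  pose K' := K + \sum_(l < J) b l.
  have bK l : b l <= K'.
    case: (ltnP l J) => lJ.
      rewrite /K' (bigD1 (Ordinal lJ)) //= addrCA lerDl addr_ge0 //.
      by apply: sumr_ge0.
    apply: le_trans (_ : K <= _); last by rewrite lerDl; apply: sumr_ge0.
    have lp : 1 <= l.+1%:R :> R by rewrite ler1n.
    have ln0 : l.+1%:R != 0 :> R by rewrite gt_eqF.
    have Mn0 p : M p != 0 by rewrite gt_eqF.
    have sn0 : s != 0 by rewrite gt_eqF.
    have Hn0 : H != 0 by rewrite gt_eqF.
    have /andP[] := d_bnd l; rewrite /b /a /assoc.
    move: (d l) (mstar (t l)) (tJ l lJ) => e m tl em em4.
    have [k ke k34] : exists2 k, e = (m + k)%N & (k == 3)%N || (k == 4)%N.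
      by clear -em em4; exists (e - m)%N; lia.
    have tm : t l ^+ m <= (s * l.+1%:R) ^+ m.
      by apply: lerXn2r; rewrite ?nnegrE ?mulr_ge0 // ltW.
    have Mk : M e <= A * H ^+ e * M m by rewrite ke; apply: AH; case/orP: k34 => /eqP ->.
    have -> : (l.+1%:R ^+ e)^-1 * (`|C| * l.+1%:R * (t l ^+ m / M m)) * l.+1%:R ^+ 2 *
       (M e / (H * s) ^+ e) =
       `|C| * (l.+1%:R ^+ 3 / l.+1%:R ^+ k) * (t l ^+ m / l.+1%:R ^+ m) / s ^+ e *
         (M e / (H ^+ e * M m)).
      by rewrite ke exprD exprMn; field; rewrite !expf_neq0 ?Mn0.
    (* One power of [l + 1] stems from [select_scale] and two from the summability; the extra
       integrations by parts, [k >= 3] in number, absorb them. *)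
    have q1 : l.+1%:R ^+ 3 / l.+1%:R ^+ k <= 1 :> R.
      by rewrite ler_pdivrMr ?exprn_gt0 // mul1r ler_weXn2l //; case/orP: k34 => /eqP ->.
    have q2 : t l ^+ m / l.+1%:R ^+ m / s ^+ e <= s ^- 3 + s ^- 4.
      apply: le_trans (_ : (s ^+ k)^-1 <= _).
        rewrite ler_pdivrMr ?exprn_gt0 // ler_pdivrMr ?exprn_gt0 //.
        rewrite ke [leRHS](_ : _ = (s * l.+1%:R) ^+ m) //.
        by rewrite exprMn exprD; field; rewrite expf_neq0.
      by case/orP: k34 => /eqP ->; rewrite ?lerDl ?lerDr invr_ge0 exprn_ge0 // ltW.
    have q3 : M e / (H ^+ e * M m) <= A.
      by rewrite ler_pdivrMr ?mulr_gt0 ?exprn_gt0 // mulrA.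
    rewrite [leLHS](_ : _ = `|C| * ((l.+1%:R ^+ 3 / l.+1%:R ^+ k) *
      ((t l ^+ m / l.+1%:R ^+ m / s ^+ e) * (M e / (H ^+ e * M m))))); last by rewrite !mulrA.
    rewrite /K -[leRHS]mulrA; apply: ler_wpM2l => //.
    have p1 : 0 <= l.+1%:R ^+ 3 / l.+1%:R ^+ k :> R by rewrite divr_ge0 ?exprn_ge0.
    have p2 : 0 <= t l ^+ m / l.+1%:R ^+ m / s ^+ e.
      by rewrite !mulr_ge0 ?invr_ge0 ?exprn_ge0 // ltW.
    have p3 : 0 <= M e / (H ^+ e * M m).
      by rewrite divr_ge0 ?mulr_ge0 ?exprn_ge0 // ltW.
    rewrite -[leRHS]mul1r; apply: ler_pM => //; first exact: mulr_ge0.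
    exact: ler_pM.
  have cE n l x : `|c l * E n l.+1 x| <= a l.
    rewrite normrM /c normrM normrX normrN1 expr1n mul1r normfV normrX normr_nat.
    rewrite ler_wpM2l ?invr_ge0 ?exprn_ge0 //; apply: le_trans (E_bound _ _ _) _.
    apply: le_trans (le_trans (ler_norm _) (gC n l)) _.
    by rewrite ler_wpM2r ?assoc_ge0 ?(ltW (t0 l)) // ler_wpM2r // ler_norm.
  have K'0 : 0 <= K' by apply: le_trans (bK 0%N).
  have E0 n x : `|E n 0 x| <= `|C0| * assoc 0.
    apply: le_trans (E_bound _ _ _) _; apply: le_trans (ler_norm _) _.
    apply: le_trans (C0g n 0%N) _; rewrite mulr0.
    by rewrite ler_wpM2r ?assoc_ge0 // ler_norm.
  have Z0 : 0 <= `|C0| * assoc 0 by rewrite mulr_ge0 ?assoc_ge0.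
  exists (`|C0| * assoc 0 * M 0%N + K' * 2) => n m x.
  rewrite /P -mulrA mulrDl; apply: le_trans (ler_normD _ _) _; apply: lerD.
    case: eqP => [->|_]; last first.
      by rewrite normr0 !mulr_ge0 ?invr_ge0 ?exprn_ge0 ?(ltW l_gt0).
    rewrite expr0 div1r mulfK ?gt_eqF // normrM ger0_norm ?invr_ge0 //.
    by apply: le_trans (E0 n x); rewrite ler_piMl //; lra.
  apply: le_trans (ler_norm_sum _ _ _) _.
  apply: le_trans (_ : \sum_(l < block_end d_oo m.+1)
     K' * ((H * s) ^+ m / M m) * (l.+1%:R ^+ 2)^-1 <= _); last first.
    rewrite -mulr_sumr -!mulrA ler_wpM2l // [leRHS]mulrC -mulrA ler_wpM2l ?exprn_ge0 ?(ltW l_gt0) //.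
    by rewrite ler_wpM2l ?invr_ge0 // sum_inv_sqr.
  rewrite big_mkcond /=; apply: ler_sum => l _; case: eqP => [e|_]; last first.
    by rewrite !mulr_ge0 ?invr_ge0 ?exprn_ge0 ?(ltW l_gt0).
  apply: le_trans (cE n l x) _; rewrite bE e [leLHS]mulrAC.
  apply: ler_wpM2r; first by rewrite invr_ge0 exprn_ge0.
  by apply: ler_wpM2r; [rewrite mulr_ge0 ?invr_ge0 ?exprn_ge0 ?(ltW l_gt0)|apply: bK].
move=> n psi tp; have [[sp _] supp_p] := tp.
have c_dpsi m : continuous (derive1n m psi) by apply: smooth_continuous.
have cEd j m : continuous (fun x => E n j x * derive1n m psi x).
  by apply: contM; [apply: continuous_E|].
pose v l := fcos psi l.+1 * Gc n l.+1 + fsin psi l.+1 * Gs n l.+1.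
pose v0 := fcos psi 0 * Gc n 0%N + fsin psi 0 * Gs n 0%N.
have Pitg m : itg (-1) 1 (fun x => P n m x * derive1n m psi x) =
    (if m == 0%N then 2^-1 * v0 else 0) + \sum_(l < block_end d_oo m.+1 | d l == m) v l.
  have -> : (fun x => P n m x * derive1n m psi x) = fun x =>
     (if m == 0%N then 2^-1 else 0) * (E n 0 x * derive1n m psi x) +
      \sum_(l < block_end d_oo m.+1) (if d l == m then c l else 0) *
         (E n l.+1 x * derive1n m psi x).
    apply/funext => x; rewrite P_sum mulrDl mulr_suml -mulrA; congr (_ + _).
    by apply: eq_bigr => l _; rewrite -mulrA.
  rewrite itgD; [|exact: contZ|by apply: continuous_sum => l; apply: contZ].
  rewrite itgZ // itg_sum; last by move=> l; apply: contZ.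
  congr (_ + _).
    by case: eqP => [->|_]; [rewrite E_itg //; apply: (c_dpsi 0%N)|rewrite mul0r].
  rewrite [RHS]big_mkcond /=; apply: eq_bigr => l _; rewrite itgZ //.
  case: eqP => [e|_]; last by rewrite mul0r.
  have dd : (d l)./2.*2 = d l by rewrite /d doubleK.
  by rewrite /v (u_term n l (d l)./2 sp supp_p) dd /c e.
(* Summing the orders up to [N] gives the value of [u n] at a cut-off partial Fourier sum, whose
   limit is known. *)
have S N : \sum_(m < N.+1) itg (-1) 1 (fun x => P n m x * derive1n m psi x) =
    u n (fun x => th x * fsum psi (block_end d_oo N.+1) x).
  under eq_bigr do rewrite Pitg.
  rewrite big_split /= (block_sum d_le) u_fsum; congr (_ + _).
  by rewrite big_ord_recl /= big1 ?addr0.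
move=> e e0; have [L uL] := u_fsum_tends n tp e0.
have [N0 N0L] := block_end_oo d_le d_oo L.+1.
exists N0.+1 => [[//|N]] N0N; rewrite S.
have := N0L N.+1 (ltnW N0N); case: (block_end d_oo N.+1) => // k; apply: uL.
Qed.

End LocalStructure.

(** * Multiplication of the densities by a fixed function *)

Section Localization.
Context {R : realType}.
Variables (M : nat -> R) (star : ultra_case).
Hypotheses (M_gt0 : forall p, 0 < M p) (M1 : cond_M1 M) (M2' : cond_M2' M)
  (M3' : cond_M3' M).
Implicit Types (l h C B x : R) (n m i N k : nat).
Local Notation test := (test_function M star).

Let Mge p : 0 <= M p. Proof. exact: M_ge0. Qed.

(** In the Roumieu case [h] is imposed by the function and [l'] is lowered until the product is
    small; the bound with the smaller parameter is the stronger one. In the Beurling case [l' = l]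
    and [h] is adapted. *)
Lemma qu_small (c : R) (S T : R -> Prop) : 0 < c -> qu star S -> coqu star T ->
  qu star (fun l => exists l' h, [/\ 0 < l', l' <= l, 0 < h, l' * h <= c & S l' /\ T h]).
Proof.
rewrite /qu /coqu => c0; case: star => [[l l0 Sl] Ta|Sa [h h0 Th] l l0].
  exists l => //; exists l, (c / l); split; rewrite ?divr_gt0 //.
    by rewrite mulrCA divff ?mulr1 // gt_eqF.
  by split=> //; apply: Ta; rewrite divr_gt0.
exists (Num.min l (c / h)), h.
have m0 : 0 < Num.min l (c / h) by rewrite lt_min l0 divr_gt0.
split=> //; first by rewrite ge_min lexx.
  by rewrite -ler_pdivlMr // ge_min lexx orbT.
by split=> //; apply: Sa.
Qed.

Lemma geometric_tail (r : R) N k : 0 <= r -> r <= 2^-1 ->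
  \sum_(m < k) r ^+ (N + m) <= 2 * r ^+ N.
Proof.
move=> r0 r2; suff : \sum_(m < k) r ^+ m <= 2.
  move=> h; under eq_bigr do rewrite exprD.
  by rewrite -mulr_sumr mulrC ler_wpM2r // exprn_ge0.
have : (1 - r) * \sum_(m < k) r ^+ m <= 1.
  rewrite mulrC -opprB mulrN mulrC -subrX1 opprB lerBlDr lerDl exprn_ge0 //.
have : 0 <= \sum_(m < k) r ^+ m by apply: sumr_ge0 => m _; rewrite exprn_ge0.
move: (\sum_(m < k) _) => s s0 h.
by nra.
Qed.

Lemma mulrn_geometric_le N : 4^-1 ^+ N *+ N <= 2^-1 ^+ N :> R.
Proof.
have -> : 4^-1 = 2^-1 * 2^-1 :> R by field.
rewrite exprMn -[_ *+ N]mulr_natr -mulrA ler_piMr ?exprn_ge0 // exprVn.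
rewrite ler_pdivrMl ?exprn_gt0 // mulr1 -natrX ler_nat.
exact/ltnW/ltn_expl.
Qed.

Variable P : nat -> nat -> R -> R.
Hypotheses (P_cont : forall n m, continuous (P n m))
  (P_bound : qu star (fun l => exists C, forall n m x, `|P n m x| <= C * l ^+ m / M m)).
Variable chi : R -> R.
Hypothesis chi_udiff : udiff M star chi.

(** What the orders [m < N] contribute to order [i] when [chi] is moved from the test function to
    the densities. The localized density of order [i] is the limit for [N -> oo]. *)
Definition leibniz_coef N n i (x : R) : R :=
  \sum_(m < N) 'C(m, i)%:R * (P n m x * derive1n (m - i) chi x).

(** From [C(m, i) <= 2^m] and [M i M (m - i) <= M 0 M m]. The factor [(2 l h)^m] turns the Leibniz
    series into a geometric one once [l h] is small. *)
Lemma leibniz_term_bound l h C B n m i x : 0 < l -> 0 < h -> 0 <= C ->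
  (forall n m x, `|P n m x| <= C * l ^+ m / M m) -> dbnd M chi h B ->
  `|'C(m, i)%:R * (P n m x * derive1n (m - i) chi x)| <=
  C * B * M 0%N * (2 * l * h) ^+ m * (h ^+ i * M i)^-1.
Proof.
move=> l0 h0 C0 PC cB; have B0 := dbnd_ge0 M_gt0 cB.
have hn k : 0 < h ^+ k by rewrite exprn_gt0.
have rhs0 : 0 <= C * B * M 0%N * (2 * l * h) ^+ m * (h ^+ i * M i)^-1.
  by rewrite !mulr_ge0 ?invr_ge0 ?mulr_ge0 ?exprn_ge0 ?mulr_ge0 ?(ltW l0) ?(ltW h0).
case: (leqP i m) => im; last by rewrite bin_small // mul0r normr0.
rewrite !normrM normr_nat.
have bin2 : 'C(m, i)%:R <= 2 ^+ m :> R.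
  rewrite -natrX ler_nat -[X in (_ <= X ^ m)%N]/(1 + 1)%N expnDn.
  have im' : (i < m.+1)%N by [].
  rewrite (bigD1 (Ordinal im')) //= !exp1n !muln1; exact: leq_addr.
apply: le_trans (_ : 2 ^+ m * ((C * l ^+ m / M m) * (B * h ^+ (m - i) * M (m - i)%N)) <= _).
  apply: ler_pM => //; by apply: ler_pM.
have hmi : h ^+ m = h ^+ i * h ^+ (m - i) by rewrite -exprD subnKC.
have Mm : M (m - i)%N / M m <= M 0%N / M i.
  rewrite ler_pdivrMr // mulrAC ler_pdivlMr //.
  by have := M_supermul M_gt0 M1 (m - i) i; rewrite subnK.
rewrite [leLHS](_ : _ = C * B * (2 * l * h) ^+ m / h ^+ i * (M (m - i)%N / M m)); last first.
  by rewrite !exprMn hmi; field; rewrite !gt_eqF.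
rewrite [leRHS](_ : _ = C * B * (2 * l * h) ^+ m / h ^+ i * (M 0%N / M i)); last first.
  by field; rewrite !gt_eqF.
by rewrite ler_wpM2l // !mulr_ge0 ?invr_ge0 ?exprn_ge0 ?mulr_ge0 ?(ltW l0) ?(ltW h0).
Qed.

Lemma leibniz_coef_tail l h C B n i x N k : 0 < l -> 0 < h -> 0 <= C -> l * h <= 8^-1 ->
  (forall n m x, `|P n m x| <= C * l ^+ m / M m) -> dbnd M chi h B ->
  `|leibniz_coef (N + k) n i x - leibniz_coef N n i x| <=
  2 * (C * B * M 0%N) * (2 * l * h) ^+ N * (h ^+ i * M i)^-1.
Proof.
move=> l0 h0 C0 lh PC cB; have B0 := dbnd_ge0 M_gt0 cB.
rewrite /leibniz_coef big_split_ord /= [X in `|X|]addrC addKr.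
apply: le_trans (ler_norm_sum _ _ _) _.
apply: le_trans (_ : \sum_(m < k) C * B * M 0%N * (2 * l * h) ^+ (N + m) * (h ^+ i * M i)^-1 <= _).
  by apply: ler_sum => m _; apply: leibniz_term_bound.
rewrite -mulr_suml -mulr_sumr.
rewrite ler_wpM2r ?invr_ge0 ?mulr_ge0 ?exprn_ge0 ?(ltW h0) //.
rewrite [leRHS](_ : _ = C * B * M 0%N * (2 * (2 * l * h) ^+ N)); last by ring.
rewrite ler_wpM2l ?mulr_ge0 //; apply: geometric_tail; last by lra.
by rewrite !mulr_ge0 // ltW.
Qed.

(** The terms with [m < i] vanish, so the geometric tail starts at [m = i], where [(2 l h)^i]
    cancels [h^i] and leaves [(2 l)^i]. *)
Lemma leibniz_coef_bound l h C B n i x N : 0 < l -> 0 < h -> 0 <= C -> l * h <= 8^-1 ->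
  (forall n m x, `|P n m x| <= C * l ^+ m / M m) -> dbnd M chi h B ->
  `|leibniz_coef N n i x| <= 2 * (C * B * M 0%N) * (2 * l) ^+ i / M i.
Proof.
move=> l0 h0 C0 lh PC cB; have B0 := dbnd_ge0 M_gt0 cB.
have low N' : (N' <= i)%N -> leibniz_coef N' n i x = 0.
  by move=> Ni; apply: big1 => -[m mN] _ /=; rewrite bin_small ?mul0r // (leq_trans mN).
case: (leqP N i) => [/low ->|/ltnW/subnKC <-].
  by rewrite normr0 !mulr_ge0 ?invr_ge0 ?exprn_ge0 ?mulr_ge0 ?(ltW l0) ?(ltW h0).
have := @leibniz_coef_tail l h C B n i x i (N - i) l0 h0 C0 lh PC cB.
rewrite (low i) // subr0 => /le_trans; apply.
rewrite le_eqVlt; apply/orP; left; apply/eqP; rewrite !exprMn; field.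
by rewrite !gt_eqF // exprn_gt0.
Qed.

Lemma leibniz_sum n N phi : smooth phi ->
  \sum_(m < N) itg (-1) 1 (fun x => P n m x * derive1n m (fun x => chi x * phi x) x) =
  \sum_(i < N) itg (-1) 1 (fun x => leibniz_coef N n i x * derive1n i phi x).
Proof.
move=> sp; have [sc _] := chi_udiff.
have cc m : continuous (derive1n m chi) by apply: smooth_continuous.
have cp m : continuous (derive1n m phi) by apply: smooth_continuous.
pose t m i x := 'C(m, i)%:R * (P n m x * derive1n (m - i) chi x) * derive1n i phi x.
have ct m i : continuous (t m i).
  by apply: contM (cp i); apply/contZ/contM.
have L m : (m < N)%N -> (fun x => P n m x * derive1n m (fun x => chi x * phi x) x) =
    fun x => \sum_(i < N) t m i x.
  move=> mN; apply/funext => x.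
  have -> : (fun x => chi x * phi x) = fun x => phi x * chi x.
    by apply/funext => y; rewrite mulrC.
  rewrite derive1n_mul // mulr_sumr.
  rewrite -(subnKC mN) big_split_ord /= [X in _ = _ + X]big1 ?addr0 => [|i _].
    by apply: eq_bigr => i _; rewrite /t; ring.
  by rewrite /t bin_small ?mul0r // addSn ltnS leq_addr.
under eq_bigr => m _ do rewrite L // itg_sum //.
rewrite exchange_big /=; apply: eq_bigr => i _.
rewrite -itg_sum //; congr itg; apply/funext => x.
by rewrite /leibniz_coef mulr_suml.
Qed.

(** Against a test function, the limit densities differ from the Leibniz sums cut at [N] by a
    multiple of [4^-N] in each of the [N] orders below [N]. As [N 4^-N] tends to [0], both sums have
    the same limit. *)
Lemma localization : exists Q : nat -> nat -> R -> R,
  [/\ forall n i, continuous (Q n i),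
      forall n i x, (forall j, derive1n j chi x = 0) -> Q n i x = 0,
      qu star (fun l => exists C, forall n i x, `|Q n i x| <= C * l ^+ i / M i) &
      forall n phi L, udiff M star phi -> tends (fun N => \sum_(m < N)
          itg (-1) 1 (fun x => P n m x * derive1n m (fun x => chi x * phi x) x)) L ->
        tends (fun N => \sum_(i < N) itg (-1) 1 (fun x => Q n i x * derive1n i phi x)) L].
Proof.
have [sc uc] := chi_udiff.
have e8 : 0 < 8^-1 :> R by rewrite invr_gt0.
have PB := qu_small e8 P_bound uc.
have Cnorm l C : (forall n m x, `|P n m x| <= C * l ^+ m / M m) -> 0 < l ->
    0 <= C.
  move=> PC l0; have := le_trans (normr_ge0 _) (PC 0%N 0%N 0).
  by rewrite expr0 mulr1 pmulr_lge0 // invr_gt0.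
(* One pair of parameters with [l h <= 1/8] suffices to define the densities. Their growth is
   estimated later from the same limits, with the parameters that [qu] demands. *)
have [_ _ [l [h [l0 _ h0 lh [[C PC] [B cB]]]]]] := qu_exists PB.
have C0 := Cnorm l C PC l0.
have B0 := dbnd_ge0 M_gt0 cB.
have lh0 : 0 <= 2 * l * h by rewrite !mulr_ge0 // ltW.
have lh2 : 2 * l * h <= 2^-1 by lra.
pose K i := 2 * (C * B * M 0%N) * (h ^+ i * M i)^-1.
have K0 i : 0 <= K i by rewrite !mulr_ge0 ?invr_ge0 ?mulr_ge0 ?exprn_ge0 ?(ltW l0) ?(ltW h0).
have tail n i x N k : `|leibniz_coef (N + k) n i x - leibniz_coef N n i x| <= K i * 2^-1 ^+ N.
  apply: le_trans (leibniz_coef_tail _ _ _ _ _ l0 h0 C0 lh PC cB) _.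
  rewrite mulrAC ler_wpM2l //; first exact: K0.
  by apply: lerXn2r; rewrite ?nnegrE.
have tK i : tends (fun N => K i * 2^-1 ^+ N) 0.
  by rewrite -[X in tends _ X](mulr0 (K i)); apply/tendsZ/tends_half.
have cQ n i x : exists q, tends (fun N => leibniz_coef N n i x) q.
  apply: tends_cauchy => e e0; have [N KN] := tK i e e0; exists N => a b Na /subnKC <-.
  apply: le_trans (tail _ _ _ _ _) _; have := KN a Na.
  by rewrite subr0; apply: le_trans; apply: ler_norm.
pose Q n i x := sval (cid (cQ n i x)).
have QP n i x : tends (fun N => leibniz_coef N n i x) (Q n i x) by apply: (svalP (cid _)).
have c_coef N n i : continuous (leibniz_coef N n i).
  apply: continuous_sum => m; apply/contZ/contM => //.
  exact: smooth_continuous.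
have Qtail n i x N : `|Q n i x - leibniz_coef N n i x| <= K i * 2^-1 ^+ N.
  by apply: (tends_dist (j := N) (QP n i x)) => m /subnKC <-; apply: tail.
have Qcont n i : continuous (Q n i).
  move=> x; apply/cvgrPdist_le => e e0.
  have e3 : 0 < e / 3 by rewrite divr_gt0.
  have [N /(_ N (leqnn N))] := tK i _ e3; rewrite subr0 => /(le_trans (ler_norm _)) KN.
  have /cvgrPdist_le/(_ _ e3) := c_coef N n i x; apply: filterS => y hy.
  have a1 := Qtail n i x N; have a2 := Qtail n i y N; rewrite distrC in a2.
  rewrite (_ : _ - _ = (Q n i x - leibniz_coef N n i x) +
    (leibniz_coef N n i x - leibniz_coef N n i y) + (leibniz_coef N n i y - Q n i y)); last by ring.
  apply: le_trans (ler_normD _ _) _; apply: le_trans (lerD (ler_normD _ _) (lexx _)) _.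
  lra.
exists Q; split=> //.
- move=> n i x c0; apply: (tends_unique (QP n i x)).
  rewrite (_ : (fun N => _) = fun=> 0); first exact: tends_cst.
  by apply/funext => N; apply: big1 => m _; rewrite c0 !mulr0.
- apply: (qu_scale (ltr0n R 2)) PB => l1 l10 [l' [h' [l'0 l'l h'0 lh' [[C' PC'] [B' cB']]]]].
  have C'0 := Cnorm l' C' PC' l'0; have B'0 := dbnd_ge0 M_gt0 cB'.
  exists (2 * (C' * B' * M 0%N)) => n i x; rewrite -[X in `|X|]subr0.
  apply: (tends_dist (j := 0%N) (QP n i x)) => N _; rewrite subr0.
  apply: le_trans (leibniz_coef_bound _ _ _ _ l'0 h'0 C'0 lh' PC' cB') _.
  rewrite ler_wpM2r ?invr_ge0 // ler_wpM2l ?mulr_ge0 //.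
  by apply: lerXn2r; rewrite ?nnegrE ?mulr_ge0 ?ler_wpM2l // ltW.
move=> n phi L [sp up] tL.
have ucp := coqu_and (dbnd_up M_gt0 (f := chi)) (dbnd_up M_gt0 (f := phi)) uc up.
have [_ _ [l' [h' [l'0 _ h'0 lh' [[C' PC'] [[B' cB'] [D pD]]]]]]] := qu_exists (qu_small e8 P_bound ucp).
have C'0 := Cnorm l' C' PC' l'0; have B'0 := dbnd_ge0 M_gt0 cB'.
have D0 := dbnd_ge0 M_gt0 pD.
pose S N := \sum_(m < N) itg (-1) 1 (fun x => P n m x * derive1n m (fun x => chi x * phi x) x).
pose U N := \sum_(i < N) itg (-1) 1 (fun x => Q n i x * derive1n i phi x).
have SU N : `|U N - S N| <= 4 * (C' * B' * M 0%N) * D * (2^-1) ^+ N.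
  rewrite /S leibniz_sum // /U -sumrB; apply: le_trans (ler_norm_sum _ _ _) _.
  apply: le_trans (_ : \sum_(i < N) 4 * (C' * B' * M 0%N) * D * (4^-1) ^+ N <= _).
    apply: ler_sum => i _.
    have cD : continuous (derive1n i phi) by apply: smooth_continuous.
    rewrite -itgB; [|exact: contM|exact: contM].
    apply: le_trans (itg_bound (B := 2 * (C' * B' * M 0%N) * D * 4^-1 ^+ N) _ _ _) _.
    - by apply: contB; apply: contM.
    - lra.
    - move=> x _; rewrite -mulrBl normrM.
      apply: le_trans (_ : (2 * (C' * B' * M 0%N) * (2 * l' * h') ^+ N * (h' ^+ i * M i)^-1) *
         (D * h' ^+ i * M i) <= _).
        apply: ler_pM => //.
        apply: (tends_dist (j := N) (QP n i x)) => m /subnKC <-.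
        exact: leibniz_coef_tail.
      rewrite [leLHS](_ : _ = 2 * (C' * B' * M 0%N) * D * (2 * l' * h') ^+ N); last first.
        by field; rewrite !gt_eqF // exprn_gt0.
      rewrite ler_wpM2l ?mulr_ge0 //; apply: lerXn2r; rewrite ?nnegrE ?mulr_ge0 ?(ltW l'0) ?(ltW h'0) //.
      lra.
    - rewrite le_eqVlt; apply/orP; left; apply/eqP; ring.
  rewrite -mulr_sumr; apply: ler_wpM2l; first by rewrite !mulr_ge0.
  by rewrite sumr_const card_ord; apply: mulrn_geometric_le.
have tU : tends (fun N => U N - S N) 0.
  apply: (tends_squeeze (v := fun N => 4 * (C' * B' * M 0%N) * D * (2^-1) ^+ N)).
    by rewrite -[X in tends _ X](mulr0 (4 * (C' * B' * M 0%N) * D)); apply/tendsZ/tends_half.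
  by move=> N; rewrite subr0.
have := tendsD tU tL; rewrite add0r; congr tends.
by apply/funext => N; rewrite -/(S N) subrK.
Qed.

End Localization.

(** * Dyadic decomposition *)

Section DyadicAssembly.
Context {R : realType}.
Variables (M : nat -> R) (star : ultra_case).
Hypotheses (M_gt0 : forall p, 0 < M p) (M1 : cond_M1 M) (M2' : cond_M2' M)
  (M3' : cond_M3' M).
Implicit Types (f g phi : R -> R) (l h B C x r : R) (n m i N k : nat).
Local Notation test := (test_function M star).

Let Mge p : 0 <= M p. Proof. exact: M_ge0. Qed.

(* The real or imaginary part of an ultradistribution on real test functions. *)
Definition real_functional (v : (R -> R) -> R) :=
  [/\ forall r f g, test r f -> test r g -> v (fun x => f x + g x) = v f + v g,
      forall r c f, test r f -> v (fun x => c * f x) = c * v f &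
      forall r, 0 < r -> qu star (fun h => exists C, forall f B,
        test r f -> dbnd M f h B -> `|v f| <= C * B)].

Variable v : (R -> R) -> R.
Hypothesis v_fun : real_functional v.
Variable rho : nat -> R.
Hypothesis rho_gt0 : forall n, 0 < rho n.
Hypothesis v_dyadic : forall r phi, test r phi -> exists C, forall n,
  `|v (fun x => phi (x / 2 ^+ n))| <= C * (2 ^+ n * rho n).

Definition rescaled n f := v (fun x => f (x / 2 ^+ n)) / (2 ^+ n * rho n).

Lemma two_gt0 n : 0 < 2 ^+ n :> R.
Proof. exact: exprn_gt0. Qed.

Lemma test_rescale r n f : test r f -> test (r * 2 ^+ n) (fun x => f (x / 2 ^+ n)).
Proof.
move=> tf; have p0 : 0 < (2 ^+ n)^-1 :> R by rewrite invr_gt0 two_gt0.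
have := test_dilate p0 tf; rewrite invrK.
by congr test_function; apply/funext => x; rewrite mulrC.
Qed.

Lemma dbnd_rescale n f h B : 0 < h -> smooth f -> dbnd M f h B ->
  dbnd M (fun x => f (x / 2 ^+ n)) h B.
Proof.
move=> h0 sf fB; have p0 : 0 < (2 ^+ n)^-1 :> R by rewrite invr_gt0 two_gt0.
have := dbnd_dilate ((2 ^+ n)^-1) sf fB; rewrite gtr0_norm // => d.
have -> : (fun x => f (x / 2 ^+ n)) = (fun x => f ((2 ^+ n)^-1 * x)).
  by apply/funext => x; rewrite mulrC.
apply: dbnd_le d => //; first by rewrite mulr_gt0.
by rewrite ler_piMl ?(ltW h0) // invf_le1 ?two_gt0 // exprn_ege1 // ler1n.
Qed.

Lemma rescaledD r n f g : test r f -> test r g ->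
  rescaled n (fun x => f x + g x) = rescaled n f + rescaled n g.
Proof.
move=> tf tg; have [vD _ _] := v_fun.
by rewrite /rescaled -mulrDl -(vD _ _ _ (test_rescale n tf) (test_rescale n tg)).
Qed.

Lemma rescaledZ r n c f : test r f -> rescaled n (fun x => c * f x) = c * rescaled n f.
Proof.
move=> tf; have [_ vZ _] := v_fun.
by rewrite /rescaled (vZ _ c _ (test_rescale n tf)) mulrA.
Qed.

Let rn n : 0 < 2 ^+ n * rho n. Proof. by rewrite mulr_gt0 ?two_gt0. Qed.

Lemma rescaled_bounded r f : test r f -> exists C, forall n, `|rescaled n f| <= C.
Proof.
move=> tf; have [C vC] := v_dyadic tf; exists C => n.
by rewrite /rescaled normrM normfV (gtr0_norm (rn n)) ler_pdivrMr.
Qed.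

Lemma rescaled_continuous n h : 0 < h ->
  (exists C, forall f B, test (2 ^+ n) f -> dbnd M f h B -> `|v f| <= C * B) ->
  exists C, forall f B, test 1 f -> dbnd M f h B -> `|rescaled n f| <= C * B.
Proof.
move=> h0 [C vC]; exists (C / (2 ^+ n * rho n)) => f B tf fB.
have [[sf _] _] := tf.
rewrite /rescaled normrM normfV (gtr0_norm (rn n)) mulrAC ler_wpM2r ?invr_ge0 ?(ltW (rn n)) //.
by apply: vC; [have := test_rescale n tf; rewrite mul1r|apply: dbnd_rescale].
Qed.

(** The gliding hump runs on the whole Frechet space in the Beurling case, with parameters
    [1 / (i + 1)], and on each Banach step separately in the Roumieu case. *)
Lemma rescaled_uniform : qu star (fun h => exists C, forall n f B,
  test 1 f -> dbnd M f h B -> `|rescaled n f| <= C * B).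
Proof.
have [vD vZ v_bound] := v_fun.
have rl n f g : test 1 f -> test 1 g -> _ := @rescaledD 1 n f g.
have rz n c f : test 1 f -> _ := @rescaledZ 1 n c f.
have rb f : test 1 f -> _ := @rescaled_bounded 1 f.
have vb n := v_bound _ (two_gt0 n).
have vh n h : 0 < h -> _ := @rescaled_continuous n h.
move: rl rz rb vb vh; rewrite /qu /test_function /udiff /coqu.
case: star => rl rz rb vb vh.
  pose hs i : R := i.+1%:R^-1.
  have hs0 i : 0 < hs i by rewrite invr_gt0.
  have hs_le i j : (i <= j)%N -> hs j <= hs i.
    by move=> ij; rewrite lef_pV2 ?posrE // ler_nat.
  have hs_small h : 0 < h -> exists i, hs i <= h.
    move=> h0; exists (Num.truncn h^-1).
    rewrite -[leRHS]invrK lef_pV2 ?posrE ?invr_gt0 //.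
    exact/ltW/truncnS_gt.
  have domE f : step_dom M 1 hs f ->
      (smooth f /\ (forall h, 0 < h -> exists C, dbnd M f h C)) /\ supp 1 f.
    move=> [sf s1 b]; split=> //; split=> // h h0; have [i hi] := hs_small h h0.
    by have [C fC] := b i; exists C; apply: dbnd_le fC => //; apply: ltW.
  have [||||i [C UB]] := @uniform_boundedness R M M_gt0 1 hs hs0 hs_le rescaled.
  - by move=> n f g /domE + /domE; apply: rl.
  - by move=> n c f /domE; apply: rz.
  - move=> n; have [h h0 vC] := vb n; have [i hi] := hs_small h h0; exists i.
    have [C rC] := vh n h h0 vC; exists C => f B /domE tf fB; apply: rC => //.
    by apply: dbnd_le fB => //; apply: ltW.
  - by move=> f /domE; apply: rb.
  exists (hs i) => //; exists C => n f B [[sf fb] f1]; apply: UB; split=> // j.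
  exact: fb.
move=> h h0.
have domE f : step_dom M 1 (fun=> h) f ->
    (smooth f /\ (exists2 h, 0 < h & exists C, dbnd M f h C)) /\ supp 1 f.
  by move=> [sf s1 b]; split=> //; split=> //; exists h => //; apply: (b 0%N).
have [||||i [C UB]] := @uniform_boundedness R M M_gt0 1 (fun=> h) (fun=> h0) (fun _ _ _ => lexx h) rescaled.
- by move=> n f g /domE + /domE; apply: rl.
- by move=> n c f /domE; apply: rz.
- move=> n; exists 0%N; have [C rC] := vh n h h0 (vb n h h0); exists C => f B /domE tf; exact: rC.
- by move=> f /domE; apply: rb.
exists C => n f B [[sf fb] f1] fB; apply: UB => //; split=> // _; by exists B.
Qed.

Lemma itg_supp (f : R -> R) r r' : continuous f -> 0 <= r -> r <= r' -> supp r f ->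
  itg (- r') r' f = itg (- r) r f.
Proof.
move=> cf r0 rr' sf; rewrite -!RintegralT_itg //; first exact: le_trans rr'.
by move=> x r'x; apply: sf; apply: le_lt_trans r'x.
Qed.

Lemma qu_and P Q : (forall h h', 0 < h -> h <= h' -> P h -> P h') ->
  (forall h h', 0 < h -> h <= h' -> Q h -> Q h') ->
  qu star P -> qu star Q -> qu star (fun h => P h /\ Q h).
Proof.
rewrite /qu => Pm Qm; case: star => [[h h0 Ph] [k k0 Qk]|Pa Qa h h0]; last by split; [exact: Pa|exact: Qa].
exists (Num.max h k); first by rewrite lt_max h0.
by split; [apply: Pm h0 _ Ph; rewrite le_max lexx|apply: Qm k0 _ Qk; rewrite le_max lexx orbT].
Qed.

Lemma derive1n_near0 (f : R -> R) a j x : smooth f -> (forall y, `|y| < a -> f y = 0) ->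
  `|x| < a -> derive1n j f x = 0.
Proof.
elim: j f => [|j IH] f sf fa xa; first exact: fa.
rewrite derive1nSr; apply: IH => //; first exact: smooth_derive1n.
move=> y ya; apply: (is_derive_unique (smooth_tower sf 0%N y)).
apply: is_deriveP_dist => e e0; exists (a - `|y|); first by rewrite subr_gt0.
move=> h hl; rewrite /= !fa ?mulr0 ?subrr ?normr0 ?mulr_ge0 ?(ltW e0) //.
by apply: le_lt_trans (ler_normD _ _) _; rewrite addrC -ltrBrDr.
Qed.

Lemma sum_window (F : nat -> R) (n1 K : nat) B : 0 <= B -> (forall n, `|F n| <= B) ->
  (forall n, n != 0%N -> ~~ (n1 <= n < n1 + 3)%N -> F n = 0) ->
  `|\sum_(n < K) F n| <= 4 * B.
Proof.
move=> B0 FB F0; apply: le_trans (ler_norm_sum _ _ _) _.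
have one a : \sum_(n < K) (nat_of_ord n == a)%:R <= 1 :> R.
  elim: K => [|k IH]; first by rewrite big_ord0.
  rewrite big_ord_recr /=; have [ka|_] := eqVneq k a; last by rewrite addr0.
  rewrite big1 ?add0r // => n _; rewrite -ka; have := ltn_ord n.
  by case: eqVneq => // ->; rewrite ltnn.
apply: (@le_trans _ _ (\sum_(n < K) B * ((nat_of_ord n == 0%N)%:R + (nat_of_ord n == n1)%:R +
  (nat_of_ord n == n1.+1)%:R + (nat_of_ord n == n1.+2)%:R))).
  apply: ler_sum => n _; have [n0|n0] := boolP (nat_of_ord n == 0%N).
    apply: le_trans (FB n) _; rewrite ler_peMr // -!addrA lerDl !addr_ge0 //.
  have [win|win] := boolP (n1 <= n < n1 + 3)%N; last first.
    by rewrite (F0 n) // normr0 mulr_ge0 // !addr_ge0.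
  apply: le_trans (FB n) _; rewrite ler_peMr // add0r.
  have : [|| nat_of_ord n == n1, nat_of_ord n == n1.+1 | nat_of_ord n == n1.+2].
    by move: win; clear; lia.
  by case: (_ == n1); case: (_ == n1.+1); case: (_ == n1.+2) => //= _; lra.
rewrite -mulr_sumr mulrC ler_wpM2r // !big_split /=.
apply: le_trans (lerD (lerD (lerD (one _) (one _)) (one _)) (one _)) _.
lra.
Qed.

(** A dyadic partition of unity. All shells but the central one are dilates of a single function,
    which vanishes for [|x| < 1/8] and for [|x| > 1/2] when [th] is a cut-off as above. *)
Definition shell (th : R -> R) n x :=
  if n is 0%N then th (2 * x) else th (2 * x) - th (4 * x).

Lemma sum_shell th N x :
  \sum_(n < N.+1) shell th n (x / 2 ^+ n) = th (2 * (x / 2 ^+ N)).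
Proof.
elim: N => [|N IH]; first by rewrite big_ord1 /shell expr0.
rewrite big_ord_recr IH /= (_ : 4 * (x / 2 ^+ N.+1) = 2 * (x / 2 ^+ N)); last first.
  by rewrite exprS invfM mulrCA; field; rewrite gt_eqF ?two_gt0.
by rewrite addrC subrK.
Qed.

Lemma shell_test th n : test 1 th -> test 2^-1 (shell th n).
Proof.
move=> t1.
have tdil c : 0 < c -> test c^-1 (fun x => th (c * x)).
  by move=> c0; have := test_dilate c0 t1; rewrite mul1r.
case: n => [|n]; first exact: tdil.
have -> : shell th n.+1 = fun x => th (2 * x) + (-1) * th (4 * x).
  by apply/funext => x; rewrite mulN1r.
apply: (testD M_gt0 (tdil 2 _)) => //; apply: testZ.
by apply: test_le (tdil 4 _) => //; rewrite lef_pV2 ?posrE // ler_nat.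
Qed.

(** Uniformity in [n] is preserved because there are only two functions to localize by: the central
    shell and the one common to all [n >= 1]. *)
Lemma shell_pieces th : test 1 th -> (forall x, `|x| <= 2^-1 -> th x = 1) ->
  exists Q : nat -> nat -> R -> R, [/\ forall n i, continuous (Q n i),
    forall n i x, 2^-1 < `|x| -> Q n i x = 0,
    forall n i x, n != 0%N -> `|x| < 8^-1 -> Q n i x = 0,
    qu star (fun l => exists C, forall n i x, `|Q n i x| <= C * l ^+ i / M i) &
    forall n phi, udiff M star phi -> tends (fun K => \sum_(i < K)
      itg (-1) 1 (fun x => Q n i x * derive1n i phi x)) (rescaled n (fun x => shell th n x * phi x))].
Proof.
move=> t1 th1.
have [P [Pc PB PE]] := local_structure M_gt0 M1 M2' M3' (fun n => @rescaledD 1 n)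
  (fun n c => @rescaledZ 1 n c) rescaled_uniform t1 th1.
have sh_test n := shell_test n t1.
have sh_near n x : `|x| < 8^-1 -> shell th n.+1 x = 0.
  by move=> x8; rewrite /shell !th1 ?subrr // normrM gtr0_norm //; lra.
have shS n : shell th n.+1 = shell th 1 by [].
have [Q0 [c0 z0 b0 e0]] := localization M_gt0 M1 Pc PB (sh_test 0%N).1.
have [Q1 [c1 z1 b1 e1]] := localization M_gt0 M1 Pc PB (sh_test 1%N).1.
have zs n j x : 2^-1 < `|x| -> derive1n j (shell th n) x = 0.
  by have [[sm _] sp] := sh_test n; apply: supp_derive1n.
exists (fun n => if n is 0%N then Q0 n else Q1 n); split.
- by case.
- by move=> [|n] i x x2; [apply: z0|apply: z1] => j; apply: zs.
- move=> [//|n] i x _ x8; apply: z1 => j.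
  by have [[sm _] _] := sh_test 1%N; apply: (derive1n_near0 _ sm) x8 => y; apply: sh_near.
- have mono Q h h' : 0 < h -> h <= h' ->
    (exists C, forall n i x, `|Q n i x| <= C * h ^+ i / M i) ->
    exists C, forall n i x, `|Q n i x : R| <= C * h' ^+ i / M i.
    move=> h0 hh [C QC]; exists C => n i x; apply: le_trans (QC n i x) _.
    have C0 : 0 <= C.
      have := le_trans (normr_ge0 _) (QC n 0%N x); rewrite expr0 mulr1.
      by rewrite pmulr_lge0 ?invr_gt0.
    rewrite ler_wpM2r ?invr_ge0 // ler_wpM2l // lerXn2r ?nnegrE ?(ltW h0) //.
    exact: le_trans (ltW h0) hh.
  apply: qu_imp (qu_and (mono Q0) (mono Q1) b0 b1) => l l0 [[C0 h0] [C1 h1]].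
  exists (Num.max C0 C1) => n i x.
  have w C : C <= Num.max C0 C1 -> C * l ^+ i / M i <= Num.max C0 C1 * l ^+ i / M i.
    by move=> CC; rewrite !ler_wpM2r ?invr_ge0 // exprn_ge0 // ltW.
  by case: n => [|n]; [apply: le_trans (h0 _ _ _) (w _ _)|apply: le_trans (h1 _ _ _) (w _ _)];
     rewrite le_max lexx ?orbT.
- move=> n phi up; have tp : test 2^-1 (fun x => shell th n x * phi x) by apply: testM.
  have := PE n _ tp; case: n tp => [|n] tp PL; [exact: (e0 _ _ _ up)|exact: (e1 _ _ _ up)].
Qed.

Lemma real_functional_sum r N (f : nat -> R -> R) : (forall n, test r (f n)) ->
  v (fun x => \sum_(n < N) f n x) = \sum_(n < N) v (f n).
Proof.
have [vD vZ _] := v_fun => tf; elim: N => [|N IH].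
  rewrite big_ord0; transitivity (0 * v (f 0%N)); last by rewrite mul0r.
  rewrite -(vZ _ _ _ (tf 0%N)).
  by congr v; apply/funext => x; rewrite big_ord0 mul0r.
rewrite big_ord_recr -IH /=.
rewrite -(vD _ _ _ (@test_sum _ M star M_gt0 _ (index_enum 'I_N) r (fun n : 'I_N => f n) (fun n : 'I_N => tf n)) (tf N)).
by congr v; apply/funext => x; rewrite big_ord_recr.
Qed.

Lemma ltr_exp2n n : n%:R < 2 ^+ n :> R.
Proof. by rewrite -natrX ltr_nat ltn_expl. Qed.

(** The weight is kept abstract: [rho n] has to be compared with it only at points that shell [n]
    can reach. *)
Lemma dyadic_structure : exists G : nat -> R -> R, [/\ forall i, continuous (G i),
  forall W : R -> R, (forall x, 0 <= W x) -> (exists C, forall n x,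
      (n = 0%N \/ 2 ^+ n <= 8 * `|x|) -> `|x| <= 2 ^+ n -> rho n <= C * W x) ->
    qu star (fun l => exists C, forall i x,
      `|G i x| <= C * (l ^+ i / M i) * (1 + `|x|) ^+ i * W x) &
  forall r phi, 0 <= r -> test r phi -> tends (fun K =>
    \sum_(i < K) itg (- r) r (fun x => G i x * derive1n i phi x)) (v phi)].
Proof.
have [th [t1 th1 _]] := exists_cutoff star M_gt0 M3'.
have [Q [Qc Qfar Qnear QB QE]] := shell_pieces t1 th1.
(* The derivatives of [phi (2^n y)] bring out [(2^n)^i]; the factor [2^n] of the normalization is
   consumed by the change of variables [x = 2^n y]. *)
pose g n i x := rho n * (2 ^+ n) ^+ i * Q n i (x / 2 ^+ n).
have gc n i : continuous (g n i).
  by apply: contZ; apply: (cont_comp (Qc n i)) => x; apply: cvgM; [apply: cvg_id|apply: cvg_cst].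
have nx n x : `|x / 2 ^+ n| = `|x| / 2 ^+ n by rewrite normrM normfV (gtr0_norm (two_gt0 n)).
have gfar n i x : 2 ^+ n < 2 * `|x| -> g n i x = 0.
  move=> nx2; rewrite /g Qfar ?mulr0 // nx ltr_pdivlMr ?two_gt0 //.
  by rewrite mulrC -ltr_pdivlMr ?invr_gt0 // invrK mulrC.
have gnear n i x : n != 0%N -> 8 * `|x| < 2 ^+ n -> g n i x = 0.
  move=> n0 nx8; rewrite /g Qnear ?mulr0 // nx ltr_pdivrMr ?two_gt0 //.
  by rewrite mulrC -ltr_pdivrMr ?invr_gt0 // invrK mulrC.
(* As [n < 2^n], a shell with [n > 8 |x|] does not reach [x]. The range is generous, but locally
   constant bounds for it give continuity. *)
pose G i x := \sum_(n < (Num.truncn (8 * `|x|)).+1) g n i x.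
have x8 x : 0 <= 8 * `|x| by rewrite mulr_ge0.
have GE K i x : 8 * `|x| < K%:R -> G i x = \sum_(n < K) g n i x.
  rewrite -truncn_lt_nat // => Kx; rewrite /G -!(big_mkord xpredT (fun n => g n i x)).
  rewrite [RHS](big_cat_nat (n := (Num.truncn (8 * `|x|)).+1)) //=.
  rewrite [X in _ = _ + X]big_nat_cond [X in _ = _ + X]big1 ?addr0 // => n /andP[/andP[xn _] _].
  apply: gnear; first by case: n xn.
  by apply: lt_trans (ltr_exp2n n); rewrite -truncn_lt_nat.
have Gc i : continuous (G i).
  move=> x; pose K := (Num.truncn (8 * (`|x| + 1))).+1.
  have near y : `|y - x| < 1 -> G i y = \sum_(n < K) g n i y.
    move=> yx; apply: GE; apply: le_lt_trans (truncnS_gt _); rewrite ler_pM2l //.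
    by rewrite -[y](subrK x) addrC (le_trans (ler_normD _ _)) // lerD2l ltW.
  rewrite /continuous_at (near x) ?subrr ?normr0 //.
  have Sc : continuous (fun y => \sum_(n < K) g n i y) by apply: continuous_sum => n; apply: gc.
  apply: cvg_trans (Sc x); apply: near_eq_cvg; apply/nbhs_ballP; exists 1 => //= y xy.
  by rewrite near // distrC.
exists G; split=> //.
- move=> W W0 [D DW].
  have c8 : 0 < 8 :> R by [].
  apply: qu_scale c8 _ QB => l l0 [C QC].
  have C0 : 0 <= C.
    have := le_trans (normr_ge0 _) (QC 0%N 0%N 0); rewrite expr0 mulr1.
    by rewrite pmulr_lge0 ?invr_gt0.
  exists (4 * (`|D| * C)) => i x.
  pose B := `|D| * W x * (8 * (1 + `|x|)) ^+ i * (C * l ^+ i / M i).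
  have B0 : 0 <= B.
    by rewrite !mulr_ge0 ?exprn_ge0 ?mulr_ge0 ?invr_ge0 ?addr_ge0 ?(ltW l0).
  have -> : 4 * (`|D| * C) * ((8 * l) ^+ i / M i) * (1 + `|x|) ^+ i * W x = 4 * B.
    by rewrite /B !exprMn; ring.
  have [n1 n1x n1min] : exists2 n1, 2 * `|x| <= 2 ^+ n1 & forall n, 2 * `|x| <= 2 ^+ n -> (n1 <= n)%N.
    have ex : exists n, 2 * `|x| <= 2 ^+ n.
      exists (Num.truncn (2 * `|x|)).+1; apply/ltW/(lt_trans (truncnS_gt _))/ltr_exp2n.
    by case: (ex_minnP ex) => n1 h1 h2; exists n1.
  (* Only the shell [n = 0] and three consecutive ones meet a given point. *)
  apply: (@sum_window (fun n => g n i x) n1) => // n.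
    have [far|far] := ltP (2 ^+ n) (2 * `|x|); first by rewrite gfar // normr0.
    have [/andP[n0 near]|] := boolP ((n != 0%N) && (8 * `|x| < 2 ^+ n)).
      by rewrite gnear // normr0.
    rewrite negb_and negbK -leNgt => act.
    have xn : `|x| <= 2 ^+ n by apply: le_trans far; have := normr_ge0 x; lra.
    have rD : rho n <= `|D| * W x.
      apply: (@le_trans _ _ (D * W x)); last by rewrite ler_wpM2r // ler_norm.
      by apply: DW => //; case/orP: act => [/eqP|]; [left|right].
    have nx8 : 2 ^+ n <= 8 * (1 + `|x|).
      case/orP: act => [/eqP ->|act]; first by have := normr_ge0 x; rewrite expr0; lra.
      by apply: le_trans act _; rewrite ler_pM2l // lerDr.
    rewrite /g !normrM (gtr0_norm (rho_gt0 n)) normrX (gtr0_norm (two_gt0 n)) /B.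
    rewrite ler_pM ?mulr_ge0 ?exprn_ge0 ?(ltW (rho_gt0 n)) //.
    by rewrite ler_pM ?exprn_ge0 ?(ltW (rho_gt0 n)) // lerXn2r // nnegrE // (le_trans _ nx8).
  move=> n0 win; have [nn|nn] := leqP n1 n; last first.
    by apply: gfar; rewrite ltNge; apply/negP => /n1min; rewrite leqNgt nn.
  have n3 : (n1 + 3 <= n)%N by move: win nn; clear; lia.
  apply: gnear => //; apply: (@lt_le_trans _ _ (2 ^+ (n1 + 3))); last by rewrite ler_eXn2l // ltr1n.
  rewrite exprD; have := two_gt0 n1; have := normr_ge0 x; move: n1x; move: (2 ^+ n1) => z.
  by rewrite !exprS expr0; lra.
- move=> r phi r0 tp; have [up sp] := tp; have [sm _] := up.
  pose N := (Num.truncn (8 * r)).+1.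
  have rN : 8 * r < N%:R by apply: truncnS_gt.
  have c2 n : 2 ^+ n != 0 :> R by rewrite gt_eqF ?two_gt0.
  have up' n : udiff M star (fun x => phi (2 ^+ n * x)) by apply: udiff_dilate.
  pose f n x := shell th n (x / 2 ^+ n) * phi x.
  have vf n : v (f n) = 2 ^+ n * rho n * rescaled n (fun x => shell th n x * phi (2 ^+ n * x)).
    rewrite /rescaled mulrC divfK ?gt_eqF ?rn //; congr v; apply/funext => x.
    by rewrite mulrCA divff ?mulr1.
  have tr n : test r (f n).
    split; last by move=> x rx; rewrite /f sp // mulr0.
    have [us _] := test_rescale n (shell_test n t1).
    exact: (udiffM M_gt0 M1 us up).
  have vE : v phi = \sum_(n < N.+1) v (f n).
    rewrite -(real_functional_sum _ tr); congr v; apply/funext => x; rewrite /f -mulr_suml sum_shell.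
    have [rx|xr] := ltP r `|x|; first by rewrite sp // mulr0.
    rewrite th1 ?mul1r // normrM gtr0_norm // nx.
    rewrite mulrA ler_pdivrMr ?two_gt0 //; have := ltr_exp2n N; have := normr_ge0 x.
    by move: (2 ^+ N) rN xr => z; lra.
  have QL n := tendsZ (2 ^+ n * rho n) (QE n _ (up' n)).
  rewrite vE (eq_bigr _ (fun (n : 'I_N.+1) _ => vf n)).
  have := tends_sum (index_enum 'I_N.+1) (fun n : 'I_N.+1 => QL n).
  congr tends; apply/funext => K; under eq_bigr do rewrite mulr_sumr.
  rewrite exchange_big /=; apply: eq_bigr => i _.
  have cD := smooth_continuous (n:=i) sm.
  have cg n : continuous (fun x => g n i x * derive1n i phi x) by apply: contM.
  transitivity (\sum_(n < N.+1) itg (- r) r (fun x => g n i x * derive1n i phi x)).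
    apply: eq_bigr => n _; rewrite derive1n_dilate //.
    rewrite -[RHS]RintegralT_itg //; last first.
      by move=> x rx; rewrite (supp_derive1n i sm sp) ?mulr0.
    rewrite (@RintegralT_itg _ _ (2 ^+ n)) ?(ltW (two_gt0 n)) //; last first.
      by move=> x nx2; rewrite gfar ?mul0r //; have := normr_ge0 x; lra.
    have sc := itg_scale (2 ^+ n) (-1) 1 (cg n); rewrite mulrN1 mulr1 in sc; apply: etrans sc.
    rewrite -mulrA; congr (_ * _); rewrite -itgZ; last first.
      by apply: contM => //; apply: contZ; apply: continuous_scale.
    congr itg; apply/funext => x; rewrite /g [2 ^+ n * x / _]mulrAC divff // mul1r; ring.
  rewrite -itg_sum //; apply: eq_itg; [exact: continuous_sum|exact: contM|lra|].
  move=> x xr; rewrite -mulr_suml -GE // (@lt_le_trans _ _ N%:R) ?ler_nat //.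
  by apply: le_lt_trans rN; rewrite ler_pM2l // ler_norml.
Qed.

End DyadicAssembly.

(** * Potter weights *)

Section PowerIntegrals.
Context {R : realType}.
Implicit Types (f g : R -> R) (a b c e q x y t K : R).

Definition pw a x := (1 + `|x|) `^ a.

Lemma norm1_gt0 x : 0 < 1 + `|x|.
Proof. by rewrite ltr_pwDl. Qed.

Lemma pw_gt0 a x : 0 < pw a x.
Proof. by rewrite powR_gt0 // norm1_gt0. Qed.

Lemma pwD a b x : pw (a + b) x = pw a x * pw b x.
Proof. by rewrite /pw powRD // (gt_eqF (norm1_gt0 x)) implybT. Qed.

Lemma pwX n x : pw n%:R x = (1 + `|x|) ^+ n.
Proof. by rewrite /pw powR_mulrn // ltW // norm1_gt0. Qed.

Lemma ler_pw a b x : a <= b -> pw a x <= pw b x.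
Proof. by move=> ab; apply: ler_powR ab; rewrite lerDl. Qed.

Lemma continuous_pw a : continuous (pw a).
Proof.
move=> x; have x0 := norm1_gt0 x.
have cp : {for 1 + `|x|, continuous (@powR R ^~ a)}.
  by apply/differentiable_continuous/derivable1_diffP/derivable_powR; rewrite in_itv /= x0.
have cn : continuous (fun y : R => 1 + `|y|).
  by apply: contD; [exact: cont_cst|exact/continuous_norm/cont_id].
exact: (continuous_comp (cn x) cp).
Qed.

Lemma powRDp a b x : 0 < x -> x `^ (a + b) = x `^ a * x `^ b.
Proof. by move=> x0; rewrite powRD // (gt_eqF x0) implybT. Qed.

Lemma powRV x e : 0 < x -> x^-1 `^ e = (x `^ e)^-1.
Proof. by move=> x0; rewrite -powR_inv1 ?(ltW x0) // -powRrM mulN1r powRN. Qed.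

Lemma powR_div x y e : 0 < x -> 0 < y -> (x / y) `^ e = x `^ e * y `^ (- e).
Proof.
by move=> x0 y0; rewrite powRM ?invr_ge0 ?(ltW x0) ?(ltW y0) // powRV // powRN.
Qed.

(** Comparability within a factor [c] passes to powers of either sign; one inequality serves
    [q >= 0], the other [q < 0]. *)
Lemma pow_comp a b c q : 0 < a -> 0 < b -> a <= c * b -> b <= c * a ->
  a `^ q <= c `^ `|q| * b `^ q.
Proof.
move=> a0 b0 ab ba.
have c0 : 0 < c by rewrite -(pmulr_lgt0 _ b0) (lt_le_trans a0).
rewrite -ler_pdivrMr ?powR_gt0 //.
have -> : a `^ q / b `^ q = (a / b) `^ q by rewrite powR_div // powRN.
have [q0|q0] := leP 0 q.
  by rewrite ger0_norm // ge0_ler_powR ?nnegrE ?divr_ge0 ?(ltW a0) ?(ltW b0) ?(ltW c0) // ler_pdivrMr.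
have -> : (a / b) `^ q = (b / a) `^ (- q) by rewrite powRN -powRV ?divr_gt0 // invf_div.
rewrite ltr0_norm //.
by rewrite ge0_ler_powR ?oppr_ge0 ?nnegrE ?divr_ge0 ?(ltW a0) ?(ltW b0) ?(ltW c0) ?(ltW q0) // ler_pdivrMr.
Qed.

Lemma itg_pw a x y : a + 1 != 0 -> 0 <= x -> x <= y ->
  itg x y (pw a) = ((1 + y) `^ (a + 1) - (1 + x) `^ (a + 1)) / (a + 1).
Proof.
move=> a1 x0; rewrite le_eqVlt => /orP[/eqP<-|xy]; first by rewrite /itg !subrr mul0r.
pose D t := (a + 1)^-1 * (1 + t) `^ (a + 1) - prim (pw a) t.
have dD t : -1 < t -> is_derive t (1 : R) D ((1 + t) `^ a - pw a t).
  move=> t1; have t0 : 0 < 1 + t by lra.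
  apply: is_deriveDr; last exact/is_deriveNr/is_derive_prim/continuous_pw.
  have -> : (1 + t) `^ a = (a + 1)^-1 * ((a + 1) * (1 + t) `^ (a + 1 - 1) * 1).
    by rewrite mulr1 mulKf // addrK.
  apply: is_deriveZr; apply: (@is_derive_compr _ (fun z => z `^ (a + 1)) (fun z => 1 + z)).
    exact: is_derive1_powR.
  have := is_deriveDr (is_derive_cstr t 1) (is_derive_idr t); by rewrite add0r.
have [||c cxy] := @MVT _ D (fun t => (1 + t) `^ a - pw a t) x y xy.
- by move=> t; rewrite in_itv /= => /andP[xt _]; apply: dD; lra.
- apply: derivable_within_continuous => t; rewrite in_itv /= => /andP[xt _].
  have t1 : -1 < t by lra.
  by have [] := dD t t1.
move: cxy; rewrite in_itv /= => /andP[xc _].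
rewrite /pw (@ger0_norm _ c) ?subrr ?mul0r; last lra.
move=> /eqP; rewrite /D subr_eq0 => /eqP; rewrite /itg => h.
rewrite mulrC mulrBr; lra.
Qed.

Lemma itg_even f x y : continuous f -> (forall t, f (- t) = f t) -> itg (- y) (- x) f = itg x y f.
Proof.
move=> cf fe; have := itg_reflect 0 x y cf; rewrite !sub0r => <-.
by congr itg; apply/funext => t; rewrite sub0r fe.
Qed.

Lemma pw_even a t : pw a (- t) = pw a t.
Proof. by rewrite /pw normrN. Qed.

End PowerIntegrals.

Section PotterWeights.
Context {R : realType}.
Implicit Types (f g : R -> R) (a b c e q x y t K : R).

(* Potter's bounds, valid on the whole half-line. *)
Definition potter (W : R -> R) := (forall x, 0 <= x -> 0 < W x) /\
  forall e, 0 < e -> exists2 C, 0 < C & forall x y, 0 <= x -> x <= y ->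
    W y <= C * ((1 + y) / (1 + x)) `^ e * W x /\
    W x <= C * ((1 + y) / (1 + x)) `^ e * W y.

Variable W : R -> R.
Hypothesis W_potter : potter W.

Let W0 x : 0 <= x -> 0 < W x. Proof. by have [h _] := W_potter; apply: h. Qed.
Let Wn x : 0 < W `|x|. Proof. exact: W0. Qed.

Lemma potter_comp c : 1 <= c -> exists2 C, 0 < C & forall x y, 0 <= x -> 0 <= y ->
  1 + x <= c * (1 + y) -> 1 + y <= c * (1 + x) -> W x <= C * W y.
Proof.
move=> c1; have [_ /(_ 1 ltr01) [C C0 CW]] := W_potter.
have c0 : 0 < c by apply: lt_le_trans c1.
exists (C * c) => [|x y x0 y0 xy yx]; first exact: mulr_gt0.
have x1 : 0 < 1 + x by lra. have y1 : 0 < 1 + y by lra.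
have [le|/ltW le] := leP x y.
  have [_ h] := CW _ _ x0 le; apply: le_trans h _.
  rewrite ler_wpM2r ?(ltW (W0 _)) // ler_pM2l // powRr1 ?divr_ge0 ?(ltW x1) ?(ltW y1) //.
  by rewrite ler_pdivrMr.
have [h _] := CW _ _ y0 le; apply: le_trans h _.
rewrite ler_wpM2r ?(ltW (W0 _)) // ler_pM2l // powRr1 ?divr_ge0 ?(ltW x1) ?(ltW y1) //.
by rewrite ler_pdivrMr.
Qed.

(** With [e = (b + 1) / 2], Potter's bound replaces the weight by its value at [r] and lowers the
    exponent to [b - e > -1], whose integral is still a power of [1 + r]. *)
Lemma mass_upper b : -1 < b -> exists2 C, 0 < C & forall r f K, 0 <= r -> 0 <= K ->
  continuous f -> (forall x, `|x| <= r -> `|f x| <= K * (pw b x * W `|x|)) ->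
  `|itg (- r) r f| <= C * (K * ((1 + r) `^ (b + 1) * W r)).
Proof.
move=> b1; pose e := (b + 1) / 2; have e0 : 0 < e by rewrite /e; lra.
have [_ /(_ e e0) [C C0 CW]] := W_potter.
exists (C * 2 / e) => [|r f K r0 K0 cf fK]; first by rewrite divr_gt0 // mulr_gt0.
have r1 : 0 < 1 + r by lra.
pose D := K * (C * ((1 + r) `^ e * W r)).
have D0 : 0 <= D by rewrite !mulr_ge0 ?powR_ge0 ?(ltW (W0 _)) ?(ltW C0).
apply: (@le_trans _ _ (itg (- r) r (fun x => D * pw (b - e) x))).
  apply: itg_norm => //; [exact/contZ/continuous_pw|lra|move=> x xr].
  have {}xr : `|x| <= r by rewrite ler_norml.
  apply: le_trans (fK x xr) _; rewrite /D -!mulrA ler_wpM2l //.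
  have [_ h] := CW _ _ (normr_ge0 x) xr.
  apply: (@le_trans _ _ (pw b x * (C * ((1 + r) / (1 + `|x|)) `^ e * W r))).
    by rewrite ler_wpM2l // ltW // pw_gt0.
  by rewrite powR_div ?norm1_gt0 // pwD /pw le_eqVlt; apply/orP; left; apply/eqP; ring.
rewrite itgZ; last exact: continuous_pw.
rewrite (itg_chasles 0) -{1}oppr0 itg_even; [|exact: continuous_pw|by move=> t; rewrite pw_even].
have be : b - e + 1 = e by rewrite /e; lra.
rewrite itg_pw // be ?(gt_eqF e0) // addr0 powR1 /D.
have -> : b + 1 = e + e by rewrite /e; lra.
rewrite powRDp //; have p0 : 0 < (1 + r) `^ e by rewrite powR_gt0.
set p := _ `^ e in p0 *.
have -> : C * 2 / e * (K * (p * p * W r)) = K * (C * (p * W r)) * (p / e + p / e).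
  by field; rewrite gt_eqF.
rewrite ler_wpM2l ?mulr_ge0 ?(ltW C0) ?(ltW p0) ?(ltW (W0 _)) //.
by rewrite lerD // ler_pM2r ?invr_gt0 //; lra.
Qed.

(** Below the critical exponent Potter's bound refers to the lower endpoint: the exponent rises to
    [b + e], which stays below [-1], and the integral is bounded independently of [y]. *)
Lemma mass_tail b : b < -1 -> exists2 C, 0 < C & forall x y f K, 0 <= x -> x <= y -> 0 <= K ->
  continuous f -> (forall t, x <= t <= y -> `|f t| <= K * (pw b t * W t)) ->
  `|itg x y f| <= C * (K * ((1 + x) `^ (b + 1) * W x)).
Proof.
move=> b1; pose e := - (b + 1) / 2; have e0 : 0 < e by rewrite /e; lra.
have [_ /(_ e e0) [C C0 CW]] := W_potter.
exists (C / e) => [|x y f K x0 xy K0 cf fK]; first by rewrite divr_gt0.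
have x1 : 0 < 1 + x by lra.
pose D := K * (C * ((1 + x) `^ (- e) * W x)).
have D0 : 0 <= D by rewrite !mulr_ge0 ?powR_ge0 ?(ltW (W0 _)) ?(ltW C0).
apply: (@le_trans _ _ (itg x y (fun t => D * pw (b + e) t))).
  apply: itg_norm => //; [exact/contZ/continuous_pw|move=> t txy].
  apply: le_trans (fK t txy) _; rewrite /D -!mulrA ler_wpM2l //.
  have /andP[xt _] := txy; have t0 : 0 <= t := le_trans x0 xt.
  have [h _] := CW _ _ x0 xt.
  apply: (@le_trans _ _ (pw b t * (C * ((1 + t) / (1 + x)) `^ e * W x))).
    by rewrite ler_wpM2l // ltW // pw_gt0.
  rewrite powR_div ?pwD; [|lra|lra].
  by rewrite /pw (ger0_norm t0) le_eqVlt; apply/orP; left; apply/eqP; ring.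
rewrite itgZ; last exact: continuous_pw.
have be : b + e + 1 = - e by rewrite /e; lra.
rewrite itg_pw // be ?oppr_eq0 ?(gt_eqF e0) // /D.
have -> : b + 1 = - e + - e by rewrite /e; lra.
rewrite powRDp //; have p0 : 0 < (1 + x) `^ (- e) by rewrite powR_gt0.
set p := (1 + x) `^ (- e) in p0 *.
have q0 : 0 <= (1 + y) `^ (- e) by apply: powR_ge0.
have -> : C / e * (K * (p * p * W x)) = K * (C * (p * W x)) * (p / e).
  by field; rewrite gt_eqF.
rewrite ler_wpM2l ?mulr_ge0 ?(ltW C0) ?(ltW p0) ?(ltW (W0 _)) //.
by rewrite invrN mulrN -mulNr opprB ler_pM2r ?invr_gt0 //; lra.
Qed.

End PotterWeights.

(** * Order of the representation *)

Section SeriesEstimates.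
Context {R : realType}.
Variables (M : nat -> R) (star : ultra_case).
Hypothesis M_gt0 : forall p, 0 < M p.
Implicit Types (f g phi : R -> R) (l h B C x r lam q b : R) (n m i j K : nat).
Local Notation test := (test_function M star).
Variable W : R -> R.
Hypothesis W_potter : potter W.

Let W0 x : 0 <= x -> 0 < W x. Proof. by have [h _] := W_potter; apply: h. Qed.
Let Wn x : 0 < W `|x|. Proof. exact: W0. Qed.

Definition weighted_terms q j (F : nat -> R -> R) := qu star (fun l => exists C,
  forall m x, (j <= m)%N -> `|F m x| <= C * (l ^+ m / M m) * (pw (q + m%:R) x * W `|x|)).

(* The sign [(-1)^m] of the [m]-th distributional derivative is absorbed in [F m]. *)
Definition represents j (F : nat -> R -> R) (v : (R -> R) -> R) := forall r phi, 0 <= r ->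
  test r phi -> tends (fun K =>
    \sum_(j <= m < K) itg (- r) r (fun x => F m x * derive1n m phi x)) (v phi).

(** The exponent is [q + 1] because the factor [1 / lam] of the dilated functional is left out. *)
Definition dilation_bounded q (v : (R -> R) -> R) := forall r phi, test r phi ->
  exists C lam0, forall lam, lam0 <= lam ->
    `|v (fun x => phi (x / lam))| <= C * (lam `^ (q + 1) * W lam).

Lemma derive1n_div n lam phi : smooth phi ->
  derive1n n (fun x => phi (x / lam)) = fun x => (lam ^+ n)^-1 * derive1n n phi (x / lam).
Proof.
move=> sp; have -> : (fun x => phi (x / lam)) = fun x => phi (lam^-1 * x).
  by apply/funext => x; rewrite mulrC.
by rewrite derive1n_dilate //; apply/funext => x; rewrite exprVn [lam^-1 * x]mulrC.
Qed.

Lemma test_div r phi lam : 0 < lam -> test r phi -> test (r * lam) (fun x => phi (x / lam)).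
Proof.
move=> l0 tp; have := test_dilate (_ : 0 < lam^-1) tp; rewrite invr_gt0 invrK => /(_ l0).
by congr test_function; apply/funext => x; rewrite mulrC.
Qed.

Lemma sum_half_le m1 K : \sum_(m1 <= m < K) 2^-1 ^+ m <= 2 :> R.
Proof.
rewrite -[m1]add0n big_addn big_mkord; under eq_bigr do rewrite addnC.
apply: le_trans (geometric_tail _ _ _ _) _ => //.
by rewrite ler_piMr // exprn_ile1 // invf_le1 // ler1n.
Qed.

Lemma weighted_terms_ge0 j q (F : nat -> R -> R) l C : 0 < l -> (forall m x, (j <= m)%N ->
  `|F m x| <= C * (l ^+ m / M m) * (pw (q + m%:R) x * W `|x|)) -> 0 <= C.
Proof.
move=> l0 FC; have := le_trans (normr_ge0 _) (FC j 0 (leqnn j)).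
by rewrite !pmulr_lge0 ?divr_gt0 ?exprn_gt0 // mulr_gt0 // pw_gt0.
Qed.

(** On the support [(1 + |x|) / lam] is at most [1 + r]. With [l h = 1 / (2 (1 + r))] its powers
    beyond order [m1] are compensated, and a factor [2^-m] remains. Enlarging the exponent to
    [b > -1] makes [mass_upper] applicable. *)
Lemma series_estimate q b j m1 (F : nat -> R -> R) r phi : (j <= m1)%N -> q + m1%:R <= b -> -1 < b -> 1 <= r ->
  (forall m, continuous (F m)) -> weighted_terms q j F -> test r phi ->
  exists2 C, 0 < C & forall lam K, 1 <= lam ->
    `|\sum_(m1 <= m < K) itg (- (r * lam)) (r * lam)
        (fun x => F m x * derive1n m (fun y => phi (y / lam)) x)| <=
    C * ((lam ^+ m1)^-1 * (lam `^ (b + 1) * W lam)).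
Proof.
move=> jm qb b1 r1 Fc Fw [[sp up] _].
have r0 : 0 < r by lra.
have r20 : 0 < (2 * (1 + r))^-1 by rewrite invr_gt0; lra.
have [l [h [l0 h0 lh [C FC] [B pB]]]] := qu_coqu_inv r20 Fw up.
have C0 := weighted_terms_ge0 l0 FC; have B0 := dbnd_ge0 M_gt0 pB.
have [C1 C10 mass] := mass_upper W_potter b1.
have [C2 C20 comp] := potter_comp W_potter r1.
pose C3 := (2 * r) `^ `|b + 1| * C2.
have C30 : 0 < C3 by rewrite mulr_gt0 // powR_gt0; lra.
have [A A0 CBA] : exists2 A, 0 < A & C * B <= A.
  by exists (C * B + 1); rewrite ?lerDl // ltr_wpDl // mulr_ge0.
exists (C1 * A * 2 * C3) => [|lam K lam1]; first by do 3![apply: mulr_gt0 => //].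
have lam0 : 0 < lam by lra.
have rl : 0 <= r * lam by rewrite mulr_ge0; lra.
have rle : lam <= r * lam by rewrite ler_peMl //; lra.
have e1 : (1 + r * lam) `^ (b + 1) * W (r * lam) <= C3 * (lam `^ (b + 1) * W lam).
  rewrite mulrACA ler_pM ?powR_ge0 ?(ltW (W0 _)) //.
    apply: pow_comp => //; first by rewrite ltr_pwDl.
      by rewrite -mulrA; lra.
    have : lam <= r * (r * lam) by apply: le_trans rle _; rewrite ler_peMl.
    have -> : 2 * r * (1 + r * lam) = 2 * r + 2 * (r * (r * lam)) by ring.
    by move: (r * (r * lam)) => X hX; lra.
  apply: comp => //; [lra|by rewrite mulrDr mulr1; lra|].
  by apply: (@le_trans _ _ (1 + r * lam)); [lra|rewrite ler_peMl; lra].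
have ln m : 0 < (lam ^+ m)^-1 by rewrite invr_gt0 exprn_gt0.
apply: le_trans (ler_norm_sum _ _ _) _.
pose D := C1 * (A * (lam ^+ m1)^-1 * (C3 * (lam `^ (b + 1) * W lam))).
have D0 : 0 <= D.
  by rewrite !mulr_ge0 ?powR_ge0 ?(ltW C10) ?(ltW C30) ?(ltW (ln _)) ?(ltW (W0 _)) ?(ltW A0) //; lra.
apply: (@le_trans _ _ (\sum_(m1 <= m < K) D * 2^-1 ^+ m)); last first.
  rewrite -mulr_sumr; apply: le_trans (ler_wpM2l D0 (sum_half_le _ _)) _.
  by rewrite /D le_eqVlt; apply/orP; left; apply/eqP; ring.
rewrite big_seq_cond [leRHS]big_seq_cond; apply: ler_sum => m; rewrite mem_index_iota => /andP[/andP[m1m _] _].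
have cF : continuous (fun x => F m x * derive1n m (fun y => phi (y / lam)) x).
  apply: contM => //; apply: smooth_continuous.
  have -> : (fun x => phi (x / lam)) = fun x => phi (lam^-1 * x) by apply/funext => x; rewrite mulrC.
  exact: smooth_dilate.
have Kge : 0 <= A * (lam ^+ m1)^-1 * 2^-1 ^+ m.
  by rewrite !mulr_ge0 ?(ltW (ln _)) ?(ltW A0).
apply: le_trans (mass _ _ _ rl Kge cF _) _; last first.
  rewrite /D -[leRHS]mulrA ler_pM2l // -[leRHS]mulrA [X in _ <= _ * X]mulrC [leRHS]mulrA.
  by rewrite ler_wpM2l.
move=> x xr; rewrite derive1n_div // !normrM (gtr0_norm (ln m)).
have pB' := pB m (x / lam); have FC' := FC m x (leq_trans jm m1m).
apply: (@le_trans _ _ (C * (l ^+ m / M m) * (pw (q + m%:R) x * W `|x|) *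
  ((lam ^+ m)^-1 * (B * h ^+ m * M m)))).
  by apply: ler_pM => //; [rewrite mulr_ge0 // ltW|rewrite ler_pM2l].
have Mm : M m != 0 by rewrite gt_eqF.
have -> : C * (l ^+ m / M m) * (pw (q + m%:R) x * W `|x|) * ((lam ^+ m)^-1 * (B * h ^+ m * M m)) =
    C * B * ((l * h) ^+ m * (pw (q + m%:R) x / lam ^+ m)) * W `|x|.
  by rewrite exprMn; field; rewrite Mm expf_neq0 // gt_eqF.
have -> : A * (lam ^+ m1)^-1 * 2^-1 ^+ m * (pw b x * W `|x|) =
   A * (2^-1 ^+ m * (pw b x / lam ^+ m1)) * W `|x| by ring.
rewrite ler_wpM2r ?(ltW (Wn _)) //.
have lhg : 0 <= l * h by rewrite mulr_ge0 ?(ltW l0) ?(ltW h0).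
have pln a n : 0 <= pw a x / lam ^+ n by rewrite mulr_ge0 ?(ltW (pw_gt0 _ _)) ?(ltW (ln _)).
apply: ler_pM => //; [exact: mulr_ge0|by rewrite mulr_ge0 // exprn_ge0|].
have -> : q + m%:R = (q + m1%:R) + (m - m1)%:R.
  by rewrite natrB //; ring.
have -> : lam ^+ m = lam ^+ m1 * lam ^+ (m - m1) by rewrite -exprD subnKC.
rewrite pwD pwX lh.
have -> : (2 * (1 + r))^-1 ^+ m * (pw (q + m1%:R) x * (1 + `|x|) ^+ (m - m1) / (lam ^+ m1 * lam ^+ (m - m1))) =
  ((2 * (1 + r))^-1 ^+ m * ((1 + `|x|) / lam) ^+ (m - m1)) * (pw (q + m1%:R) x / lam ^+ m1).
  by rewrite expr_div_n; field; rewrite !expf_neq0 ?gt_eqF.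
have x0 : 0 <= (1 + `|x|) / lam by rewrite divr_ge0 ?(ltW (norm1_gt0 x)) ?(ltW lam0).
apply: ler_pM => //; first by rewrite mulr_ge0 ?exprn_ge0 // ltW.
- rewrite invfM exprMn -mulrA; apply: ler_piMr; first by rewrite exprn_ge0.
  rewrite exprVn mulrC ler_pdivrMr ?exprn_gt0 ?mul1r; last lra.
  apply: (@le_trans _ _ ((1 + r) ^+ (m - m1))); last by rewrite ler_eXn2l ?leq_subr //; lra.
  apply: lerXn2r; rewrite ?nnegrE //; first lra.
  by rewrite ler_pdivrMr // mulrDl mul1r; lra.
  by [].
- by apply: ler_wpM2r; [exact: ltW|apply: ler_pw].
Qed.

End SeriesEstimates.

(** * Cut-offs of monomials and symmetric integrals *)

Section Moments.
Context {R : realType}.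
Variables (M : nat -> R) (star : ultra_case).
Hypotheses (M_gt0 : forall p, 0 < M p) (M1 : cond_M1 M) (M3' : cond_M3' M).
Implicit Types (f g phi : R -> R) (l h B C x r lam q b : R) (n m i j K : nat).
Local Notation test := (test_function M star).

Lemma smooth_id : smooth (fun x : R => x).
Proof.
apply: (tower_smooth (F := fun n x => if n is 0%N then x else if n is 1%N then 1 else 0)).
by move=> [|[|n]] x; [exact: is_derive_idr|exact: is_derive_cstr|exact: is_derive_cstr].
Qed.

Lemma derive1n_id n : derive1n n (fun x : R => x) =
  fun x => if n is 0%N then x else if n is 1%N then 1 else 0.
Proof.
apply: (tower_derive1n (F := fun n x => if n is 0%N then x else if n is 1%N then 1 else 0)).
by move=> [|[|m]] x; [exact: is_derive_idr|exact: is_derive_cstr|exact: is_derive_cstr].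
Qed.

Lemma test_mulX r f : 0 <= r -> test r f -> test r (fun x => f x * x).
Proof.
move=> r0 [[sf uf] rf]; split; last by move=> x rx; rewrite rf ?mul0r.
split; first exact: smoothM smooth_id.
have two0 : 0 < 2 :> R by [].
apply: coqu_scale two0 _ uf => h h0 [A fA].
pose B := r / M 0%N + (h * M 1%N)^-1.
have hM : 0 < h * M 1%N by rewrite mulr_gt0.
have B0 : 0 <= B by rewrite addr_ge0 ?divr_ge0 ?invr_ge0 ?(ltW hM) ?(ltW (M_gt0 _)).
exists (A * B * M 0%N); rewrite mulrDl mul1r.
apply: (dbnd_mul_on M_gt0 M1 (S := fun x => `|x| <= r) h0 h0 sf smooth_id fA _ _ B0).
  by move=> m x /negP; rewrite -ltNge; apply: supp_derive1n.
move=> [|[|m]] x xr; rewrite derive1n_id ?normr0 ?normr1.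
- rewrite expr0 mulr1 /B mulrDl divfK ?gt_eqF //; apply: le_trans xr _.
  by rewrite lerDl mulr_ge0 ?invr_ge0 ?(ltW hM) ?(ltW (M_gt0 _)).
- rewrite expr1 -mulrA /B mulrDl mulVf ?(gt_eqF hM) // lerDr.
  by rewrite mulr_ge0 ?divr_ge0 ?(ltW hM) ?(ltW (M_gt0 _)).
- by apply: mulr_ge0; [apply: mulr_ge0 => //; exact/exprn_ge0/ltW|exact: ltW].
Qed.

Lemma derive1n_mulX n f : smooth f ->
  derive1n n.+1 (fun x => f x * x) = fun x => derive1n n.+1 f x * x + n.+1%:R * derive1n n f x.
Proof.
move=> sf; rewrite derive1n_mul //; last exact: smooth_id.
apply/funext => x; rewrite big_ord_recr big_ord_recr /= big1 ?add0r => [|i _].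
  by rewrite subnn subSnn !derive1n_id binn binSn /= !mulr1 mul1r addrC.
by rewrite derive1n_id subSn ?(ltnW (ltn_ord i)) // -(subnSK (ltn_ord i)) mulr0.
Qed.

(* Cut-off of the monomial [x^j / j!]. *)
Lemma exists_monomial j : exists2 psi, test 1 psi &
  forall m x, (j <= m)%N -> `|x| < 2^-1 -> derive1n m psi x = (m == j)%:R.
Proof.
elim: j => [|j [psi tp pj]].
  have [th [t1 th1 _]] := exists_cutoff star M_gt0 M3'; exists th => // m x _ x2.
  case: m => [|m]; first by rewrite /= th1 // ltW.
  have [[st _] _] := t1.
  rewrite derive1nSr; apply: (derive1n_near0 _ (smooth_derive1n 1 st)) x2 => y y2.
  apply: (is_derive_unique (smooth_tower st 0%N y)).
  apply: is_deriveP_dist => e e0; exists (2^-1 - `|y|); first by rewrite subr_gt0.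
  move=> h hl; rewrite /= !th1 ?mulr0 ?subrr ?normr0 ?mulr_ge0 ?(ltW e0) ?(ltW y2) //.
  by apply: le_trans (ler_normD _ _) _; rewrite addrC -lerBrDr ltW.
have [[sp _] _] := tp.
have tx := test_mulX ler01 tp; have [[sx _] _] := tx.
exists (fun x => j.+1%:R^-1 * (psi x * x)); first exact: testZ.
move=> [//|m] x jm x2.
have -> : derive1n m.+1 (fun x => j.+1%:R^-1 * (psi x * x)) x =
    j.+1%:R^-1 * (derive1n m.+1 psi x * x + m.+1%:R * derive1n m psi x).
  by rewrite derive1n_scale // derive1n_mulX.
rewrite (pj m.+1 x (ltnW jm) x2) (pj m x jm x2).
rewrite (gtn_eqF (_ : (j < m.+1)%N)) // mul0r add0r eqSS.
by case: eqVneq => [->|]; rewrite ?mulr1 ?mulr0 ?mulVf // pnatr_eq0.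
Qed.

End Moments.

Section MomentEstimate.
Context {R : realType}.
Variables (M : nat -> R) (star : ultra_case).
Hypotheses (M_gt0 : forall p, 0 < M p) (M1 : cond_M1 M) (M3' : cond_M3' M).
Implicit Types (f g phi : R -> R) (l h B C x r lam q b : R) (n m i j K : nat).
Local Notation test := (test_function M star).
Variable W : R -> R.
Hypothesis W_potter : potter W.
Local Notation weighted_terms := (weighted_terms M star W).
Local Notation represents := (represents M star).
Local Notation dilation_bounded := (dilation_bounded M star W).

Let W0 x : 0 <= x -> 0 < W x. Proof. by have [h _] := W_potter; apply: h. Qed.
Let Wn x : 0 < W `|x|. Proof. exact: W0. Qed.

Lemma weighted_term_single q j (F : nat -> R -> R) m : (j <= m)%N -> weighted_terms q j F ->
  exists2 C, 0 < C & forall x, `|F m x| <= C * (pw (q + m%:R) x * W `|x|).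
Proof.
move=> jm /qu_exists [l l0 [C FC]]; have C0 := weighted_terms_ge0 M_gt0 W_potter l0 FC.
have lm : 0 < l ^+ m / M m by rewrite divr_gt0 // exprn_gt0.
exists ((C + 1) * (l ^+ m / M m)) => [|x]; first by rewrite mulr_gt0 // ltr_wpDl.
apply: le_trans (FC m x jm) _; rewrite ler_wpM2r ?mulr_ge0 ?(ltW (pw_gt0 _ _)) ?(ltW (Wn _)) //.
by rewrite ler_pM2r // lerDl.
Qed.

Lemma itg_split3 (f : R -> R) a b c d : itg a d f = itg a b f + itg b c f + itg c d f.
Proof. by rewrite (itg_chasles b) (itg_chasles c b) addrA. Qed.

(* The [j]-th derivative of a dilated cut-off of [x^j / j!] is the indicator of
   [[-lam, lam]] up to an annulus, and the terms of order [> j] are small. *)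
Lemma moment_estimate q b j (F : nat -> R -> R) v : q + j%:R + 1 <= b -> -1 < b ->
  (forall m, continuous (F m)) -> weighted_terms q j F -> represents j F v ->
  dilation_bounded q v ->
  exists C lam0, forall lam, lam0 <= lam -> `|itg (- lam) lam (F j)| <= C * (lam `^ b * W lam).
Proof.
move=> qb b1 Fc Fw Fv vd.
have [psi tp pj] := exists_monomial star M_gt0 M1 M3' j.
have [[sp up] s1] := tp.
have [C1 [lam1 vC]] := vd _ _ tp.
have qb' : q + j.+1%:R <= b by rewrite -addn1 natrD addrA.
have [C2 C20 sC] := series_estimate M_gt0 W_potter (leqnSn j) qb' b1 (lexx 1) Fc Fw tp.
have [C3 C30 FC] := weighted_term_single (leqnn j) Fw.
have [h h0 [B pB]] : exists2 h, 0 < h & exists B, dbnd M psi h B.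
  by move: up; rewrite /coqu; case: star => // /(_ 1 ltr01) [B pB]; exists 1 => //; exists B.
have B0 := dbnd_ge0 M_gt0 pB.
have c4 : 1 <= 4 :> R by lra.
have [C4 C40 comp] := potter_comp W_potter c4.
pose Bj := B * h ^+ j * M j; have Bj0 : 0 <= Bj by rewrite !mulr_ge0 ?exprn_ge0 ?(ltW h0) ?(ltW (M_gt0 _)).
pose c8 := 8 `^ `|q + j%:R|.
pose D1 := (`|C1| + C2) * (4 `^ `|b| * C4).
pose D2 := C3 * Bj * (c8 * C4).
exists (D1 + D2 * 3 + D2 * 3), (Num.max 1 lam1) => lam; rewrite ge_max => /andP[l1 ll].
have l0 : 0 < lam by lra.
(* Division by [mu] takes [[-lam, lam]] to [[-1/4, 1/4]], well inside the region where [psi] is the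
   exact monomial. *)
pose mu := 4 * lam; have mu1 : 1 <= mu by rewrite /mu; lra.
have mu0 : 0 < mu by rewrite /mu; lra.
pose g x := F j x * derive1n j psi (x / mu).
have cpsi : continuous (fun x => derive1n j psi (x / mu)).
  have -> : (fun x => derive1n j psi (x / mu)) = fun x => derive1n j psi (mu^-1 * x).
    by apply/funext => x; rewrite mulrC.
  exact/continuous_scale/smooth_continuous.
have cg : continuous g by apply: contM.
have ann x : lam <= `|x| -> `|x| <= mu -> `|g x| <= D2 * (lam `^ (b - 1) * W lam).
  move=> xl xm.
  have xmu : 1 + `|x| <= 8 * lam by move: xm; rewrite /mu; lra.
  have xmu' : 1 + `|x| <= 4 * (1 + lam) by move: xm; rewrite /mu; lra.
  rewrite /g normrM; apply: (@le_trans _ _ (C3 * (pw (q + j%:R) x * W `|x|) * Bj)).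
    by apply: ler_pM => //; exact: pB.
  have -> : C3 * (pw (q + j%:R) x * W `|x|) * Bj = C3 * Bj * (pw (q + j%:R) x * W `|x|) by ring.
  have -> : D2 * (lam `^ (b - 1) * W lam) = C3 * Bj * (c8 * lam `^ (b - 1) * (C4 * W lam)).
    by rewrite /D2; ring.
  apply: ler_wpM2l; first by rewrite mulr_ge0 // ltW.
  apply: ler_pM; rewrite ?(ltW (pw_gt0 _ _)) ?(ltW (Wn _)) //.
    apply: le_trans (pow_comp (q + j%:R) (norm1_gt0 x) l0 xmu _) _; first lra.
    by rewrite ler_wpM2l ?powR_ge0 // ler_powR //; lra.
  by apply: comp => //; lra.
have mass : `|itg (- mu) mu g| <= D1 * (lam `^ b * W lam).
  have tm := test_div mu0 tp; rewrite mul1r in tm.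
  have lim := Fv mu _ (ltW mu0) tm.
  have mj : 0 < mu ^+ j by rewrite exprn_gt0.
  have first K : (j < K)%N ->
     \sum_(j <= m < K) itg (- mu) mu (fun x => F m x * derive1n m (fun y => psi (y / mu)) x) =
     (mu ^+ j)^-1 * itg (- mu) mu g +
     \sum_(j.+1 <= m < K) itg (- (1 * mu)) (1 * mu) (fun x => F m x * derive1n m (fun y => psi (y / mu)) x).
    move=> jK; rewrite big_ltn // mul1r; congr (_ + _).
    rewrite -itgZ //; congr itg; apply/funext => x; rewrite derive1n_div // /g; ring.
  have dist := tends_dist (j := j.+1) lim (c := C2 * ((mu ^+ j.+1)^-1 * (mu `^ (b + 1) * W mu)))
    (a := (mu ^+ j)^-1 * itg (- mu) mu g).
  have {}dist : `|v (fun x => psi (x / mu)) - (mu ^+ j)^-1 * itg (- mu) mu g| <=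
      C2 * ((mu ^+ j.+1)^-1 * (mu `^ (b + 1) * W mu)).
    by apply: dist => K jK; rewrite first // addrAC subrr add0r; apply: sC.
  have vm : `|v (fun x => psi (x / mu))| <= `|C1| * (mu `^ (q + 1) * W mu).
    apply: le_trans (vC mu _) _; first by rewrite /mu; lra.
    by rewrite ler_wpM2r ?ler_norm // mulr_ge0 ?powR_ge0 // ltW // W0 // ltW.
  have Wm : 0 <= W mu by rewrite ltW // W0 // ltW.
  have Wl : 0 <= W lam by rewrite ltW // W0 // ltW.
  have am : (mu ^+ j)^-1 * `|itg (- mu) mu g| <= `|C1| * (mu `^ (q + 1) * W mu) +
      C2 * ((mu ^+ j.+1)^-1 * (mu `^ (b + 1) * W mu)).
    have -> : (mu ^+ j)^-1 * `|itg (- mu) mu g| = `|(mu ^+ j)^-1 * itg (- mu) mu g|.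
      by rewrite normrM ger0_norm // invr_ge0 ltW.
    apply: le_trans (lerD vm dist).
    rewrite -[X in `|X| <= _](subKr (v (fun x => psi (x / mu)))).
    exact: ler_normB.
  have pm : mu `^ b * W mu <= 4 `^ `|b| * C4 * (lam `^ b * W lam).
    rewrite mulrACA; apply: ler_pM; rewrite ?powR_ge0 //.
      by apply: pow_comp => //; rewrite /mu; lra.
    by apply: comp; rewrite /mu; lra.
  apply: (@le_trans _ _ ((`|C1| + C2) * (mu `^ b * W mu))); last first.
    by rewrite /D1 -[leRHS]mulrA ler_wpM2l // addr_ge0 // ltW.
  move: am; rewrite mulrC ler_pdivrMr // => am; apply: le_trans am _.
  have muj : mu `^ (q + 1) * mu ^+ j <= mu `^ b.
    rewrite -powR_mulrn ?(ltW mu0) // -powRDp // ler_powR //; lra.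
  have mub : (mu ^+ j.+1)^-1 * mu `^ (b + 1) * mu ^+ j = mu `^ b.
    rewrite powRDp // powRr1 ?(ltW mu0) // exprS; field.
    by rewrite !gt_eqF.
  rewrite mulrDl mulrDl lerD //.
    rewrite -mulrA ler_wpM2l // mulrAC ler_wpM2r //.
  by rewrite -mulrA ler_wpM2l ?(ltW C20) // mulrA mulrAC mub.
have mid : itg (- lam) lam g = itg (- lam) lam (F j).
  apply: eq_itg => //; first by lra.
  move=> x xl; rewrite /g pj ?eqxx ?mulr1 //.
  rewrite normrM normfV (gtr0_norm mu0) ltr_pdivrMr //.
  have : `|x| <= lam by rewrite ler_norml.
  by rewrite /mu; lra.
have D20 : 0 <= D2 by apply: mulr_ge0; apply: mulr_ge0 => //; rewrite ?powR_ge0 // ltW.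
have bl : lam `^ (b - 1) * lam = lam `^ b.
  by rewrite -{2}[lam]powRr1 ?(ltW l0) // -powRDp // subrK.
have lm : lam <= mu by rewrite /mu; lra.
have right_side : `|itg lam mu g| <= D2 * 3 * (lam `^ b * W lam).
  apply: le_trans (itg_bound cg lm (B := D2 * (lam `^ (b - 1) * W lam)) _) _.
    move=> x /andP[xl xm]; have x0 : 0 <= x by lra.
    by apply: ann; rewrite ger0_norm.
  by rewrite -bl /mu le_eqVlt; apply/orP; left; apply/eqP; ring.
have left_side : `|itg (- mu) (- lam) g| <= D2 * 3 * (lam `^ b * W lam).
  have lm' : - mu <= - lam by lra.
  apply: le_trans (itg_bound cg lm' (B := D2 * (lam `^ (b - 1) * W lam)) _) _.
    move=> x /andP[xl xm]; have x0 : x <= 0 by lra.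
    by apply: ann; rewrite ler0_norm //; lra.
  by rewrite -bl /mu le_eqVlt; apply/orP; left; apply/eqP; ring.
have -> : itg (- lam) lam (F j) = itg (- mu) mu g - itg (- mu) (- lam) g - itg lam mu g.
  by rewrite -mid (itg_split3 g (- mu) (- lam) lam mu); ring.
rewrite 2!mulrDl; apply: le_trans (ler_normB _ _) _; apply: lerD => //.
by apply: le_trans (ler_normB _ _) _; apply: lerD.
Qed.

End MomentEstimate.

(** * Primitives that decay at both ends *)

Section DecayingPrimitives.
Context {R : realType}.
Variable W : R -> R.
Hypothesis W_potter : potter W.
Implicit Types (f : R -> R) (b c e x y C : R) (n : nat).

Let W0 x : 0 <= x -> 0 < W x. Proof. by have [h _] := W_potter; apply: h. Qed.
Let Wn x : 0 < W `|x|. Proof. exact: W0. Qed.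

Lemma tends_eq_from (u w : nat -> R) N l : (forall n, (N <= n)%N -> u n = w n) ->
  tends u l -> tends w l.
Proof.
move=> uw ul e e0; have [N1 h] := ul e e0; exists (maxn N N1) => n.
by rewrite geq_max => /andP[Nn N1n]; rewrite -uw // h.
Qed.

Lemma powR_small c e : c < 0 -> 0 < e -> exists2 N, 0 <= N & forall x, N <= x -> (1 + x) `^ c <= e.
Proof.
move=> c0 e0; exists (e `^ c^-1); first exact: powR_ge0.
move=> x Nx; have p0 : 0 < e `^ c^-1 by rewrite powR_gt0.
have x0 : 0 < x by apply: lt_le_trans Nx.
have -> : e = (e `^ c^-1) `^ c by rewrite -powRrM mulVf ?powRr1 ?(ltW e0) // lt_eqF.
have inv z : z `^ c = (z `^ (- c))^-1 by rewrite powRN invrK.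
rewrite !inv lef_pV2 ?posrE ?powR_gt0 //; last lra.
by rewrite ge0_ler_powR ?nnegrE ?oppr_ge0 ?(ltW c0) ?powR_ge0 //; lra.
Qed.

(** Half of the negative exponent beats the weight, by Potter's bound relative to the origin; the
    other half tends to [0]. *)
Lemma weight_small c e : c < 0 -> 0 < e ->
  exists2 N, 0 <= N & forall x, N <= x -> (1 + x) `^ c * W x <= e.
Proof.
move=> c0 e0; have d0 : 0 < - (c / 2) by lra.
have [_ /(_ _ d0) [C C0 CW]] := W_potter.
have W00 := W0 (lexx 0).
have ce : 0 < e / (C * W 0) by rewrite divr_gt0 // mulr_gt0.
have c2 : c / 2 < 0 by lra.
have [N N0 hN] := powR_small c2 ce; exists N => // x Nx; have x0 : 0 <= x by lra.
have [h _] := CW 0 x (lexx 0) x0; rewrite addr0 divr1 in h.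
apply: le_trans (ler_wpM2l (powR_ge0 _ _) h) _.
have -> : (1 + x) `^ c * (C * (1 + x) `^ (- (c / 2)) * W 0) = (1 + x) `^ (c / 2) * (C * W 0).
  have cc : c = c / 2 + c / 2 by lra.
  have x1 : 0 < 1 + x by lra.
  have x2 : (1 + x) `^ (c / 2) != 0 by rewrite gt_eqF // powR_gt0.
  by rewrite {1}cc powRDp // powRN; field.
by rewrite -ler_pdivlMr ?hN // mulr_gt0.
Qed.

(** The primitive that vanishes at [+oo] vanishes at [-oo] as well, because the symmetric integrals
    tend to [0]. On either half-line it is then a tail integral of [f], to which [mass_tail]
    applies. *)
Lemma decaying_primitive f b C : b < -1 -> continuous f -> 0 <= C ->
  (forall x, `|f x| <= C * (pw b x * W `|x|)) ->
  (forall e : R, 0 < e -> exists lam0, forall lam, lam0 <= lam -> `|itg (- lam) lam f| <= e) ->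
  exists2 H, forall x, is_derive x (1 : R) H (f x) &
    exists2 C', 0 <= C' & forall x, `|H x| <= C' * (pw (b + 1) x * W `|x|).
Proof.
move=> b1 cf C0 fC f0; have [C1 C10 mass] := mass_tail W_potter b1.
have cfN : continuous (fun x => f (- x)).
  by apply: (cont_comp cf) => x; apply: cvgN; apply: cvg_id.
have mp x y : 0 <= x -> x <= y -> `|itg x y f| <= C1 * (C * ((1 + x) `^ (b + 1) * W x)).
  move=> x0 xy; apply: mass => // t /andP[xt _].
  by have := fC t; rewrite (ger0_norm (le_trans x0 xt)).
have mn x y : 0 <= x -> x <= y -> `|itg (- y) (- x) f| <= C1 * (C * ((1 + x) `^ (b + 1) * W x)).
  move=> x0 xy; have -> : itg (- y) (- x) f = itg x y (fun z => f (- z)).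
    have := itg_reflect 0 x y cf; rewrite !sub0r => <-.
    by congr itg; apply/funext => z; rewrite sub0r.
  apply: mass => // t /andP[xt _].
  by have := fC (- t); rewrite pw_even normrN (ger0_norm (le_trans x0 xt)).
have b10 : b + 1 < 0 by lra.
have itgC a c : itg a c f = - itg c a f by rewrite /itg opprB.
have [A uA] : exists A, tends (fun n => itg 0 n%:R f) A.
  apply: tends_cauchy => e e0.
  have ce : 0 < e / (C1 * C + 1) by rewrite divr_gt0 // ltr_wpDl // mulr_ge0 // ltW.
  have [N N0 hN] := weight_small b10 ce; exists (Num.truncn N).+1 => n m Nn nm.
  have -> : itg 0 m%:R f - itg 0 n%:R f = itg n%:R m%:R f by rewrite /itg; ring.
  apply: le_trans (mp _ _ _ _) _; rewrite ?ler_nat //.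
  have Nn' : N <= n%:R by apply: ltW; apply: lt_le_trans (truncnS_gt _) _; rewrite ler_nat.
  rewrite [leLHS]mulrA; apply: (@le_trans _ _ ((C1 * C + 1) * (e / (C1 * C + 1)))).
    apply: ler_pM; rewrite ?mulr_ge0 ?powR_ge0 ?(ltW C10) ?(ltW (W0 _)) ?hN ?lerDl //.
  by rewrite mulrC divfK // gt_eqF // ltr_wpDl // mulr_ge0 // ltW.
have uA' : tends (fun n => itg 0 (- n%:R) f) A.
  rewrite -[A]addr0; have t0 : tends (fun n => - 1 * itg (- n%:R) n%:R f) 0.
    rewrite -(mulr0 (-1)); apply: tendsZ => e e0; have [l0 hl] := f0 e e0.
    exists (Num.truncn l0).+1 => n ln; rewrite subr0; apply: hl.
    by apply: ltW; apply: lt_le_trans (truncnS_gt _) _; rewrite ler_nat.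
  by have := tendsD uA t0; congr tends; apply/funext => n; rewrite /itg; ring.
exists (fun x => itg 0 x f - A).
  move=> x; have := is_deriveDr (is_derive_prim x cf) (is_derive_cstr x (- prim f 0 - A)).
  by rewrite addr0; congr is_derive; apply/funext => y; rewrite /itg; ring.
exists (C1 * C); first by rewrite mulr_ge0 // ltW.
move=> x; rewrite /pw -mulrA distrC.
have [x0|/ltW x0] := leP 0 x.
  rewrite (ger0_norm x0).
  apply: (tends_dist (j := (Num.truncn x).+1) uA) => n xn.
  have -> : itg 0 n%:R f - itg 0 x f = itg x n%:R f by rewrite /itg; ring.
  apply: mp => //; apply: ltW; apply: lt_le_trans (truncnS_gt _) _; by rewrite ler_nat.
rewrite (ler0_norm x0).
apply: (tends_dist (j := (Num.truncn (- x)).+1) uA') => n xn.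
have -> : itg 0 (- n%:R) f - itg 0 x f = - itg (- n%:R) (- - x) f.
  by rewrite opprK /itg; ring.
rewrite normrN; apply: mn; first by rewrite oppr_ge0.
by apply: ltW; apply: lt_le_trans (truncnS_gt _) _; rewrite ler_nat.
Qed.

End DecayingPrimitives.

(** * The structure theorem for real functionals *)

Section StructureTheorem.
Context {R : realType}.
Variables (M : nat -> R) (star : ultra_case).
Hypotheses (M_gt0 : forall p, 0 < M p) (M1 : cond_M1 M) (M2' : cond_M2' M)
  (M3' : cond_M3' M).
Implicit Types (f g phi : R -> R) (l h B C x r lam q b : R) (n m i j k K : nat).
Local Notation test := (test_function M star).
Variable W : R -> R.
Hypothesis W_potter : potter W.
Local Notation weighted_terms := (weighted_terms M star W).
Local Notation represents := (represents M star).
Local Notation dilation_bounded := (dilation_bounded M star W).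

Let W0 x : 0 <= x -> 0 < W x. Proof. by have [h _] := W_potter; apply: h. Qed.
Let Wn x : 0 < W `|x|. Proof. exact: W0. Qed.

Lemma raise_order q j (F : nat -> R -> R) v : q + j%:R + 1 < 0 ->
  (forall m, continuous (F m)) -> weighted_terms q j F -> represents j F v ->
  dilation_bounded q v ->
  exists F', [/\ forall m, continuous (F' m), weighted_terms q j.+1 F' & represents j.+1 F' v].
Proof.
move=> qj Fc Fw Fv vd.
(* [moment_estimate] requires an exponent above [-1], and its bound tends to [0] only if the
   exponent is negative. *)
pose b := Num.max (q + j%:R + 1) (- 2^-1).
have b0 : b < 0 by rewrite gt_max qj; lra.
have b1 : -1 < b by rewrite lt_max; apply/orP; right; lra.
have qb : q + j%:R + 1 <= b by rewrite le_max lexx.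
have [C [lam0 Fm]] := moment_estimate M_gt0 M1 M3' W_potter qb b1 Fc Fw Fv vd.
have qj1 : q + j%:R < -1 by lra.
have [C1 C10 FC] := weighted_term_single M_gt0 W_potter (leqnn j) Fw.
have F0 e : 0 < e -> exists lam1, forall lam, lam1 <= lam -> `|itg (- lam) lam (F j)| <= e.
  move=> e0; pose D := (`|C| + 1) * 2 `^ `|b|.
  have D0 : 0 < D by rewrite mulr_gt0 ?powR_gt0 // ltr_wpDl.
  have [N N0 hN] := weight_small W_potter b0 (divr_gt0 e0 D0).
  exists (Num.max (Num.max 1 lam0) N) => lam; rewrite !ge_max => /andP[/andP[l1 ll] lN].
  have l0 : 0 < lam by lra.
  apply: le_trans (Fm _ ll) _.
  apply: (@le_trans _ _ (D * ((1 + lam) `^ b * W lam))); last first.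
    by have := hN _ lN; rewrite ler_pdivlMr // mulrC.
  rewrite /D -mulrA; apply: (@le_trans _ _ (`|C| * (lam `^ b * W lam))).
    by rewrite ler_wpM2r ?ler_norm // mulr_ge0 ?powR_ge0 // ltW // W0 // ltW.
  apply: ler_pM; rewrite ?lerDl // ?mulr_ge0 ?powR_ge0 // ?(ltW (W0 (ltW l0))) //.
  rewrite mulrA ler_wpM2r ?(ltW (W0 (ltW l0))) //.
  by apply: pow_comp; lra.
have [H HF [C2 C20 HC]] := decaying_primitive W_potter qj1 (Fc j) (ltW C10) FC F0.
have cH : continuous H := is_derive_continuous HF.
pose F' m x := if m == j.+1 then F m x - H x else F m x.
exists F'; split.
- by move=> m; rewrite /F'; case: eqP => _ //; apply: contB.
- apply: qu_imp Fw => l l0 [C3 FC3].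
  have C30 := weighted_terms_ge0 M_gt0 W_potter l0 FC3.
  have lM m : 0 < l ^+ m / M m by rewrite divr_gt0 // exprn_gt0.
  exists (C3 + C2 / (l ^+ j.+1 / M j.+1)) => m x jm.
  have w0 m' : 0 <= pw (q + m'%:R) x * W `|x| by rewrite mulr_ge0 ?(ltW (pw_gt0 _ _)) ?(ltW (Wn _)).
  rewrite /F' mulrDl mulrDl; case: eqP => [->|_].
    apply: le_trans (ler_normB _ _) _; apply: lerD; first exact: FC3.
    rewrite divfK ?(gt_eqF (lM _)) //; apply: le_trans (HC x) _.
    by rewrite -addn1 natrD addrA.
  apply: le_trans (FC3 m x (ltnW jm)) _; rewrite lerDl.
  by apply: mulr_ge0 (w0 m); apply: mulr_ge0; [apply: divr_ge0 => //|]; exact: ltW.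
- move=> r phi r0 tp; have [[sp _] s1] := tp.
  apply: (tends_eq_from (N := j.+2)) (Fv r phi r0 tp) => K jK.
  have cd m : continuous (derive1n m phi) by apply: smooth_continuous.
  have parts : itg (- r) r (fun x => F j x * derive1n j phi x) =
      - itg (- r) r (fun x => H x * derive1n j.+1 phi x).
    (* [supp r] says nothing at [|x| = r] itself; on a larger interval the boundary terms vanish
       outright. *)
    have wide m g : continuous g -> itg (- r) r (fun x => g x * derive1n m phi x) =
        itg (- (r + 1)) (r + 1) (fun x => g x * derive1n m phi x).
      move=> cg; rewrite (itg_supp (r := r)) //; [exact: contM|by rewrite lerDl|].
      by move=> x rx; rewrite (supp_derive1n m sp s1) ?mulr0.
    rewrite !wide // (itg_parts _ _ (Fc j) (cd j.+1) HF (fun x => smooth_tower sp j x)) //.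
    have z y : `|y| = r + 1 -> derive1n j phi y = 0.
      by move=> yr; apply: (supp_derive1n j sp s1); rewrite yr ltrDl.
    have r1 : 0 <= r + 1 by lra.
    by rewrite !z ?normrN ?ger0_norm // !mulr0 subrr sub0r opprK.
  rewrite big_ltn ?(ltnW jK) // [in RHS]big_ltn // [in LHS]big_ltn // addrA; congr (_ + _).
    rewrite parts addrC -itgB; [|exact: contM|exact: contM].
    by congr itg; apply/funext => x; rewrite /F' eqxx; ring.
  rewrite big_nat_cond [RHS]big_nat_cond; apply: eq_bigr => m /andP[/andP[jm _] _].
  by rewrite /F' gtn_eqF.
Qed.

(** Only finitely many [n] lie below the threshold [lam0]; they go into the constant. *)
Lemma dyadic_bound q v : dilation_bounded q v -> forall r phi, test r phi -> exists C, forall n,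
  `|v (fun x => phi (x / 2 ^+ n))| <= C * (2 ^+ n * ((2 ^+ n) `^ q * W (2 ^+ n))).
Proof.
move=> vd r phi tp; have [C [lam0 vC]] := vd r phi tp.
have two n : 0 < 2 ^+ n :> R by apply: two_gt0.
pose rho n := 2 ^+ n * ((2 ^+ n) `^ q * W (2 ^+ n)).
have rho0 n : 0 < rho n by rewrite !mulr_gt0 ?powR_gt0 // W0 // ltW.
pose N := (Num.truncn lam0).+1; pose u n := v (fun x => phi (x / 2 ^+ n)).
exists (`|C| + \sum_(n < N) `|u n| / rho n) => n; rewrite -/(rho n) -/(u n) mulrDl.
have S0 m : 0 <= `|u m| / rho m by rewrite divr_ge0 // ltW.
have [nN|Nn] := ltnP n N.
  rewrite (bigD1 (Ordinal nN)) //= mulrDl divfK ?gt_eqF // addrCA lerDl.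
  by rewrite addr_ge0 // mulr_ge0 ?(ltW (rho0 n)) // sumr_ge0.
apply: (@le_trans _ _ (`|C| * rho n)); last by rewrite lerDl mulr_ge0 ?(ltW (rho0 n)) // sumr_ge0.
apply: le_trans (vC _ _) _.
  apply: ltW; apply: lt_le_trans (truncnS_gt _) _; apply: (@le_trans _ _ n%:R); first by rewrite ler_nat.
  exact/ltW/ltr_exp2n.
have -> : rho n = (2 ^+ n) `^ (q + 1) * W (2 ^+ n).
  by rewrite /rho powRDp // powRr1 ?(ltW (two n)) //; ring.
by rewrite ler_wpM2r ?ler_norm // mulr_ge0 ?powR_ge0 // ltW // W0 // ltW.
Qed.

Lemma order_zero q v : real_functional M star v -> dilation_bounded q v ->
  exists F, [/\ forall m, continuous (F m), weighted_terms q 0 F & represents 0 F v].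
Proof.
move=> vf vd; pose rho n := (2 ^+ n) `^ q * W (2 ^+ n).
have two n : 0 < 2 ^+ n :> R by apply: two_gt0.
have rho0 n : 0 < rho n by rewrite !mulr_gt0 ?powR_gt0 // W0 // ltW.
have [G [Gc GW Gv]] := dyadic_structure M_gt0 M1 M2' M3' vf rho0 (dyadic_bound vd).
(* On the shells that reach [x] one has [2^n <= 8 (1 + |x|)] and [|x| <= 2^n], so [1 + 2^n] and
   [1 + |x|] differ by a factor of at most [9]. *)
have c9 : 1 <= 9 :> R by lra.
have [C1 C10 comp] := potter_comp W_potter c9.
exists G; split=> //; last first.
  by move=> r phi r0 tp; have := Gv r phi r0 tp; congr tends; apply/funext => K; rewrite big_mkord.
have w0 x : 0 <= pw q x * W `|x| by rewrite mulr_ge0 ?(ltW (pw_gt0 _ _)) ?(ltW (Wn _)).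
apply: qu_imp (GW (fun x => pw q x * W `|x|) w0 _) => [l l0 [C GC]|].
  exists C => m x _; apply: le_trans (GC m x) _.
  by rewrite pwD pwX le_eqVlt; apply/orP; left; apply/eqP; ring.
exists (9 `^ `|q| * C1) => n x act xn; rewrite /rho mulrACA.
have n8 : 2 ^+ n <= 8 * (1 + `|x|).
  have x0 := normr_ge0 x; case: act => [->|]; [by rewrite expr0; lra|lra].
have n1 : 1 <= 2 ^+ n :> R by rewrite exprn_ege1 // ler1n.
have x0 := normr_ge0 x; have tn := two n; move: (2 ^+ n) n8 n1 tn xn => z n8 n1 tn xn.
apply: ler_pM; rewrite ?powR_ge0 ?(ltW (W0 (ltW tn))) //.
  apply: (pow_comp _ tn (norm1_gt0 x)); lra.
by apply: comp; lra.
Qed.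

Theorem real_structure q v k : (0 < k)%N -> (forall i, (i < k.-1)%N -> q + i%:R + 1 < 0) ->
  real_functional M star v -> dilation_bounded q v ->
  exists F, [/\ forall m, continuous (F m), weighted_terms q k.-1 F, represents k.-1 F v &
    q = - k%:R -> exists C lam0, forall lam, lam0 <= lam ->
      `|itg (- lam) lam (F k.-1)| <= C * W lam].
Proof.
move=> k0 qk vf vd.
have step i : (i <= k.-1)%N ->
    exists F, [/\ forall m, continuous (F m), weighted_terms q i F & represents i F v].
  elim: i => [|i IH] ik; first exact: order_zero.
  by have [F [Fc Fw Fv]] := IH (ltnW ik); apply: raise_order (qk i ik) Fc Fw Fv vd.
have [F [Fc Fw Fv]] := step _ (leqnn _); exists F; split=> // qE.
have q0 : q + k.-1%:R + 1 <= 0 by rewrite qE -addrA natr1 prednK // addNr.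
have b1 : -1 < 0 :> R by lra.
have [C [lam0 FC]] := moment_estimate M_gt0 M1 M3' W_potter q0 b1 Fc Fw Fv vd.
by exists C, lam0 => lam ll; have := FC lam ll; rewrite powRr0 mul1r.
Qed.

(** In the critical case the lowest term is split according to [eta (x / lam) = eta 0 + (eta (x /
    lam) - eta 0)], with [eta] the [j]-th derivative of the test function. The constant meets the
    symmetric integral; the difference gains a factor [|x| / lam], which lifts the exponent from
    [-1] to [0]. *)
Theorem real_structure_converse q v j (F : nat -> R -> R) : -1 <= q + j%:R ->
  (forall m, continuous (F m)) -> weighted_terms q j F -> represents j F v ->
  (q + j%:R = -1 -> exists C lam0, forall lam, lam0 <= lam ->
      `|itg (- lam) lam (F j)| <= C * W lam) ->
  dilation_bounded q v.
Proof.
move=> qj Fc Fw Fv F1 r0 phi tp0.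
pose r := Num.max 1 r0; have r1 : 1 <= r by rewrite le_max lexx.
have tp : test r phi by apply: test_le tp0; rewrite le_max lexx orbT.
have rp : 0 < r by lra.
pose I lam m := itg (- (r * lam)) (r * lam) (fun x => F m x * derive1n m (fun y => phi (y / lam)) x).
have lim lam : 0 < lam -> tends (fun K => \sum_(j <= m < K) I lam m) (v (fun x => phi (x / lam))).
  by move=> l0; apply: Fv; [rewrite mulr_ge0; lra|apply: test_div].
have [qj1|qj1] := ltP (-1) (q + j%:R).
  have [C C0 sC] := series_estimate M_gt0 W_potter (leqnn j) (lexx _) qj1 r1 Fc Fw tp.
  exists C, 1 => lam l1; have l0 : 0 < lam by lra.
  have := tends_dist (lim lam l0) (j := 0%N) (a := 0) (c := C * (lam `^ (q + 1) * W lam)).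
  rewrite subr0; apply => K _; rewrite subr0; apply: le_trans (sC lam K l1) _.
  rewrite le_eqVlt; apply/orP; left; apply/eqP; congr (_ * _).
  have -> : q + j%:R + 1 = (q + 1) + j%:R by ring.
  rewrite powRDp // powR_mulrn ?(ltW l0) //.
  by field; rewrite expf_neq0 // gt_eqF.
have {qj qj1} qE : q + j%:R = -1 by apply: le_anti; rewrite qj qj1.
have qj1 : q + j.+1%:R <= 0 by rewrite -addn1 natrD addrA qE addNr.
have b1 : -1 < 0 :> R by lra.
have [C C0 sC] := series_estimate M_gt0 W_potter (leqnSn j) qj1 b1 r1 Fc Fw tp.
have [C1 [lam1 FC]] := F1 qE.
have [C2 C20 FW] := weighted_term_single M_gt0 W_potter (leqnn j) Fw.
have [[sp up] _] := tp.
have [h h0 [B pB]] : exists2 h, 0 < h & exists B, dbnd M phi h B.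
  by move: up; rewrite /coqu; case: star => // /(_ 1 ltr01) [B pB]; exists 1 => //; exists B.
have B0 := dbnd_ge0 M_gt0 pB.
pose A := B * h ^+ j.+1 * M j.+1.
have A0 : 0 <= A by rewrite !mulr_ge0 ?exprn_ge0 ?(ltW h0) ?(ltW (M_gt0 _)).
have [C3 C30 mass] := mass_upper W_potter b1.
have [C4 C40 comp] := potter_comp W_potter r1.
pose eta := derive1n j phi.
have ce : continuous eta by apply: smooth_continuous.
have lip x : `|eta x - eta 0| <= A * `|x|.
  have lipx y z : y <= z -> `|eta z - eta y| <= A * (z - y).
    move=> yz.
    have -> : eta z - eta y = itg y z (derive1n j.+1 phi).
      apply/esym/itg_prim; [exact: smooth_continuous|exact: smooth_tower].
    by apply: itg_bound => //; apply: smooth_continuous.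
  have [x0|/ltW x0] := leP 0 x; first by have := lipx _ _ x0; rewrite subr0 (ger0_norm x0).
  by rewrite distrC; have := lipx _ _ x0; rewrite sub0r (ler0_norm x0).
clearbody A.
pose D := C3 * (C2 * A * (2 * r * C4)) + `|C1| * C4 * `|eta 0|.
exists (D + C), (Num.max 1 lam1) => lam; rewrite ge_max => /andP[l1 ll].
have l0 : 0 < lam by lra.
have rl0 : 0 <= r * lam by rewrite mulr_ge0; lra.
have rll : lam <= r * lam by rewrite ler_peMl //; lra.
have Wrl : W (r * lam) <= C4 * W lam.
  apply: comp => //; [lra|by rewrite mulrDr mulr1; lra|].
  by apply: (@le_trans _ _ (1 + r * lam)); [lra|rewrite ler_peMl; lra].
have Wl : 0 <= W lam by rewrite ltW // W0 // ltW.
have lj : 0 < lam ^+ j by rewrite exprn_gt0.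
have cel : continuous (fun x => eta (x / lam)).
  have -> : (fun x => eta (x / lam)) = fun x => eta (lam^-1 * x).
    by apply/funext => x; rewrite mulrC.
  exact: continuous_scale.
have lE : lam `^ (q + 1) = (lam ^+ j)^-1.
  have -> : q + 1 = - j%:R by lra.
  by rewrite powR_invn // ltW.
pose g x := F j x * (eta (x / lam) - eta 0).
have cg : continuous g by apply: contM => //; apply: contB => //; apply: cont_cst.
have gW : `|itg (- (r * lam)) (r * lam) g| <= C3 * (C2 * A * (2 * r * C4)) * W lam.
  have K0 : 0 <= C2 * A / lam by apply: divr_ge0 (ltW l0); apply: mulr_ge0 => //; exact: ltW.
  apply: le_trans (mass (r * lam) g (C2 * A / lam) rl0 K0 cg _) _.
    move=> x _; rewrite /g normrM.
    apply: (@le_trans _ _ (C2 * (pw (q + j%:R) x * W `|x|) * (A * (`|x| / lam)))).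
      apply: ler_pM => //; apply: le_trans (lip _) _.
      by rewrite normrM normfV (gtr0_norm l0).
    have -> : C2 * (pw (q + j%:R) x * W `|x|) * (A * (`|x| / lam)) =
      C2 * A / lam * (`|x| * pw (-1) x * W `|x|) by rewrite qE; ring.
    rewrite ler_wpM2l // ler_wpM2r ?(ltW (Wn x)) //.
    have -> : pw 0 x = (1 + `|x|) * pw (-1) x.
      by rewrite -[X in X * _](@powRr1 _ (1 + `|x|)) ?(ltW (norm1_gt0 x)) // -pwD subrr.
    by rewrite ler_wpM2r ?(ltW (pw_gt0 _ _)) // lerDr.
  rewrite add0r powRr1; last by lra.
  have -> : C3 * (C2 * A * (2 * r * C4)) * W lam = C3 * (C2 * A / lam * (2 * r * lam * (C4 * W lam))).
    by field; rewrite gt_eqF.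
  rewrite ler_wpM2l ?(ltW C30) // ler_wpM2l // ler_pM ?(ltW (W0 rl0)) //; first lra.
  by rewrite -mulrA; lra.
have FW' : `|itg (- (r * lam)) (r * lam) (F j)| <= `|C1| * C4 * W lam.
  apply: le_trans (FC _ (le_trans ll rll)) _.
  apply: (@le_trans _ _ (`|C1| * W (r * lam))).
    by rewrite ler_wpM2r ?ler_norm ?(ltW (W0 rl0)).
  by rewrite -mulrA ler_wpM2l.
have Ij : I lam j = (lam ^+ j)^-1 * (itg (- (r * lam)) (r * lam) g +
    eta 0 * itg (- (r * lam)) (r * lam) (F j)).
  rewrite -itgZ // -itgD //; last exact: contZ.
  rewrite -itgZ; last by apply: contD => //; apply: contZ.
  by congr itg; apply/funext => x; rewrite derive1n_div // /g /eta; ring.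
have IjB : `|I lam j| <= (lam ^+ j)^-1 * (D * W lam).
  rewrite Ij normrM gtr0_norm ?invr_gt0 // ler_wpM2l ?invr_ge0 ?(ltW lj) //.
  apply: le_trans (ler_normD _ _) _; rewrite /D mulrDl lerD // normrM.
  rewrite mulrC; apply: le_trans (ler_wpM2r _ FW') _ => //.
  by rewrite mulrAC.
have := tends_dist (lim lam l0) (j := j.+1) (a := 0) (c := (lam ^+ j)^-1 * (D * W lam) + C * ((lam ^+ j)^-1 * W lam)).
have -> : (D + C) * (lam `^ (q + 1) * W lam) = (lam ^+ j)^-1 * (D * W lam) + C * ((lam ^+ j)^-1 * W lam).
  by rewrite lE; ring.
rewrite subr0; apply => K jK.
rewrite subr0 big_ltn //; apply: le_trans (ler_normD _ _) _; apply: lerD => //.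
apply: le_trans (sC lam K l1) _; rewrite add0r powRr1 ?(ltW l0) //.
rewrite le_eqVlt; apply/orP; left; apply/eqP; rewrite exprS; field.
by rewrite !gt_eqF.
Qed.

End StructureTheorem.

(** * O-slowly varying functions *)

Section SlowlyVarying.
Context {R : realType}.
Variable L : R -> R.
Hypotheses (L_loc : Linfty_loc L) (L_slow : O_slowly_varying L) (L_low : locally_bounded_below L).
Implicit Types (f F : R -> R) (a b c e x y r s B C K : R).
Local Notation mu := (@lebesgue_measure R).

(** An interval on which [L] exceeds its essential supremum would be a null set. Intervals are all
    that is needed, because a bound violated by a continuous function is violated on an interval. *)
Lemma local_ess_bound r : exists2 B, 0 < B & forall a b, 0 <= a -> a < b -> b <= r ->
  ~ (forall x, a < x < b -> B < L x).
Proof.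
have Kc : compact (`[0, r]%classic : set R) by exact: segment_compact.
have Kp : `[0, r]%classic `<=` (`[0, +oo[%classic : set R).
  by move=> x /=; rewrite !in_itv /= => /andP[->].
have := L_loc Kc Kp; rewrite /finite_norm unlock /Lnorm => fin.
pose s := ess_sup_inf.ess_sup mu (abse \o (EFin \o (L \_ `[0, r]%classic))).
exists (Num.max 1 (fine s)); first by rewrite lt_max ltr01.
move=> a b a0 ab br Lab.
have mab : (0 < mu `]a, b[%classic)%E.
  by rewrite lebesgue_measure_itv /= lte_fin ab -EFinD lte_fin subr_gt0.
have mT : (0 < mu setT)%E by apply: lt_le_trans mab _; apply: le_measure; rewrite ?inE //; exact: measurable_itv.
move: fin; rewrite mT -/s => fin.
have key t (u : \bar R) : (u < +oo)%E -> (`|t|%:E <= u)%E -> t <= fine u.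
  by case: u => [u| |] //= _; rewrite lee_fin; apply: le_trans; exact: ler_norm.
have [A [mA A0 sub]] := ess_sup_inf.ess_sup_ge mu (abse \o (EFin \o (L \_ `[0, r]%classic))).
have : (mu `]a, b[%classic <= mu A)%E.
  apply: le_measure; rewrite ?inE // => x /=; rewrite in_itv /= => xab; apply: sub => /=; rewrite -/s => Ls.
  have := Lab x xab; rewrite gt_max => /andP[_]; apply/negP; rewrite -leNgt.
  move: Ls; rewrite patchE mem_set; last first.
    by rewrite /= in_itv /=; case/andP: xab => ax xb; apply/andP; split; apply: ltW; [apply: le_lt_trans ax|apply: lt_le_trans br].
  exact: key.
by rewrite A0 leNgt mab.
Qed.

(** Replacing both points by their maximum with [s] does not increase the ratio of [1 + y] to
    [1 + x]. *)
Lemma max_ratio x y s : 0 <= x -> x <= y -> (1 + Num.max y s) * (1 + x) <= (1 + y) * (1 + Num.max x s).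
Proof.
move=> x0 xy; case: (leP x s) => xs; case: (leP y s) => ys; try lra.
- by rewrite mulrC ler_pM2r; lra.
- by rewrite ler_pM2l; lra.
Qed.

Lemma potter_weight : exists W : R -> R, [/\ potter W,
  exists r, forall x, r < x -> W x = L x,
  exists2 C, 0 < C & forall x, 0 <= x -> W x <= C * L x &
  forall F a K, continuous F -> 0 <= K -> (forall x, `|F x| <= K * (pw a x * L `|x|)) ->
    forall x, `|F x| <= K * (pw a x * W `|x|)].
Proof.
have [Lp _ Ls] := L_slow.
have [C1 [c1 [r [C10 c10 r0 L1]]]] := Ls 1 ltr01.
pose r1 := r + 1; have r10 : 0 < r1 by rewrite /r1; lra.
have [B B0 BL] := local_ess_bound r1.
(* Near the origin [L] is only essentially bounded, so that [W] need not dominate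
   it there; it does so for the purpose of majorizing continuous functions. *)
pose W x := if x <= r1 then B else L x.
have W0 x : 0 <= x -> 0 < W x by move=> x0; rewrite /W; case: (leP x r1) => // _; apply: Lp.
exists W; split.
- split=> // e e0.
  have [C2 [c2 [r2 [C20 c20 r20 L2]]]] := Ls e e0.
  pose s := Num.max r1 r2 + 1.
  have s1 : r1 < s by rewrite /s ltr_pwDr // le_max lexx.
  have s2 : r2 < s by rewrite /s ltr_pwDr // le_max lexx orbT.
  have s3 : 1 <= s by rewrite /s lerDr le_max (ltW r10).
  have Lr1 : 0 < L r1 by apply/Lp/ltW.
  (* Bounds of [W] on [[0, s]]: the constant [B] up to [r1], and beyond it the slow variation with
     exponent [1] from the base point [r1]. *)
  pose m1 := Num.min B (c1 * r1 / s * L r1).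
  pose m2 := Num.max B (C1 * (s / r1) * L r1).
  have s0 : 0 < s by lra.
  have m10 : 0 < m1 by rewrite lt_min B0 !mulr_gt0 // invr_gt0.
  have Wb x : 0 <= x -> x <= s -> m1 <= W x <= m2.
    move=> x0 xs; rewrite /W; case: (leP x r1) => xr; first by rewrite ge_min lexx le_max lexx.
    have x1 : 1 <= x / r1 by rewrite ler_pdivlMr // mul1r ltW.
    have rr : r < r1 by rewrite /r1 ltrDl.
    have := L1 (x / r1) r1 x1 rr; rewrite divfK ?gt_eqF // powRr1 ?(le_trans ler01) //.
    rewrite ler_pdivlMr // ler_pdivrMr // => /andP[lo hi].
    rewrite ge_min le_max; apply/andP; split; apply/orP; right.
      apply: le_trans lo; rewrite ler_pM2r // invf_div -mulrA ler_pM2l //.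
      by rewrite ler_pM2l // lef_pV2 ?posrE //; lra.
    by apply: le_trans hi _; rewrite ler_pM2r // ler_pM2l // ler_pM2r ?invr_gt0.
  pose kap := m2 / m1.
  have m12 : m1 <= m2 by have /andP[h1 h2] := Wb 0 (lexx 0) (ltW s0); apply: le_trans h2.
  have kap1 : 1 <= kap by rewrite ler_pdivlMr // mul1r.
  (* Points are moved into [[s, +oo[], where slow variation applies; since [W] is bounded above and
     below on [[0, s]], this costs a factor [kap] on each side. *)
  pose cl x := Num.max x s.
  have clW x : 0 <= x -> W x <= kap * W (cl x) /\ W (cl x) <= kap * W x.
    move=> x0; rewrite /cl; case: (leP x s) => xs; last first.
      by split; rewrite ler_peMl // ltW // W0.
    have /andP[a1 a2] := Wb x x0 xs; have /andP[b1 b2] := Wb s (ltW s0) (lexx s).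
    have k2 z : m1 <= z -> m2 <= kap * z.
      by move=> mz; rewrite /kap mulrAC ler_pdivlMr // ler_wpM2l // ltW // (lt_le_trans m10).
    by split; [apply: le_trans a2 (k2 _ b1)|apply: le_trans b2 (k2 _ a1)].
  pose C3 := Num.max C2 c2^-1 * 2 `^ e.
  have m0 : 0 < Num.max C2 c2^-1 by rewrite lt_max C20.
  have C30 : 0 < C3 by rewrite mulr_gt0 // powR_gt0.
  have big x y : s <= x -> x <= y -> W y <= C3 * ((1 + y) / (1 + x)) `^ e * W x /\
      W x <= C3 * ((1 + y) / (1 + x)) `^ e * W y.
    move=> sx xy; have x0 : 0 < x by lra. have y0 : 0 < y by lra.
    have xr : (x <= r1) = false by apply/negbTE; rewrite -ltNge; lra.
    have yr : (y <= r1) = false by apply/negbTE; rewrite -ltNge; lra.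
    rewrite /W xr yr; have yx1 : 1 <= y / x by rewrite ler_pdivlMr // mul1r.
    have xr2 : r2 < x by lra.
    have Lx := Lp x (ltW x0); have Ly := Lp y (ltW y0).
    have := L2 (y / x) x yx1 xr2; rewrite divfK ?gt_eqF //.
    rewrite ler_pdivlMr // ler_pdivrMr // => /andP[lo hi].
    have p0 : 0 < (y / x) `^ e by rewrite powR_gt0 // divr_gt0.
    have x1 : 0 < 1 + x by lra. have y1 : 0 < 1 + y by lra.
    have f1 : 0 <= (1 + y) / (1 + x) by rewrite divr_ge0 ?(ltW x1) ?(ltW y1).
    have f2 : 0 <= y / x by rewrite divr_ge0 ?(ltW x0) ?(ltW y0).
    (* [y / x <= 2 (1 + y) / (1 + x)], because [x >= s >= 1]. *)
    have pe : (y / x) `^ e <= 2 `^ e * ((1 + y) / (1 + x)) `^ e.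
      rewrite -powRM //; apply: ge0_ler_powR; rewrite ?nnegrE ?f2 ?(ltW e0) ?(mulr_ge0 (ler0n _ 2) f1) //.
      rewrite ler_pdivrMr // mulrA mulrAC ler_pdivlMr //.
      have xy0 : 0 <= x * y by rewrite mulr_ge0 // ltW.
      nra.
    split.
      apply: le_trans hi _; rewrite ler_pM2r // /C3 -mulrA ler_pM ?powR_ge0 ?(ltW C20) //.
      by rewrite le_max lexx.
    move: lo; rewrite mulrAC ler_pdivrMr // -ler_pdivlMl // => lo.
    apply: le_trans lo _; rewrite mulrCA mulrC ler_pM2r // /C3 -mulrA ler_pM ?powR_ge0 ?invr_ge0 ?(ltW c20) //.
    by rewrite le_max lexx orbT.
  have kap0 : 0 < kap := lt_le_trans ltr01 kap1.
  exists (kap * (C3 * kap)) => [|x y x0 xy]; first exact: mulr_gt0 kap0 (mulr_gt0 C30 kap0).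
  have y0 : 0 <= y by lra.
  have [x1 x2] := clW x x0; have [y1 y2] := clW y y0.
  have clxy : cl x <= cl y by rewrite /cl ge_max !le_max xy lexx orbT.
  have sc z : s <= cl z by rewrite le_max lexx orbT.
  have [b1 b2] := big _ _ (sc x) clxy.
  have cx0 : 0 < 1 + cl x by have := sc x; lra.
  have cy0 : 0 < 1 + cl y by have := sc y; lra.
  have rat : ((1 + cl y) / (1 + cl x)) `^ e <= ((1 + y) / (1 + x)) `^ e.
    have x3 : 0 < 1 + x by lra. have y3 : 0 < 1 + y by lra.
    apply: ge0_ler_powR; rewrite ?nnegrE ?(ltW e0) ?divr_ge0 ?(ltW x3) ?(ltW y3) ?(ltW cx0) ?(ltW cy0) //.
    rewrite ler_pdivrMr // mulrAC ler_pdivlMr //.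
    exact: max_ratio.
  have k0 := ltW kap0.
  have fin u w p z : 0 <= z -> u <= kap * w -> w <= C3 * p * z -> p <= ((1 + y) / (1 + x)) `^ e ->
      forall z', z <= kap * z' -> u <= kap * (C3 * kap) * ((1 + y) / (1 + x)) `^ e * z'.
    move=> z0 uw wz pp z' zz'.
    have -> : kap * (C3 * kap) * ((1 + y) / (1 + x)) `^ e * z' =
      kap * (C3 * ((1 + y) / (1 + x)) `^ e * (kap * z')) by ring.
    apply: (le_trans uw); apply: (ler_wpM2l k0); apply: (le_trans wz).
    apply: (@le_trans _ _ (C3 * ((1 + y) / (1 + x)) `^ e * z)).
      by rewrite ler_wpM2r // ler_pM2l.
    by rewrite ler_wpM2l // mulr_ge0 ?powR_ge0 // ltW.
  have cl0 z : 0 <= cl z by have := sc z; lra.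
  split.
    exact: (fin _ _ _ _ (ltW (W0 _ (cl0 x))) y1 b1 rat _ x2).
  exact: (fin _ _ _ _ (ltW (W0 _ (cl0 y))) x1 b2 rat _ y2).
- by exists r1 => x xr; rewrite /W leNgt xr.
- have Kc : compact (`[0, r1]%classic : set R) by exact: segment_compact.
  have Kp : `[0, r1]%classic `<=` (`[0, +oo[%classic : set R).
    by move=> x /=; rewrite !in_itv /= => /andP[->].
  have [c c0 cL] := L_low Kc Kp.
  exists (Num.max 1 (B / c)) => [|x x0]; first by rewrite lt_max ltr01.
  have Lx := Lp x x0; rewrite /W; case: (leP x r1) => xr.
    apply: (@le_trans _ _ (B / c * L x)); last by rewrite ler_pM2r // le_max lexx orbT.
    rewrite mulrAC ler_pdivlMr // ler_pM2l //; apply: cL; rewrite /= in_itv /=.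
    by rewrite x0 xr.
  by rewrite ler_peMl ?(ltW Lx) // le_max lexx.
- have half F a K : continuous F -> 0 <= K -> (forall x, `|F x| <= K * (pw a x * L `|x|)) ->
      forall x, 0 <= x -> `|F x| <= K * (pw a x * W `|x|).
    move=> cF K0 FK x x0; rewrite /W; case: (leP `|x| r1) => [xr|_]; last exact: FK.
    (* A violation at [x] persists on an interval inside [[0, r1]], where the hypothesis on [F]
       would force [L > B]. *)
    rewrite leNgt; apply/negP => big.
    pose g y := `|F y| - K * B * pw a y.
    have cg : continuous g.
      by apply: contB; [exact: continuous_norm|exact/contZ/continuous_pw].
    have gx : 0 < g x by rewrite subr_gt0 -mulrA [B * _]mulrC.
    have [d d0 gd] : exists2 d, 0 < d & forall y, `|y - x| < d -> 0 < g y.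
      have /cg/nbhs_ballP[d /= d0 gd] : nbhs (g x) [set z | 0 < z].
        apply/nbhs_ballP; exists (g x) => //= z; rewrite /ball /= => /ltr_distlBl.
        by rewrite subrr.
      by exists d => // y yx; apply: gd; rewrite /ball /= distrC.
    have K1 : 0 < K.
      rewrite lt_def K0 andbT; apply/eqP => K00; have := FK x.
      rewrite K00 mul0r normr_le0 => /eqP Fx; move: gx; rewrite /g Fx K00 normr0 !mul0r subrr.
      by rewrite ltxx.
    have [a' [b' [a0 ab br near]]] : exists a' b', [/\ 0 <= a', a' < b', b' <= r1 &
        forall y, a' < y < b' -> `|y - x| < d].
      rewrite ger0_norm // in xr.
      have [xr1|xr1] := ltP x r1.
        exists x, (Num.min (x + d) r1); split=> //; rewrite ?lt_min ?ge_min ?xr1 ?ltrDl ?d0 ?lexx ?orbT //.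
        move=> y; rewrite lt_min => /andP[xy /andP[yd _]].
        by rewrite gtr0_norm ?subr_gt0 // ltrBlDl.
      exists (Num.max 0 (x - d)), x; split=> //; rewrite ?le_max ?gt_max ?lexx ?ltrBlDr ?ltrDl ?d0 ?andbT //.
        by lra.
      move=> y; rewrite gt_max => /andP[/andP[_ xd] yx].
      by rewrite ltr0_norm ?subr_lt0 // opprB ltrBlDr -ltrBlDl.
    apply: (BL a' b' a0 ab br) => y yab.
    have y0 : 0 <= y by case/andP: yab => /ltW/(le_trans a0).
    have := gd y (near y yab); rewrite subr_gt0 => h; have := lt_le_trans h (FK y).
    by rewrite -mulrA ltr_pM2l // mulrC ltr_pM2l ?pw_gt0 // ger0_norm.
  move=> F a K cF K0 FK x; have [x0|/ltW x0] := leP 0 x; first exact: half.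
  have cFN : continuous (fun x => F (- x)).
    by apply: (cont_comp cF) => y; apply: cvgN; apply: cvg_id.
  have FKN y : `|F (- y)| <= K * (pw a y * L `|y|).
    by have := FK (- y); rewrite pw_even normrN.
  have := half _ a K cFN K0 FKN (- x); rewrite oppr_ge0 opprK pw_even normrN; exact.
Qed.

End SlowlyVarying.

(** * Ultradistributions *)

Section ComplexValues.
Context {R : realType}.
Implicit Types (z w : R[i]) (f g : R -> R) (phi : cfun R) (r x : R).

Lemma normc_ge0 z : 0 <= normc z.
Proof. by case: z => a b; apply: sqrtr_ge0. Qed.

Lemma normc_norm z : `|z| = (normc z)%:C%C.
Proof. by rewrite normc_def; case: z. Qed.

Lemma normcD z w : normc (z + w) <= normc z + normc w.
Proof. by have := ler_normD z w; rewrite !normc_norm -rmorphD lecR. Qed.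

Lemma normcC r : normc r%:C%C = `|r|.
Proof. by rewrite /normc /= expr0n addr0 sqrtr_sqr. Qed.

Lemma normcI r : normc (Complex 0 r) = `|r|.
Proof. by rewrite /normc /= expr0n add0r sqrtr_sqr. Qed.

Lemma normc_le z : normc z <= `|complex.Re z| + `|complex.Im z|.
Proof.
have zE : z = (complex.Re z)%:C%C + Complex 0 (complex.Im z).
  by case: z => a b; apply/eqP; rewrite eq_complex /= addr0 add0r !eqxx.
by rewrite {1}zE; apply: le_trans (normcD _ _) _; rewrite normcC normcI.
Qed.

Lemma normc_re z : `|complex.Re z| <= normc z.
Proof. by case: z => a b /=; rewrite -sqrtr_sqr ler_wsqrtr // lerDl sqr_ge0. Qed.

Lemma normc_im z : `|complex.Im z| <= normc z.
Proof. by case: z => a b /=; rewrite -sqrtr_sqr ler_wsqrtr // lerDr sqr_ge0. Qed.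

Lemma bigO_pinftyP f g : bigO_pinfty f g <->
  exists C lam0, forall lam, lam0 <= lam -> `|f lam| <= C * `|g lam|.
Proof.
split=> [/eqO_exP|].
  move=> [C _ [N [_ NP]]]; exists C, (N + 1) => lam Nl; apply: NP.
  by apply: lt_le_trans Nl; rewrite ltrDl.
move=> [C [lam0 h]]; apply/eqO_exP; exists (`|C| + 1); first by rewrite /= ltr_wpDl.
exists lam0; split; first exact: num_real.
move=> lam /= ll; apply: le_trans (h lam (ltW ll)) _; rewrite ler_wpM2r //.
by rewrite (le_trans (ler_norm C)) // lerDl.
Qed.

Definition repart phi : R -> R := @complex.Re R \o phi.
Definition impart phi : R -> R := @complex.Im R \o phi.
Definition cpx f : cfun R := fun x => Complex (f x) 0.

Lemma csmoothP phi : csmooth phi <-> smooth (repart phi) /\ smooth (impart phi).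
Proof.
split=> [h|[[h1] [h2]] n x]; last by split; [apply: h1|apply: h2].
by split; split=> n x; [exact: (h n x).1|exact: (h n x).2].
Qed.

Lemma derive1n_zero n : derive1n n (fun _ : R => (0 : R)) = fun=> 0.
Proof. exact: (tower_derive1n n (@tower0 R)). Qed.

Lemma smooth_zero : smooth (fun _ : R => (0 : R)).
Proof. exact: (tower_smooth (@tower0 R)). Qed.

Lemma locally_zero n f x e : smooth f -> (forall y, `|y - x| < e -> f y = 0) ->
  forall y, `|y - x| < e -> derive1n n f y = 0.
Proof.
move=> sf fx y yx; pose g (t : R) := f (t + x).
have sh m (h : R -> R) : smooth h -> smooth (fun t => h (t + x)) /\
    derive1n m (fun t => h (t + x)) = fun t => derive1n m h (t + x).
  move=> sh; have tw : tower (fun n t => derive1n n h (t + x)).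
    by move=> k t; apply: is_derive_shift; apply: smooth_tower.
  by split; [exact: (tower_smooth tw)|exact: (tower_derive1n m tw)].
have [sg gE] := sh n f sf.
have : derive1n n g (y - x) = 0.
  by apply: (derive1n_near0 n sg _ yx) => t te; rewrite /g fx // addrK.
by rewrite gE subrK.
Qed.

Lemma csupport_out phi K n x : csmooth phi -> csupport phi `<=` K -> ~ K x -> cderiv n phi x = 0.
Proof.
move=> /csmoothP[sa sb] suppK nKx.
have nc : ~ csupport phi x by move=> /suppK.
have [e e0 he] : exists2 e : R, 0 < e & forall y, `|y - x| < e -> phi y = 0.
  have : nbhs x (~` closure [set x | phi x != 0]).
    by apply: open_nbhs_nbhs; split=> //; apply/closed_openC/closed_closure.
  move=> /nbhs_ballP[e /= e0 he]; exists e => // y ye; apply/eqP/negPn/negP => py.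
  have yb : ball x e y by rewrite /ball /= distrC.
  by apply: (he y yb); apply: subset_closure.
have xx : `|x - x| < e by rewrite subrr normr0.
rewrite /cderiv (locally_zero n sa _ xx) ?(locally_zero n sb _ xx) //.
  by move=> y ye; rewrite /impart /= he.
by move=> y ye; rewrite /repart /= he.
Qed.

End ComplexValues.

(** * The test space and its neighbourhoods in terms of real functions *)

Section TestSpace.
Context {R : realType}.
Variables (M : nat -> R) (star : ultra_case).
Hypothesis M_gt0 : forall p, 0 < M p.
Implicit Types (f g : R -> R) (phi v w : cfun R) (K : set R) (l h e r x t B C : R) (n m : nat).
Local Notation test := (test_function M star).
Local Notation space := (ultra_space M star).
Local Notation space_on := (ultra_space_on M star).

Let Ml l m : 0 < l -> 0 < l ^+ m * M m.
Proof. by move=> l0; rewrite mulr_gt0 // exprn_gt0. Qed.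

Lemma dom_onP K phi : lc_dom (space_on K) phi <->
  [/\ csmooth phi, csupport phi `<=` K & coqu star (fun l => (ultra_norm M l K phi < +oo)%E)].
Proof.
rewrite /ultra_space_on /coqu; case: star; split.
- move=> h; have [s0 s1 _] := h 1 (ltr01 : 0 < 1); split=> // l l0.
  by have [] := h l l0.
- by move=> [s0 s1 fin] /= l l0; split; [exact: s0|exact: s1|exact: fin].
- by move=> [l /= l0 [s0 s1 fin]]; split=> //; exists l.
- by move=> [s0 s1 [l l0 fin]]; exists l.
Qed.

Lemma ultra_norm_le l K phi B : 0 < l ->
  (forall m x, K x -> normc (cderiv m phi x) <= B * (l ^+ m * M m)) ->
  (ultra_norm M l K phi <= B%:E)%E.
Proof.
move=> l0 h; apply: ge_ereal_sup => _ [m [x [Kx ->]]].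
by rewrite lee_fin ler_pdivrMr ?Ml // h.
Qed.

Lemma ultra_norm_ge l K phi B : 0 < l -> (ultra_norm M l K phi <= B%:E)%E ->
  forall m x, K x -> normc (cderiv m phi x) <= B * (l ^+ m * M m).
Proof.
move=> l0 h m x Kx; rewrite -ler_pdivrMr ?Ml // -lee_fin; apply: le_trans h.
by apply: ereal_sup_ubound; exists m, x.
Qed.

Lemma norm_dbnd l K phi B : 0 < l -> 0 <= B -> csmooth phi -> csupport phi `<=` K ->
  (ultra_norm M l K phi <= B%:E)%E ->
  dbnd M (repart phi) l B /\ dbnd M (impart phi) l B.
Proof.
move=> l0 B0 sp sK nB.
have all m x : normc (cderiv m phi x) <= B * l ^+ m * M m.
  rewrite -mulrA; have [Kx|nKx] := pselect (K x); first exact: ultra_norm_ge nB m x Kx.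
  by rewrite (csupport_out m sp sK nKx) normc0 mulr_ge0 // ltW // Ml.
by split=> m x; apply: le_trans (all m x); [exact: (normc_re (cderiv m phi x))|exact: (normc_im (cderiv m phi x))].
Qed.

Lemma dbnd_norm l K phi A B : 0 < l -> dbnd M (repart phi) l A -> dbnd M (impart phi) l B ->
  (ultra_norm M l K phi <= (A + B)%:E)%E.
Proof.
move=> l0 a b; apply: ultra_norm_le => // m x _; apply: le_trans (normc_le _) _.
by rewrite mulrDl lerD // mulrA; [exact: a|exact: b].
Qed.

Lemma fin_bound (y : \bar R) : (y < +oo)%E -> exists2 B : R, 0 <= B & (y <= B%:E)%E.
Proof.
case: y => [y| |] // _; last by exists 0; rewrite ?leNye.
by exists `|y|; rewrite // lee_fin ler_norm.
Qed.

Lemma dom_on_test K r phi : K `<=` [set x | `|x| <= r] -> lc_dom (space_on K) phi ->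
  test r (repart phi) /\ test r (impart phi).
Proof.
move=> Kr /dom_onP[sp sK fin]; have [sa sb] := (csmoothP phi).1 sp.
have z x : r < `|x| -> phi x = 0.
  move=> rx; have nK : ~ K x by move=> /Kr /=; rewrite leNgt rx.
  by have := csupport_out 0 sp sK nK; rewrite /cderiv /=; case: (phi x).
have bnd : coqu star (fun h => (exists C, dbnd M (repart phi) h C) /\ exists C, dbnd M (impart phi) h C).
  apply: coqu_imp fin => h h0 /fin_bound[B B0 hB].
  by have [a b] := norm_dbnd h0 B0 sp sK hB; split; exists B.
split; split; [split=> //|by move=> x /z h; rewrite /repart /= h|split=> //|by move=> x /z h; rewrite /impart /= h].
  by apply: coqu_imp bnd => h _ [].
by apply: coqu_imp bnd => h _ [].
Qed.

Lemma test_dom_on r phi : test r (repart phi) -> test r (impart phi) ->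
  lc_dom (space_on `[- r, r]%classic) phi.
Proof.
move=> [[sa ua] za] [[sb ub] zb]; apply/dom_onP; split; first exact/csmoothP.
  have ce : `[- r, r]%classic = closure (`[- r, r]%classic : set R) by apply/closure_id; exact: itv_closed.
  rewrite ce.
  apply: closure_subset => x /= px; rewrite in_itv /= -ler_norml leNgt; apply/negP => rx.
  move: px; move: (za x rx) (zb x rx); rewrite /repart /impart /=.
  by case: (phi x) => a b /= -> ->; rewrite eqxx.
apply: coqu_imp (coqu_and (@dbnd_up _ M M_gt0 (repart phi)) (@dbnd_up _ M M_gt0 (impart phi)) ua ub) => h h0 [[A fA] [B fB]].
by apply: le_lt_trans (dbnd_norm _ h0 fA fB) _; rewrite ltry.
Qed.

Lemma compact_ball K : compact K -> exists2 r, 0 <= r & K `<=` [set x | `|x| <= r].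
Proof.
move=> /compact_bounded[N [_ NP]]; exists (Num.max 0 (N + 1)); first by rewrite le_max lexx.
move=> x Kx /=; rewrite le_max; apply/orP; right; apply: NP => //.
by rewrite ltrDl.
Qed.

Lemma domP phi : lc_dom space phi <->
  exists r, [/\ 0 <= r, test r (repart phi) & test r (impart phi)].
Proof.
split=> [[K /= cK] dK|[r [r0 ta tb]]].
  by have [r r0 Kr] := compact_ball cK; have [ta tb] := dom_on_test Kr dK; exists r.
by exists `[- r, r]%classic; [exact: segment_compact|exact: test_dom_on].
Qed.

Lemma dom_cpx r f : 0 <= r -> test r f -> lc_dom space (cpx f).
Proof.
move=> r0 tf; apply/domP; exists r; split=> //.
have [[_ _] _] := tf; split; last by [].
split; first exact: smooth_zero.
rewrite /coqu; case: star => [h h0|]; last exists 1 => //;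
  by exists 0 => m x; rewrite (_ : impart (cpx f) = fun=> 0) // derive1n_zero normr0 !mul0r.
Qed.

Lemma dom_comb (a b : R[i]) v w : lc_dom space v -> lc_dom space w -> lc_dom space (a *: v + b *: w).
Proof.
move=> /domP[r [r0 va vb]] /domP[s [s0 wa wb]]; apply/domP.
pose t := Num.max r s; exists t.
have {}va := test_le (_ : r <= t) va; have {}vb := test_le (_ : r <= t) vb.
have {}wa := test_le (_ : s <= t) wa; have {}wb := test_le (_ : s <= t) wb.
have rt : r <= t by rewrite le_max lexx.
have st : s <= t by rewrite le_max lexx orbT.
split; first exact: le_trans rt.
- have -> : repart (a *: v + b *: w) = fun x =>
     (complex.Re a * repart v x + - complex.Im a * impart v x) +
     (complex.Re b * repart w x + - complex.Im b * impart w x).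
    apply/funext => x; rewrite /repart /impart /=.
    rewrite -[(a *: v + b *: w) x]/(a * v x + b * w x).
    by case: a b (v x) (w x) => ? ? [? ?] [? ?] [? ?] /=; ring.
  by apply: testD => //; apply: testD => //; apply: testZ; [exact: va|exact: vb|exact: wa|exact: wb].
- have -> : impart (a *: v + b *: w) = fun x =>
     (complex.Re a * impart v x + complex.Im a * repart v x) +
     (complex.Re b * impart w x + complex.Im b * repart w x).
    apply/funext => x; rewrite /repart /impart /=.
    rewrite -[(a *: v + b *: w) x]/(a * v x + b * w x).
    by case: a b (v x) (w x) => ? ? [? ?] [? ?] [? ?] /=; ring.
  by apply: testD => //; apply: testD => //; apply: testZ; [exact: vb|exact: va|exact: wb|exact: wa].
Qed.

(** A neighbourhood in the projective limit involves finitely many seminorms, all dominated by the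
    one with the smallest parameter; in the inductive limit it induces a neighbourhood on every
    step. The quantifier [qu] expresses both. *)
Lemma nbhs_elim K W : compact K -> lc_nbhs0 space W ->
  qu star (fun h => exists2 e, 0 < e & forall v, lc_dom (space_on K) v ->
    (ultra_norm M h K v < e%:E)%E -> W v).
Proof.
move=> cK [W1 [_ W1n W1W]].
have inW v : lc_dom (space_on K) v -> W1 v -> W v.
  by move=> dv w1; apply: W1W; split=> //; exists K.
have := W1n K cK; have dE := dom_onP K; move: inW dE; rewrite /ultra_space_on /qu /coqu; case: star => inW dE.
  move=> [J [U [/finite_seqP[s ->] Jpos UJ sub]]].
  have [h [e [h0 e0 he]]] : exists h e, [/\ 0 < h, 0 < e & forall l, l \in s -> h <= l /\
      forall v, lc_dom (ultra_step M l K) v -> (ultra_norm M l K v < e%:E)%E -> U l v].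
    elim: s Jpos UJ {sub} => [|l s IH] Jpos UJ; first by exists 1, 1.
    have [||h [e [h0 e0 he]]] := IH.
    - by move=> x /= xs; apply: Jpos; rewrite /= inE xs orbT.
    - by move=> x /= xs; apply: UJ; rewrite /= inE xs orbT.
    have l0 : 0 < l by apply: (Jpos l); rewrite /= mem_head.
    have [e' e'0 hU] := UJ l (mem_head l s).
    exists (Num.min h l), (Num.min e e'); split; rewrite ?lt_min ?h0 ?e0 //.
    move=> x; rewrite inE => /orP[/eqP->|/he[hx hU']].
      split; first by rewrite ge_min lexx orbT.
      by move=> v dv nv; apply: hU => //; apply: lt_le_trans nv _; rewrite lee_fin ge_min lexx orbT.
    split; first by rewrite ge_min hx.
    by move=> v dv nv; apply: hU' => //; apply: lt_le_trans nv _; rewrite lee_fin ge_min lexx.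
  exists h => //; exists e => // v dv nv; apply: inW => //; apply: sub; split=> // l ls.
  have [hl hU] := he l ls; have l0 : 0 < l := Jpos l ls.
  apply: hU; first exact: (dv l l0).
  apply: le_lt_trans nv; apply: ge_ereal_sup => _ [m [x [Kx ->]]].
  apply: le_trans (ereal_sup_ubound _); last by exists m, x.
  rewrite lee_fin ler_wpM2l ?normc_ge0 // lef_pV2 ?posrE ?Ml // ler_pM2r //.
  by rewrite lerXn2r // nnegrE ltW.
move=> [W' [_ W'n W'W]] h h0; have [e e0 he] := W'n h h0; exists e => // v dv nv.
apply: inW => //; apply: W'W; split=> //; apply: he => //.
have [s0 s1 _] := (dE v).1 dv; split=> //; exact: lt_trans nv (ltry _).
Qed.

Lemma nbhs_intro W : absconvex W -> (forall K, compact K ->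
    qu star (fun h => exists2 e, 0 < e & forall v, lc_dom (space_on K) v ->
      (ultra_norm M h K v < e%:E)%E -> W v)) ->
  lc_nbhs0 space W.
Proof.
move=> aW Wq; exists W; split; [exact: aW| |exact: subIsetr].
move=> K /= cK; have := Wq K cK; have dE := dom_onP K; move: dE; rewrite /ultra_space_on /qu /coqu; case: star => dE.
  move=> [h h0 [e e0 he]]; exists [set h], (fun _ => [set v | lc_dom (lc_proj_lim [set l | 0 < l] (fun l => ultra_step M l K)) v -> W v]).
  split; first exact: finite_set1.
  - by move=> _ ->.
  - move=> _ ->; exists e => // v [_ _ nv] ne dv; exact: he.
  - by move=> v [dv]; apply.
move=> Wh; exists W; split; [exact: aW| |exact: subIsetr].
move=> h h0; have [e e0 he] := Wh h h0; exists e => // v [s0 s1 nv] ne; apply: he => //.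
by apply/dE; split=> //; exists h.
Qed.

End TestSpace.

(** * Decomposition into real and imaginary parts *)

Section Complexification.
Context {R : realType}.
Implicit Types (phi v w : cfun R) (f g : R -> R) (x r c d : R) (m n j : nat).

Lemma continuous_cfunP (F : cfun R) :
  continuous F <-> continuous (repart F) /\ continuous (impart F).
Proof.
split=> [cF|[ca cb] x].
  have dist x e : 0 < e -> \forall y \near x, normc (F x - F y) < e.
    move=> e0; have := cF x; rewrite /continuous_at => /cvgrPdist_lt/(_ e%:C%C).
    rewrite ltcR => /(_ e0); apply: filterS => y /=.
    by rewrite normc_norm ltcR.
  split=> x; apply/cvgrPdist_lt => e e0; apply: filterS (dist x e e0) => y /=.
    apply: le_lt_trans; apply: le_trans (normc_re _).
    by rewrite /repart /=; case: (F x) (F y) => ? ? [].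
  apply: le_lt_trans; apply: le_trans (normc_im _).
  by rewrite /impart /=; case: (F x) (F y) => ? ? [].
apply/cvgrPdist_lt => e; rewrite ltcE => /andP[/eqP ie re].
have e2 : 0 < complex.Re e / 2 by rewrite divr_gt0.
have /cvgrPdist_lt/(_ _ e2) na := ca x; have /cvgrPdist_lt/(_ _ e2) nb := cb x.
apply: filterS2 na nb => y /= ay yb.
rewrite normc_norm ltcE /= ie eqxx /=; apply: le_lt_trans (normc_le _) _.
rewrite [ltRHS]splitr; apply: ltrD.
  by apply: le_lt_trans ay; rewrite /repart /=; case: (F x) (F y) => ? ? [].
by apply: le_lt_trans yb; rewrite /impart /=; case: (F x) (F y) => ? ? [].
Qed.

Lemma Complex_sum (I : Type) (s : seq I) (P : pred I) (a b : I -> R) :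
  \sum_(i <- s | P i) Complex (a i) (b i) = Complex (\sum_(i <- s | P i) a i) (\sum_(i <- s | P i) b i).
Proof.
elim: s => [|i s IH]; first by rewrite !big_nil.
by rewrite !big_cons; case: ifP => // _; rewrite IH.
Qed.

(** The complex-linear extension of [A + i B] from real to complex test functions. *)
Definition complexify (A B : (R -> R) -> R) phi : R[i] :=
  Complex (A (repart phi) - B (impart phi)) (A (impart phi) + B (repart phi)).

End Complexification.

Section Pairings.
Context {R : realType}.
Variables (M : nat -> R) (star : ultra_case).
Hypothesis M_gt0 : forall p, 0 < M p.
Implicit Types (phi v w : cfun R) (f g : R -> R) (x r c d : R) (m n j : nat).
Local Notation test := (test_function M star).
Local Notation space := (ultra_space M star).
Local Notation mu := (@lebesgue_measure R).

Definition linear_on_tests (A : (R -> R) -> R) := forall r f g c d, 0 <= r ->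
  test r f -> test r g -> A (fun x => c * f x + d * g x) = c * A f + d * A g.

Lemma repart_comb (a b : R[i]) v w : repart (a *: v + b *: w) = fun x =>
  (complex.Re a * repart v x + - complex.Im a * impart v x) +
  (complex.Re b * repart w x + - complex.Im b * impart w x).
Proof.
apply/funext => x; rewrite /repart /impart /=.
rewrite -[(a *: v + b *: w) x]/(a * v x + b * w x).
by case: a b (v x) (w x) => ? ? [? ?] [? ?] [? ?] /=; ring.
Qed.

Lemma impart_comb (a b : R[i]) v w : impart (a *: v + b *: w) = fun x =>
  (complex.Re a * impart v x + complex.Im a * repart v x) +
  (complex.Re b * impart w x + complex.Im b * repart w x).
Proof.
apply/funext => x; rewrite /repart /impart /=.
rewrite -[(a *: v + b *: w) x]/(a * v x + b * w x).
by case: a b (v x) (w x) => ? ? [? ?] [? ?] [? ?] /=; ring.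
Qed.

Lemma complexify_comb A B (a b : R[i]) v w : linear_on_tests A -> linear_on_tests B ->
  lc_dom space v -> lc_dom space w ->
  complexify A B (a *: v + b *: w) = a * complexify A B v + b * complexify A B w.
Proof.
move=> lA lB /(domP _ M_gt0)[r [r0 va vb]] /(domP _ M_gt0)[s [s0 wa wb]].
pose t := Num.max r s; have rt : r <= t by rewrite le_max lexx.
have st : s <= t by rewrite le_max lexx orbT.
have t0 : 0 <= t by apply: le_trans rt.
have {}va := test_le rt va; have {}vb := test_le rt vb.
have {}wa := test_le st wa; have {}wb := test_le st wb.
have comb (T : (R -> R) -> R) (f1 f2 f3 f4 : R -> R) c1 c2 c3 c4 : linear_on_tests T ->
    test t f1 -> test t f2 -> test t f3 -> test t f4 ->
    T (fun x => (c1 * f1 x + c2 * f2 x) + (c3 * f3 x + c4 * f4 x)) =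
    c1 * T f1 + c2 * T f2 + (c3 * T f3 + c4 * T f4).
  move=> lT t1 t2 t3 t4.
  have s1 : test t (fun x => c1 * f1 x + c2 * f2 x) by apply: testD => //; apply: testZ.
  have s2 : test t (fun x => c3 * f3 x + c4 * f4 x) by apply: testD => //; apply: testZ.
  have := lT t _ _ 1 1 t0 s1 s2; rewrite !mul1r.
  rewrite (lT t f1 f2 c1 c2 t0 t1 t2) (lT t f3 f4 c3 c4 t0 t3 t4) => <-.
  by congr T; apply/funext => x; rewrite !mul1r.
rewrite /complexify repart_comb impart_comb !comb //.
case: a b => a1 a2 [b1 b2] /=; apply/eqP; rewrite eq_complex /=.
by apply/andP; split; apply/eqP; ring.
Qed.

Definition pairing (F : R -> R) m g := \int[mu]_x (F x * derive1n m g x).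

Lemma pairingE F m r g : continuous F -> 0 <= r -> test r g ->
  pairing F m g = itg (- r) r (fun x => F x * derive1n m g x).
Proof.
move=> cF r0 [[sg _] rg]; apply: RintegralT_itg => //.
  by apply: contM => //; apply: smooth_continuous.
by move=> x rx; rewrite (supp_derive1n m sg rg) // mulr0.
Qed.

Lemma pairing_linear F m : continuous F -> linear_on_tests (pairing F m).
Proof.
move=> cF r f g c d r0 tf tg.
have [[sf _] _] := tf; have [[sg _] _] := tg.
have tt : test r (fun x => c * f x + d * g x) by apply: testD => //; apply: testZ.
have cf := smooth_continuous (n := m) sf; have cg := smooth_continuous (n := m) sg.
rewrite !(pairingE m cF r0) // -itgZ; last exact: contM.
rewrite -itgZ; last exact: contM.
rewrite -itgD; [|by apply/contZ/contM|by apply/contZ/contM].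
congr itg; apply/funext => x.
by rewrite derive1n_add ?derive1n_scale //; [ring|exact: smoothZ|exact: smoothZ].
Qed.

Definition partial_sum j n (F : nat -> R -> R) g := \sum_(j <= m < n) pairing (F m) m g.

Lemma partial_sum_linear j n F : (forall m, continuous (F m)) -> linear_on_tests (partial_sum j n F).
Proof.
move=> cF r f g c d r0 tf tg; rewrite /partial_sum !mulr_sumr -big_split /=.
by apply: eq_bigr => m _; exact: (pairing_linear m (cF m) c d r0 tf tg).
Qed.

Lemma linear_on_testsB A B : linear_on_tests A -> linear_on_tests B ->
  linear_on_tests (fun g => A g - B g).
Proof.
by move=> lA lB r f g c d r0 tf tg; rewrite (lA r) // (lB r) //; ring.
Qed.

(** The density and the test function are both split into real and imaginary parts; all four
    products are continuous with compact support, so that their integrals may be combined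
    linearly. *)
Lemma regular_ud_cderiv (F : cfun R) m phi : continuous (repart F) -> continuous (impart F) ->
  lc_dom space phi -> regular_ud F (cderiv m phi) =
  complexify (pairing (repart F) m) (pairing (impart F) m) phi.
Proof.
move=> ca cb /(domP _ M_gt0)[r [r0 ta tb]].
have [[sa _] za] := ta; have [[sb _] zb] := tb.
have da := smooth_continuous (n := m) sa; have db := smooth_continuous (n := m) sb.
have wa x : r < `|x| -> derive1n m (repart phi) x = 0 by exact: (supp_derive1n m sa za).
have wb x : r < `|x| -> derive1n m (impart phi) x = 0 by exact: (supp_derive1n m sb zb).
rewrite /complexify !(pairingE m _ r0) // /regular_ud /cint; congr Complex.
  rewrite -itgB; [|exact: contM|exact: contM].
  rewrite -RintegralT_itg //.
  - apply: eq_Rintegral => x _; rewrite /cderiv /repart /impart /=.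
    by case: (F x) => p q /=.
  - by apply: contB; apply: contM.
  - by move=> x rx; rewrite wa // wb // !mulr0 subrr.
rewrite -itgD; [|exact: contM|exact: contM].
rewrite -RintegralT_itg //.
- apply: eq_Rintegral => x _; rewrite /cderiv /repart /impart /=.
  by case: (F x) => p q /=.
- by apply: contD; apply: contM.
- by move=> x rx; rewrite wa // wb // !mulr0 addr0.
Qed.

Definition alternate (F : nat -> R -> R) m x := (-1) ^+ m * F m x.

Lemma sum_ud_deriv j n (F : nat -> cfun R) phi :
  (forall m, (j <= m)%N -> continuous (F m)) -> lc_dom space phi ->
  \sum_(j <= m < n) ud_deriv m (regular_ud (F m)) phi =
  complexify (partial_sum j n (alternate (fun m => repart (F m))))
             (partial_sum j n (alternate (fun m => impart (F m)))) phi.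
Proof.
move=> cF dphi; have [r [r0 ta tb]] := (domP _ M_gt0 _).1 dphi.
rewrite /complexify /partial_sum -sumrB -big_split /= -Complex_sum.
rewrite big_nat [RHS]big_nat; apply: eq_bigr => m /andP[jm _].
have [ca cb] := (continuous_cfunP _).1 (cF m jm).
rewrite /ud_deriv regular_ud_cderiv // /complexify.
have z s (G : R -> R) g : continuous G -> test r g -> pairing (fun x => s * G x) m g = s * pairing G m g.
  move=> cG tg; have [[sg _] _] := tg; rewrite !(pairingE m _ r0 tg) //; last exact: contZ.
  rewrite -itgZ; last by apply: contM => //; apply: smooth_continuous.
  by congr itg; apply/funext => x; rewrite mulrA.
have -> : (-1) ^+ m = ((-1) ^+ m)%:C%C :> R[i] by rewrite rmorphXn rmorphN1.
rewrite /alternate !z //; apply/eqP; rewrite eq_complex /=.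
by apply/andP; split; apply/eqP; ring.
Qed.

End Pairings.

(** * Bounds for the partial sums and for the parts of an ultradistribution *)

Section RealParts.
Context {R : realType}.
Variables (M : nat -> R) (star : ultra_case).
Hypothesis M_gt0 : forall p, 0 < M p.
Implicit Types (phi v w : cfun R) (g : R -> R) (x r c d q h e C B : R) (m n j : nat).
Local Notation test := (test_function M star).
Local Notation space := (ultra_space M star).
Local Notation space_on := (ultra_space_on M star).
Variable W : R -> R.
Hypothesis W_potter : potter W.

Let W0 x : 0 <= x -> 0 < W x. Proof. by have [h _] := W_potter; apply: h. Qed.
Let Wn x : 0 < W `|x|. Proof. exact: W0. Qed.

(** On [[-r, r]] the weight contributes [(1 + r)^m]. With [l h = 1 / (4 (1 + r))] the bounds
    [l^m / M m] of the density and [h^m M m] of the test function leave [4^-m]. *)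
Lemma pairing_bound q j (F : nat -> R -> R) r : 0 <= r -> (forall m, continuous (F m)) ->
  weighted_terms M star W q j F ->
  qu star (fun h => exists2 C, 0 <= C & forall g B m, (j <= m)%N -> test r g -> dbnd M g h B ->
    `|pairing (F m) m g| <= C * B * 4^-1 ^+ m).
Proof.
move=> r0 cF Fw.
have [_ /(_ 1 ltr01) [C1 C10 CW]] := W_potter.
have r1 : 0 < 1 + r by lra.
pose D := pw `|q| r * (C1 * (1 + r) * W r).
have D0 : 0 <= D by rewrite !mulr_ge0 ?(ltW (pw_gt0 _ _)) ?(ltW C10) ?(ltW r1) ?(ltW (W0 r0)).
have Wb x : `|x| <= r -> pw q x * W `|x| <= D.
  move=> xr; apply: ler_pM; rewrite ?(ltW (pw_gt0 _ _)) ?(ltW (Wn _)) //.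
    apply: (le_trans (ler_pw x (ler_norm q))).
    apply: ge0_ler_powR; rewrite ?nnegrE ?(ltW (norm1_gt0 _)) //.
    by rewrite lerD2l (ger0_norm r0).
  have [_ h] := CW _ _ (normr_ge0 x) xr; apply: le_trans h _.
  rewrite ler_wpM2r ?(ltW (W0 r0)) // ler_pM2l // powRr1; last first.
    by rewrite divr_ge0 ?(ltW r1) ?(ltW (norm1_gt0 x)).
  by rewrite ler_pdivrMr ?norm1_gt0 // ler_peMr ?(ltW r1) // lerDl.
have c0 : 0 < (4 * (1 + r))^-1 by rewrite invr_gt0 mulr_gt0.
apply: qu_inv c0 _ Fw => l l0 [C FC].
have C0 := weighted_terms_ge0 M_gt0 W_potter l0 FC.
exists (C * D * (r - - r)) => [|g B m jm tg gB].
  by apply: mulr_ge0; [exact: mulr_ge0|lra].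
have [[sg _] _] := tg; have B0 := dbnd_ge0 M_gt0 gB.
rewrite (pairingE m (cF m) r0 tg).
have rr : - r <= r by lra.
have cc : continuous (fun x => F m x * derive1n m g x) by apply: contM => //; apply: smooth_continuous.
apply: le_trans (itg_bound cc rr (B := C * D * B * 4^-1 ^+ m) _) _; last first.
  by rewrite le_eqVlt; apply/orP; left; apply/eqP; ring.
move=> x; rewrite -ler_norml => xr; rewrite normrM.
have lm : 0 < l ^+ m by rewrite exprn_gt0.
apply: (@le_trans _ _ (C * (l ^+ m / M m) * ((1 + r) ^+ m * D) * (B * ((4 * (1 + r))^-1 / l) ^+ m * M m))).
  apply: ler_pM => //; apply: le_trans (FC m x jm) _.
  rewrite ler_wpM2l ?mulr_ge0 ?invr_ge0 ?(ltW lm) ?(ltW (M_gt0 _)) //.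
  rewrite addrC pwD -mulrA; apply: ler_pM; rewrite ?(ltW (pw_gt0 _ _)) ?Wb //.
    by rewrite mulr_ge0 ?(ltW (pw_gt0 _ _)) ?(ltW (Wn _)).
  rewrite pwX; apply: lerXn2r; rewrite ?nnegrE ?(ltW (norm1_gt0 _)) ?(ltW r1) //.
  by rewrite lerD2l.
rewrite le_eqVlt; apply/orP; left; apply/eqP.
rewrite invfM !exprMn !exprVn; field.
by rewrite !expf_neq0 ?gt_eqF.
Qed.

Lemma partial_sum_tail q j (F : nat -> R -> R) (A : (R -> R) -> R) r : 0 <= r ->
  (forall m, continuous (F m)) -> weighted_terms M star W q j F -> represents M star j F A ->
  qu star (fun h => exists2 C, 0 <= C & forall g B n, (j <= n)%N -> test r g -> dbnd M g h B ->
    `|partial_sum j n F g - A g| <= C * B * 4^-1 ^+ n).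
Proof.
move=> r0 cF Fw FA; apply: qu_imp (pairing_bound r0 cF Fw) => h h0 [C C0 hC].
exists (2 * C) => [|g B n jn tg gB]; first exact: mulr_ge0.
have B0 := dbnd_ge0 M_gt0 gB.
have lim : tends (fun K => partial_sum j K F g) (A g).
  have := FA r g r0 tg; congr tends; apply/funext => K; apply: eq_bigr => m _.
  by rewrite (pairingE m (cF m) r0 tg).
rewrite distrC; apply: (tends_dist (j := n) lim) => K nK.
rewrite /partial_sum (big_cat_nat jn nK) /= addrAC subrr add0r.
apply: le_trans (ler_norm_sum _ _ _) _.
apply: (@le_trans _ _ (\sum_(n <= m < K) C * B * 4^-1 ^+ m)).
  rewrite big_nat [leRHS]big_nat; apply: ler_sum => m /andP[nm _].
  by apply: hC => //; apply: leq_trans nm.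
rewrite -mulr_sumr -[n in X in _ * X]add0n big_addn big_mkord.
under eq_bigr do rewrite addnC.
have -> : 2 * C * B * 4^-1 ^+ n = C * B * (2 * 4^-1 ^+ n) by ring.
rewrite ler_wpM2l ?mulr_ge0 //; apply: geometric_tail => //; lra.
Qed.

Lemma test_zero r : test r (fun=> 0).
Proof.
split=> //; split; first exact: smooth_zero.
rewrite /coqu; case: star => [h h0|]; last exists 1 => //;
  by exists 0 => m x; rewrite derive1n_zero normr0 !mul0r.
Qed.

(** Makes convergence at a single test function a consequence of strong convergence, which is all
    that the converse implication takes from it. *)
Lemma singleton_bounded phi : lc_dom space phi -> lc_bounded space [set phi].
Proof.
move=> dphi; split=> [_ -> //|U nU].
have [r [r0 ta tb]] := (domP _ M_gt0 _).1 dphi.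
have dK := test_dom_on M_gt0 ta tb.
have cK : compact (`[- r, r]%classic : set R) by exact: segment_compact.
have [sp sK fin] := (dom_onP _ _ _ _).1 dK.
have [h h0 [[e e0 he] nfin]] := qu_coqu (nbhs_elim M_gt0 cK nU) fin.
have [B B0 hB] := fin_bound nfin.
have [ra rb] := norm_dbnd M_gt0 h0 B0 sp sK hB.
pose c := e / (4 * (B + 1)).
have c0 : 0 < c by rewrite divr_gt0 // mulr_gt0 //; lra.
exists c => // _ ->.
have cE : c%:C%C *: phi = c%:C%C *: phi + 0%:C%C *: phi by rewrite scale0r addr0.
have re : repart (c%:C%C *: phi) = fun x => c * repart phi x.
  by rewrite cE repart_comb; apply/funext => x /=; ring.
have im : impart (c%:C%C *: phi) = fun x => c * impart phi x.
  by rewrite cE impart_comb; apply/funext => x /=; ring.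
apply: he.
  by apply: test_dom_on => //; rewrite ?re ?im; apply: testZ.
have [[sa _] _] := ta; have [[sb _] _] := tb.
have da : dbnd M (repart (c%:C%C *: phi)) h (c * B).
  by rewrite re -[c in c * B]gtr0_norm //; apply: dbndZ.
have db : dbnd M (impart (c%:C%C *: phi)) h (c * B).
  by rewrite im -[c in c * B]gtr0_norm //; apply: dbndZ.
apply: le_lt_trans (dbnd_norm M_gt0 _ h0 da db) _; rewrite lte_fin.
have -> : c * B + c * B = e * (2 * B / (4 * (B + 1))).
  by rewrite /c; field; rewrite gt_eqF //; lra.
rewrite gtr_pMr // ltr_pdivrMr; last by rewrite mulr_gt0 //; lra.
by rewrite mul1r; lra.
Qed.

Section Functional.
Variable f : cfun R -> R[i].
Hypothesis f_ud : ultradistribution M star f.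

Definition real_functional_re g := complex.Re (f (cpx g)).
Definition real_functional_im g := complex.Im (f (cpx g)).
Local Notation u := real_functional_re.
Local Notation w := real_functional_im.

Let f_lin (a : R[i]) phi psi : lc_dom space phi -> lc_dom space psi ->
  f (a *: phi + psi) = a * f phi + f psi.
Proof. by have [h _] := f_ud; apply: h. Qed.

Lemma ud_comb r g g' c d : 0 <= r -> test r g -> test r g' ->
  f (cpx (fun x => c * g x + d * g' x)) = c%:C%C * f (cpx g) + d%:C%C * f (cpx g').
Proof.
move=> r0 tg tg'.
have dg := dom_cpx M_gt0 r0 tg; have dg' := dom_cpx M_gt0 r0 tg'.
have d0 : lc_dom space (cpx (fun=> 0)) by apply: dom_cpx r0 (test_zero r).
have z0 : f (cpx (fun=> 0)) = 0.
  have := f_lin 1 d0 d0; rewrite scale1r mul1r.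
  have -> : cpx (fun=> 0) + cpx (fun=> 0) = cpx (fun=> 0) :> cfun R.
    by apply/funext => x; apply/eqP; rewrite eq_complex /= addr0 !eqxx.
  by move/eqP; rewrite -subr_eq0 opprD addrA subrr add0r oppr_eq0 => /eqP.
have cdom : lc_dom space (d%:C%C *: cpx g' + cpx (fun=> 0)).
  by have := dom_comb M_gt0 d%:C%C 1 dg' d0; rewrite scale1r.
have -> : cpx (fun x => c * g x + d * g' x) = c%:C%C *: cpx g + (d%:C%C *: cpx g' + cpx (fun=> 0)).
  apply/funext => x.
  rewrite -[RHS]/(c%:C%C * cpx g x + (d%:C%C * cpx g' x + cpx (fun=> 0) x)).
  by rewrite /cpx; apply/eqP; rewrite eq_complex /=; apply/andP; split; apply/eqP; ring.
by rewrite f_lin // f_lin // z0 addr0.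
Qed.

Lemma linear_re : linear_on_tests M star u.
Proof.
move=> r g g' c d r0 tg tg'; rewrite /u (ud_comb c d r0 tg tg').
by case: (f _) (f _) => ? ? [? ?] /=; ring.
Qed.

Lemma linear_im : linear_on_tests M star w.
Proof.
move=> r g g' c d r0 tg tg'; rewrite /w (ud_comb c d r0 tg tg').
by case: (f _) (f _) => ? ? [? ?] /=; ring.
Qed.

Lemma ud_complexify phi : lc_dom space phi -> f phi = complexify u w phi.
Proof.
move=> /(domP _ M_gt0)[r [r0 ta tb]].
have dg := dom_cpx M_gt0 r0 ta; have dg' := dom_cpx M_gt0 r0 tb.
have phiE : phi = Complex 0 1 *: cpx (impart phi) + cpx (repart phi).
  apply/funext => x.
  rewrite -[RHS]/(Complex 0 1 * cpx (impart phi) x + cpx (repart phi) x).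
  rewrite /cpx /repart /impart /=; case: (phi x) => a b; apply/eqP; rewrite eq_complex /=.
  by apply/andP; split; apply/eqP; ring.
rewrite {1}phiE f_lin // /complexify /u /w.
case: (f (cpx (impart phi))) (f (cpx (repart phi))) => a b [a' b'] /=; apply/eqP; rewrite eq_complex /=.
by apply/andP; split; apply/eqP; ring.
Qed.

Lemma ud_bound r : 0 < r -> qu star (fun h => exists C, forall g B,
  test r g -> dbnd M g h B -> normc (f (cpx g)) <= C * B).
Proof.
move=> r0; have [_ /(_ 1 ltr01) nU] := f_ud.
have cK : compact (`[- r, r]%classic : set R) by exact: segment_compact.
apply: qu_imp (nbhs_elim M_gt0 cK nU) => h h0 [e e0 he].
exists (2 / e) => g B tg gB; have B0 := dbnd_ge0 M_gt0 gB.
apply/ler_addgt0Pr => eps eps0.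
(* [B'] is positive even if [B = 0], so that one may divide by it; in the final estimate it costs
   just [eps]. *)
pose B' := B + eps * e / 2; have B'0 : 0 < B' by rewrite ltr_wpDl // divr_gt0 // mulr_gt0.
pose c := e / (2 * B'); have c0 : 0 < c by rewrite divr_gt0 // mulr_gt0.
have tz := test_zero r.
have fc : f (cpx (fun x => c * g x + 0 * 0)) = c%:C%C * f (cpx g).
  by have := ud_comb c 0 (ltW r0) tg tz; rewrite rmorph0 [0 * f _]mul0r addr0.
have gE : (fun x => c * g x + 0 * 0) = fun x => c * g x.
  by apply/funext => x; rewrite mulr0 addr0.
rewrite gE in fc.
have [[sg _] _] := tg.
have lt1 : normc (f (cpx (fun x => c * g x))) < 1.
  apply: he.
    by apply: test_dom_on; [exact: M_gt0|exact: (testZ c tg)|exact: tz].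
  have d1 : dbnd M (repart (cpx (fun x => c * g x))) h (c * B).
    by have := dbndZ c sg gB; rewrite (gtr0_norm c0).
  have d2 : dbnd M (impart (cpx (fun x => c * g x))) h 0.
    by move=> m x; rewrite (_ : impart _ = fun=> 0) // derive1n_zero normr0 !mul0r.
  apply: le_lt_trans (dbnd_norm M_gt0 _ h0 d1 d2) _; rewrite lte_fin addr0.
  have -> : c * B = e * (B / (2 * B')) by rewrite /c; ring.
  rewrite gtr_pMr // ltr_pdivrMr ?mulr_gt0 // mul1r.
  have : B <= B' by rewrite lerDl ltW // divr_gt0 // mulr_gt0.
  by lra.
move: lt1; rewrite fc normcM normcC gtr0_norm // mulrC -ltr_pdivlMr // mul1r => /ltW h1.
apply: le_trans h1 _; rewrite /c invf_div /B' le_eqVlt; apply/orP; left; apply/eqP.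
by field; rewrite gt_eqF.
Qed.

Lemma real_functional_of (A : (R -> R) -> R) : linear_on_tests M star A ->
  (forall g, `|A g| <= normc (f (cpx g))) -> real_functional M star A.
Proof.
move=> lA AB.
have rpos r : 0 <= Num.max 0 r by rewrite le_max lexx.
have rle r : r <= Num.max 0 r by rewrite le_max lexx orbT.
split.
- move=> r g g' tg tg'.
  have := lA _ _ _ 1 1 (rpos r) (test_le (rle r) tg) (test_le (rle r) tg').
  by rewrite !mul1r => <-; congr A; apply/funext => x; rewrite !mul1r.
- move=> r c g tg.
  have := lA _ _ _ c 0 (rpos r) (test_le (rle r) tg) (test_le (rle r) tg).
  by rewrite mul0r addr0 => <-; congr A; apply/funext => x; rewrite mul0r addr0.
- move=> r r0; apply: qu_imp (ud_bound r0) => h h0 [C hC]; exists C => g B tg gB.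
  by apply: le_trans (AB g) _; apply: hC.
Qed.

Lemma bigO_dilation q (L : R -> R) (rL : R) : (forall x, 0 <= x -> 0 < L x) ->
  (forall x, rL < x -> W x = L x) ->
  ud_bigO M star f (fun lam => lam `^ q * L lam) <->
  dilation_bounded M star W q u /\ dilation_bounded M star W q w.
Proof.
move=> L0 WL.
have dil lam phi : 0 < lam -> normc (ud_dilate lam f phi) = lam^-1 * normc (f (fun x => phi (x / lam))).
  by move=> l0; rewrite /ud_dilate normcM normcC gtr0_norm // invr_gt0.
have rpos r : 0 <= Num.max 0 r by rewrite le_max lexx.
have rle r : r <= Num.max 0 r by rewrite le_max lexx orbT.
split=> [h|[hu hw] phi dphi].
  have key r g : test r g -> exists C lam0, forall lam, lam0 <= lam ->
      normc (f (cpx (fun x => g (x / lam)))) <= C * (lam `^ (q + 1) * W lam).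
    move=> tp; have dp := dom_cpx M_gt0 (rpos r) (test_le (rle r) tp).
    have /bigO_pinftyP[C [lam0 hC]] := h _ dp.
    exists C, (Num.max (Num.max 1 lam0) (rL + 1)) => lam.
    rewrite !ge_max => /andP[/andP[l1 ll] lr]; have l0 : 0 < lam by lra.
    have := hC lam ll; rewrite dil // ger0_norm; last by rewrite mulr_ge0 ?normc_ge0 // invr_ge0 ltW.
    rewrite ger0_norm; last by rewrite mulr_ge0 ?powR_ge0 // ltW // L0 // ltW.
    rewrite mulrC ler_pdivrMr // => hh; apply: le_trans hh _.
    rewrite WL; last by lra.
    rewrite powRDp // powRr1 ?(ltW l0) // le_eqVlt; apply/orP; left; apply/eqP; ring.
  split=> r g tp; have [C [lam0 hC]] := key r g tp; exists C, lam0 => lam ll.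
    by apply: le_trans (hC lam ll); apply: normc_re.
  by apply: le_trans (hC lam ll); apply: normc_im.
have [r [r0 ta tb]] := (domP _ M_gt0 _).1 dphi.
have [C1 [l1 h1]] := hu _ _ ta; have [C2 [l2 h2]] := hu _ _ tb.
have [C3 [l3 h3]] := hw _ _ ta; have [C4 [l4 h4]] := hw _ _ tb.
apply/bigO_pinftyP; exists (C1 + C4 + (C2 + C3)).
exists (Num.max (Num.max (Num.max l1 l2) (Num.max l3 l4)) (Num.max 1 (rL + 1))) => lam.
rewrite !ge_max => /andP[/andP[/andP[ll1 ll2] /andP[ll3 ll4]] /andP[lam1 lr]].
have l0 : 0 < lam by lra.
rewrite dil // ger0_norm; last by rewrite mulr_ge0 ?normc_ge0 // invr_ge0 ltW.
rewrite ger0_norm; last by rewrite mulr_ge0 ?powR_ge0 // ltW // L0 // ltW.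
rewrite mulrC ler_pdivrMr //.
have dl : lc_dom space (fun x => phi (x / lam)).
  apply/domP => //; exists (r * lam); split; first by rewrite mulr_ge0 // ltW.
    exact: (test_div l0 ta).
  exact: (test_div l0 tb).
rewrite (ud_complexify dl); apply: le_trans (normc_le _) _; rewrite /complexify /=.
have -> : (C1 + C4 + (C2 + C3)) * (lam `^ q * L lam) * lam =
   C1 * (lam `^ (q + 1) * W lam) + C4 * (lam `^ (q + 1) * W lam) +
   (C2 * (lam `^ (q + 1) * W lam) + C3 * (lam `^ (q + 1) * W lam)).
  rewrite (WL lam); last by lra.
  by rewrite powRDp // powRr1 ?(ltW l0) //; ring.
apply: lerD.
  by apply: le_trans (ler_normB _ _) _; apply: lerD; [exact: h1|exact: h4].
by apply: le_trans (ler_normD _ _) _; apply: lerD; [exact: h2|exact: h3].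
Qed.

End Functional.

End RealParts.

(** * Convergence in the strong dual *)

Section StrongSum.
Context {R : realType}.
Variables (M : nat -> R) (star : ultra_case).
Hypothesis M_gt0 : forall p, 0 < M p.
Implicit Types (phi v : cfun R) (g : R -> R) (x r c d q h e C B : R) (m n j : nat).
Local Notation test := (test_function M star).
Local Notation space := (ultra_space M star).
Local Notation space_on := (ultra_space_on M star).
Variable W : R -> R.
Hypothesis W_potter : potter W.
Variable f : cfun R -> R[i].
Hypothesis f_ud : ultradistribution M star f.
Local Notation u := (real_functional_re f).
Local Notation w := (real_functional_im f).

Lemma qu_and_anti (P Q : R -> Prop) : (forall h h', 0 < h -> h <= h' -> P h' -> P h) ->
  (forall h h', 0 < h -> h <= h' -> Q h' -> Q h) ->
  qu star P -> qu star Q -> qu star (fun h => P h /\ Q h).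
Proof.
rewrite /qu => Pm Qm; case: star => [[h h0 Ph] [k k0 Qk]|Pa Qa h h0]; last by split; [exact: Pa|exact: Qa].
have hk : 0 < Num.min h k by rewrite lt_min h0.
exists (Num.min h k) => //.
by split; [apply: Pm hk _ Ph; rewrite ge_min lexx|apply: Qm hk _ Qk; rewrite ge_min lexx orbT].
Qed.

Variables (q : R) (j : nat) (Fu Fw : nat -> R -> R).
Hypotheses (Fu_cont : forall m, continuous (Fu m)) (Fw_cont : forall m, continuous (Fw m))
  (Fu_weight : weighted_terms M star W q j Fu) (Fw_weight : weighted_terms M star W q j Fw)
  (Fu_rep : represents M star j Fu u) (Fw_rep : represents M star j Fw w).

Definition tail n := complexify (fun g => partial_sum j n Fu g - u g) (fun g => partial_sum j n Fw g - w g).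

Let lin_u n : linear_on_tests M star (fun g => partial_sum j n Fu g - u g).
Proof. by apply: linear_on_testsB; [exact: partial_sum_linear|exact: linear_re]. Qed.

Let lin_w n : linear_on_tests M star (fun g => partial_sum j n Fw g - w g).
Proof. by apply: linear_on_testsB; [exact: partial_sum_linear|exact: linear_im]. Qed.

(* This set absorbs every bounded set, whence convergence is uniform on bounded sets. *)
Lemma tail_nbhs : lc_nbhs0 space
  [set v | lc_dom space v /\ forall n, (j <= n)%N -> normc (tail n v) <= 2^-1 ^+ n].
Proof.
apply: nbhs_intro => //.
  move=> a b v v' ab [dv hv] [dv' hv']; split; first exact: dom_comb.
  move=> n jn; rewrite /tail (complexify_comb M_gt0 a b (lin_u n) (lin_w n) dv dv'); apply: le_trans (normcD _ _) _; rewrite !normcM.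
  apply: (@le_trans _ _ ((normc a + normc b) * 2^-1 ^+ n)).
    by rewrite mulrDl; apply: lerD; [exact: ler_wpM2l (normc_ge0 a) _ _ (hv n jn)|exact: ler_wpM2l (normc_ge0 b) _ _ (hv' n jn)].
  by rewrite ler_piMl // exprn_ge0.
move=> K cK; have [r r0 Kr] := compact_ball cK.
have anti (F : nat -> R -> R) (A : (R -> R) -> R) h h' : 0 < h -> h <= h' ->
    (exists2 C, 0 <= C & forall g B n, (j <= n)%N -> test r g -> dbnd M g h' B ->
      `|partial_sum j n F g - A g| <= C * B * 4^-1 ^+ n) ->
    (exists2 C, 0 <= C & forall g B n, (j <= n)%N -> test r g -> dbnd M g h B ->
      `|partial_sum j n F g - A g| <= C * B * 4^-1 ^+ n).
  move=> h0 hh [C C0 hC]; exists C => // g B n jn tg gB; apply: hC => //.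
  exact: (dbnd_le M_gt0 h0 hh (lexx B) gB).
have tu := partial_sum_tail M_gt0 W_potter r0 Fu_cont Fu_weight Fu_rep.
have tw := partial_sum_tail M_gt0 W_potter r0 Fw_cont Fw_weight Fw_rep.
apply: qu_imp (qu_and_anti (@anti Fu u) (@anti Fw w) tu tw) => h h0 [[C1 C10 h1] [C2 C20 h2]].
pose D := C1 + C2 + 1; have D0 : 0 < D by rewrite /D; lra.
have e0 : 0 < (2 * D)^-1 by rewrite invr_gt0 mulr_gt0.
exists (2 * D)^-1 => // v dv nv.
have [sp sK _] := (dom_onP _ _ _ _).1 dv.
have [ta tb] := dom_on_test M_gt0 Kr dv.
have [ba bb] := norm_dbnd M_gt0 h0 (ltW e0) sp sK (ltW nv).
split; first by exists K.
move=> n jn; apply: le_trans (normc_le _) _; rewrite /tail /complexify /=.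
have q0 : 0 <= 4^-1 ^+ n :> R by rewrite exprn_ge0.
have e4 : 4^-1 ^+ n <= 2^-1 ^+ n :> R.
  by rewrite lerXn2r ?nnegrE //; lra.
apply: (@le_trans _ _ (4^-1 ^+ n)) => //.
apply: (@le_trans _ _ (((C1 * (2 * D)^-1 * 4^-1 ^+ n) + (C2 * (2 * D)^-1 * 4^-1 ^+ n)) +
    ((C1 * (2 * D)^-1 * 4^-1 ^+ n) + (C2 * (2 * D)^-1 * 4^-1 ^+ n)))).
  apply: lerD.
    by apply: le_trans (ler_normB _ _) _; apply: lerD; [exact: h1|exact: h2].
  by apply: le_trans (ler_normD _ _) _; apply: lerD; [exact: h1|exact: h2].
have -> : (C1 * (2 * D)^-1 * 4^-1 ^+ n + C2 * (2 * D)^-1 * 4^-1 ^+ n) +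
    (C1 * (2 * D)^-1 * 4^-1 ^+ n + C2 * (2 * D)^-1 * 4^-1 ^+ n) =
    ((C1 + C2) / D) * 4^-1 ^+ n.
  by field; rewrite gt_eqF.
by rewrite ler_piMl // ler_pdivrMr // mul1r /D lerDl.
Qed.

Lemma strong_sum (F : nat -> cfun R) : (forall m, (j <= m)%N -> continuous (F m)) ->
  (forall m, (j <= m)%N -> alternate (fun m => repart (F m)) m = Fu m) ->
  (forall m, (j <= m)%N -> alternate (fun m => impart (F m)) m = Fw m) ->
  ud_sum M star j (fun m => ud_deriv m (regular_ud (F m))) f.
Proof.
move=> cF Fa Fb B [Bdom Babs] e e0.
(* Boundedness of [B] scales it into the neighbourhood [tail_nbhs], where the tails are at most
   [2^-n]; on [B] itself they are then at most [2^-n / c], uniformly. *)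
have [c c0 hc] := Babs _ tail_nbhs.
have sums n v : lc_dom space v ->
    \sum_(j <= m < n) ud_deriv m (regular_ud (F m)) v - f v = tail n v.
  move=> dv; rewrite (sum_ud_deriv M_gt0 n cF dv) (ud_complexify M_gt0 f_ud dv) /tail /complexify.
  have pE G G' g : (forall m, (j <= m)%N -> G m = G' m) -> partial_sum j n G g = partial_sum j n G' g.
    by move=> GG; rewrite /partial_sum big_nat [RHS]big_nat; apply: eq_bigr => m /andP[jm _]; rewrite GG.
  rewrite !(pE _ _ _ Fa) !(pE _ _ _ Fb).
  by apply/eqP; rewrite eq_complex /=; apply/andP; split; apply/eqP; ring.
have [N hN] := tends_half (mulr_gt0 c0 e0).
near=> n => v Bv; have dv := Bdom v Bv.
have [dcv hcv] := hc v Bv.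
have jn : (j <= n)%N by near: n; exact: nbhs_infty_ge.
have Nn : (N <= n)%N by near: n; exact: nbhs_infty_ge.
have := hcv n jn; have := hN n Nn; rewrite subr0 ger0_norm ?exprn_ge0 // => pn.
rewrite sums //.
have -> : c%:C%C *: v = c%:C%C *: v + 0 *: v by rewrite scale0r addr0.
rewrite /tail (complexify_comb M_gt0 c%:C%C 0 (lin_u n) (lin_w n) dv dv) mul0r addr0 normcM normcC gtr0_norm // => h.
by have := le_trans h pn; rewrite ler_pM2l.
Unshelve. all: by end_near. Qed.

End StrongSum.

(** * From real functionals back to the ultradistribution *)

Theorem theorem3 (R : realType) (M : nat -> R)
    (M_gt0 : forall p, 0 < M p)
    (M1 : cond_M1 M) (M2' : cond_M2' M) (M3' : cond_M3' M)
    (star : ultra_case) (f : cfun R -> R[i])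
    (f_ud : ultradistribution M star f)
    (q : R) (L : R -> R)
    (L_loc : Linfty_loc L) (L_slow : O_slowly_varying L)
    (L_low : locally_bounded_below L)
    (k : nat) (k_gt0 : (0 < k)%N) (k_le : - k%:R <= q)
    (k_min : forall j : nat, (0 < j)%N -> - j%:R <= q -> (k <= j)%N) :
  ud_bigO M star f (fun lam => lam `^ q * L lam) <->
  exists F : nat -> cfun R,
    [/\ forall m, (k.-1 <= m)%N -> continuous (F m),
        ud_sum M star k.-1 (fun m => ud_deriv m (regular_ud (F m))) f,
        structure_bound star M q L k.-1 F &
        q = - k%:R ->
          bigO_pinfty (fun x => normc (cint `[- x, x] (F k.-1))) L].
Proof.
have [W [Wp [rL WL] [C0 C00 WCL] WF]] := potter_weight L_loc L_slow L_low.
have [L0 _ _] := L_slow.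
have W0 x : 0 <= x -> 0 < W x by case: Wp => h _; apply: h.
have lin_u := linear_re M_gt0 f_ud; have lin_w := linear_im M_gt0 f_ud.
have f_re := real_functional_of M_gt0 f_ud lin_u (fun g => normc_re _).
have f_im := real_functional_of M_gt0 f_ud lin_w (fun g => normc_im _).
have dil := bigO_dilation M_gt0 f_ud q L0 WL.
split.
  move=> /dil[du dw].
  (* If [q + i + 1 >= 0], then [i + 1 < k] would satisfy the condition that defines [k], against
     minimality. *)
  have qk i : (i < k.-1)%N -> q + i%:R + 1 < 0.
    move=> ik; rewrite ltNge; apply/negP => qi.
    have := k_min i.+1 isT; rewrite -natr1 => /(_ _).
    have h : - (i%:R + 1) <= q by lra.
    by move=> /(_ h); move: ik k_gt0; clear; lia.
  have [Fu [uc uw ur ui]] := real_structure M_gt0 M1 M2' M3' Wp k_gt0 qk f_re du.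
  have [Fw [wc ww wr wi]] := real_structure M_gt0 M1 M2' M3' Wp k_gt0 qk f_im dw.
  (* The sign that [represents] absorbs into the densities is restored. *)
  pose F m : cfun R := fun x => Complex ((-1) ^+ m * Fu m x) ((-1) ^+ m * Fw m x).
  have sgn m (y : R) : `|(-1) ^+ m * y| = `|y| by rewrite normrM normrX normrN1 expr1n mul1r.
  have cF m : continuous (F m).
    by apply/continuous_cfunP; split; apply: contZ.
  exists F; split=> //.
  - apply: (strong_sum M_gt0 Wp f_ud uc wc uw ww ur wr) => // m _; apply/funext => x;
      by rewrite /alternate /repart /impart /= mulrA -exprMn mulrNN mulr1 expr1n mul1r.
  - have mono (G : nat -> R -> R) l l' : 0 < l -> l <= l' -> (exists C, forall m x, (k.-1 <= m)%N ->
          `|G m x| <= C * (l ^+ m / M m) * (pw (q + m%:R) x * W `|x|)) ->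
        (exists C, forall m x, (k.-1 <= m)%N ->
          `|G m x| <= C * (l' ^+ m / M m) * (pw (q + m%:R) x * W `|x|)).
      move=> l0 ll [C GC]; have Cp := weighted_terms_ge0 M_gt0 Wp l0 GC.
      exists C => m x km; apply: le_trans (GC m x km) _.
      rewrite ler_wpM2r ?mulr_ge0 ?(ltW (pw_gt0 _ _)) ?(ltW (W0 _ _)) //.
      rewrite ler_wpM2l // ler_wpM2r ?invr_ge0 ?(ltW (M_gt0 _)) //.
      by rewrite lerXn2r ?nnegrE ?(ltW l0) // (le_trans (ltW l0)).
    have := qu_imp _ (qu_and (mono Fu) (mono Fw) uw ww).
    move=> /(_ (fun l => exists2 C : R, 0 < C & forall m x, (k.-1 <= m)%N ->
      normc (F m x) <= C * (l ^+ m / M m) * (1 + `|x|) `^ (q + m%:R) * L `|x|)).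
    apply => l l0 [[C1 h1] [C2 h2]].
    have C10 := weighted_terms_ge0 M_gt0 Wp l0 h1; have C20 := weighted_terms_ge0 M_gt0 Wp l0 h2.
    exists ((C1 + C2 + 1) * C0) => [|m x km]; first by rewrite mulr_gt0 //; lra.
    apply: le_trans (normc_le _) _; rewrite /= !sgn.
    apply: le_trans (lerD (h1 m x km) (h2 m x km)) _; rewrite -!mulrDl.
    have lm : 0 <= l ^+ m / M m by rewrite divr_ge0 ?exprn_ge0 ?(ltW l0) ?(ltW (M_gt0 _)).
    have -> : (C1 + C2 + 1) * C0 * (l ^+ m / M m) * (1 + `|x|) `^ (q + m%:R) * L `|x| =
      (C1 + C2 + 1) * (l ^+ m / M m) * (pw (q + m%:R) x * (C0 * L `|x|)) by rewrite /pw; ring.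
    apply: ler_pM.
    - exact: mulr_ge0 (addr_ge0 C10 C20) lm.
    - exact: mulr_ge0 (ltW (pw_gt0 _ _)) (ltW (W0 _ (normr_ge0 x))).
    - by apply: ler_wpM2r => //; rewrite lerDl.
    - by apply: ler_wpM2l; [exact: ltW (pw_gt0 _ _)|exact: WCL].
  - move=> qE; have [C1 [l1 h1]] := ui qE; have [C2 [l2 h2]] := wi qE.
    apply/bigO_pinftyP; exists (C1 + C2), (Num.max (Num.max l1 l2) (Num.max 0 (rL + 1))) => x.
    rewrite !ge_max => /andP[/andP[x1 x2] /andP[x0 xr]].
    rewrite ger0_norm ?normc_ge0 // ger0_norm ?(ltW (L0 _ _)) // -WL; last by lra.
    apply: le_trans (normc_le _) _; rewrite /cint /= mulrDl.
    have xx : - x <= x by lra.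
    apply: lerD; rewrite itgE ?itgZ ?sgn ?h1 ?h2 //; exact: contZ.
move=> [F [cF Fsum Fbound Fint]]; apply/dil.
pose j := k.-1.
have qj : -1 <= q + j%:R.
  have kj : k%:R = j%:R + 1 :> R by rewrite natr1 prednK.
  by move: k_le; rewrite kj; lra.
(* Nothing is assumed about [F m] for [m < j]; the value [0] there makes every density continuous,
   as the real theory requires. *)
pose G (part : cfun R -> R -> R) m x := if (m < j)%N then 0 else (-1) ^+ m * part (F m) x.
have GE part m : (j <= m)%N -> alternate (fun m => part (F m)) m = G part m.
  by move=> jm; apply/funext => x; rewrite /G ltnNge jm.
have Gc part : (forall m, (j <= m)%N -> continuous (part (F m))) -> forall m, continuous (G part m).
  move=> pc m; rewrite /G; case: ltnP => jm; first exact: cont_cst.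
  exact/contZ/pc.
have cr m : (j <= m)%N -> continuous (repart (F m)) by move=> jm; have [] := (continuous_cfunP _).1 (cF m jm).
have ci m : (j <= m)%N -> continuous (impart (F m)) by move=> jm; have [] := (continuous_cfunP _).1 (cF m jm).
have sgn m (y : R) : `|(-1) ^+ m * y| = `|y| by rewrite normrM normrX normrN1 expr1n mul1r.
have Gw part : (forall m, (j <= m)%N -> continuous (part (F m))) ->
    (forall m x, `|part (F m) x| <= normc (F m x)) -> weighted_terms M star W q j (G part).
  move=> pc pn.
  have Fq : qu star (fun l => exists2 C : R, 0 < C & forall m x, (j <= m)%N ->
      normc (F m x) <= C * (l ^+ m / M m) * (1 + `|x|) `^ (q + m%:R) * L `|x|) by exact: Fbound.
  apply: qu_imp Fq => l l0 [C C1 FC]; exists C => m x jm; rewrite /G ltnNge jm /= sgn.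
  apply: WF; [exact: pc|by rewrite mulr_ge0 ?divr_ge0 ?exprn_ge0 ?(ltW l0) ?(ltW (M_gt0 _)) ?(ltW C1)|].
  by move=> y; apply: le_trans (pn m y) _; rewrite /pw mulrA; apply: FC.
(* The alternative [x < 0] sets aside the case where [[-x, x]] is empty and [cint] does not agree
   with the oriented integral. *)
have Gi part A : (forall m, (j <= m)%N -> continuous (part (F m))) ->
    (forall x, `|itg (- x) x (part (F j))| <= normc (cint `[- x, x] (F j)) \/ x < 0) ->
    A = q + j%:R -> A = -1 -> exists C lam0, forall lam, lam0 <= lam ->
      `|itg (- lam) lam (G part j)| <= C * W lam.
  move=> pc pi -> qE; have qk : q = - k%:R by rewrite -(prednK k_gt0) -natr1 -/j; lra.
  have /bigO_pinftyP[C [l1 hC]] := Fint qk.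
  exists C, (Num.max l1 (Num.max 0 (rL + 1))) => x; rewrite !ge_max => /andP[x1 /andP[x0 xr]].
  have -> : G part j = fun x => (-1) ^+ j * part (F j) x by apply/funext => y; rewrite /G ltnn.
  rewrite itgZ ?sgn; last exact: pc.
  case: (pi x) => [h|]; last by rewrite ltNge x0.
  apply: le_trans h _; have := hC x x1; rewrite ger0_norm ?normc_ge0 // ger0_norm ?(ltW (L0 _ _)) //.
  by rewrite -WL //; lra.
(* Strong convergence is evaluated at the real test function [g], seen as a complex one; its real
   and imaginary parts then give the representations of the two real functionals. *)
have rep r g : 0 <= r -> test_function M star r g ->
    forall e : R, 0 < e -> exists N, forall n, (N <= n)%N ->
      normc (complexify (partial_sum j n (G repart)) (partial_sum j n (G impart)) (cpx g) - f (cpx g)) <= e.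
  move=> r0 tg e e0; have dg := dom_cpx M_gt0 r0 tg.
  have [N _ hN] := Fsum _ (singleton_bounded M_gt0 dg) e e0.
  exists N => n Nn; have := hN n Nn (cpx g) erefl; rewrite (sum_ud_deriv M_gt0 n cF dg).
  have pE part g' : partial_sum j n (alternate (fun m => part (F m))) g' = partial_sum j n (G part) g'.
    by rewrite /partial_sum big_nat [RHS]big_nat; apply: eq_bigr => m /andP[jm _]; rewrite GE.
  by rewrite /complexify !(pE repart) !(pE impart).
have p0 n part : (forall m, (j <= m)%N -> continuous (part (F m))) -> partial_sum j n (G part) (fun=> 0) = 0.
  move=> pc; have tz := test_zero M star 0.
  have := partial_sum_linear M_gt0 j n (Gc _ pc) 0 0 (lexx 0) tz tz.
  have zE : (fun _ : R => 0 * 0 + 0 * 0) = fun=> 0 :> R by apply/funext => y; rewrite mul0r addr0.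
  by rewrite zE !mul0r addr0.
have imz g : impart (cpx g) = fun=> 0 by [].
have rez g : repart (cpx g) = g by [].
have psE part r g n : (forall m, (j <= m)%N -> continuous (part (F m))) -> 0 <= r -> test_function M star r g ->
    \sum_(j <= m < n) itg (- r) r (fun x => G part m x * derive1n m g x) = partial_sum j n (G part) g.
  by move=> pc r0 tg; apply: eq_bigr => m _; rewrite (pairingE m (Gc _ pc m) r0 tg).
have ru : represents M star j (G repart) (real_functional_re f).
  move=> r g r0 tg e e0; have [N hN] := rep r g r0 tg e e0; exists N => n Nn.
  apply: le_trans (hN n Nn); apply: le_trans (normc_re _); rewrite (psE _ _ _ _ cr r0 tg).
  rewrite /complexify imz rez !p0 // subr0 add0r /real_functional_re.
  by case: (f _) => a b /=.
have rw : represents M star j (G impart) (real_functional_im f).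
  move=> r g r0 tg e e0; have [N hN] := rep r g r0 tg e e0; exists N => n Nn.
  apply: le_trans (hN n Nn); apply: le_trans (normc_im _); rewrite (psE _ _ _ _ ci r0 tg).
  rewrite /complexify imz rez !p0 // subr0 add0r /real_functional_im.
  by case: (f _) => a b /=.
have intr x : `|itg (- x) x (repart (F j))| <= normc (cint `[- x, x] (F j)) \/ x < 0.
  have [x0|] := leP 0 x; [left|by right].
  have xx : - x <= x by lra.
  rewrite -(itgE (cr j (leqnn j)) xx); exact: (normc_re (cint `[- x, x] (F j))).
have inti x : `|itg (- x) x (impart (F j))| <= normc (cint `[- x, x] (F j)) \/ x < 0.
  have [x0|] := leP 0 x; [left|by right].
  have xx : - x <= x by lra.
  rewrite -(itgE (ci j (leqnn j)) xx); exact: (normc_im (cint `[- x, x] (F j))).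
split.
  apply: (real_structure_converse M_gt0 Wp qj (Gc _ cr) (Gw _ cr _) ru (Gi _ _ cr intr erefl)).
  by move=> m x; apply: normc_re.
apply: (real_structure_converse M_gt0 Wp qj (Gc _ ci) (Gw _ ci _) rw (Gi _ _ ci inti erefl)).
by move=> m x; apply: normc_im.
Qed.
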